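(* For any fixed positive integer $K$, the following promise problem is PSPACE-complete: given a single-sink DAG $G$ of fan-in at most $2$ and an integer $s$, decide whether the pebbling price of $G$ is at most $s$ or at least $s+K$. This holds both for the standard pebbling price and for the reversible pebbling price.
   Context: All graphs are finite DAGs; $\mathrm{pred}(v)$ is the set of immediate predecessors of $v$; fan-in at most $2$ means $|\mathrm{pred}(v)|\le 2$. A standard pebbling is a sequence of vertex sets $P_0,\dots,P_\tau$, each obtained from the previous by placing a pebble on some $v\notin P$ with $\mathrm{pred}(v)\subseteq P$ or removing a pebble from any $v\in P$. A reversible pebbling is the same but removal from $v$ is allowed only if $\mathrm{pred}(v)\subseteq P$. The space is $\max_t|P_t|$. For a DAG with unique sink $z$, the standard (resp. reversible) pebbling price is the minimum space of a standard (resp. reversible) pebbling with $P_0=\emptyset$ and $P_\tau=\{z\}$. *)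

(* Defs.v *)
From mathcomp Require Import all_boot all_order all_algebra.

Set Implicit Arguments.
Unset Strict Implicit.
Unset Printing Implicit Defensive.

Local Open Scope nat_scope.

(** * Deterministic multi-tape Turing machines *)

(* [None] is the blank, [Some (inl b)] an input/output bit, and [Some (inr a)]
   an auxiliary symbol. *)
Definition symbol (A : Type) : Type := option (bool + A).

Definition bit (A : Type) (b : bool) : symbol A := Some (inl b).

Variant direction := MoveL | MoveR | Stay.

(* A two-way infinite tape, blank outside the recorded window: the cells to the
   left of the head (nearest first), the scanned cell, the cells to its right.
   The window consists of the input cells and of every cell visited so far, so
   that its width measures the space used on the tape. *)
Record tape (A : Type) := Tape {
  tleft : seq (symbol A);
  thead : symbol A;
  tright : seq (symbol A)
}.

Definition tape_of_seq A (s : seq (symbol A)) : tape A :=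
  Tape [::] (head None s) (behead s).

Definition tape_size A (T : tape A) : nat :=
  (size (tleft T) + size (tright T)).+1.

Definition tape_write A (a : symbol A) (T : tape A) : tape A :=
  Tape (tleft T) a (tright T).

Definition tape_move A (d : direction) (T : tape A) : tape A :=
  match d with
  | MoveL => Tape (behead (tleft T)) (head None (tleft T)) (thead T :: tright T)
  | MoveR => Tape (thead T :: tleft T) (head None (tright T)) (behead (tright T))
  | Stay => T
  end.

Fixpoint leading_bits A (s : seq (symbol A)) : seq bool :=
  if s is Some (inl b) :: s' then b :: leading_bits s' else [::].

(* [tm_trans q a = None] means that the machine halts. *)
Record turing_machine := TuringMachine {
  tm_tapes : nat;  (* number of tapes minus one *)
  tm_work : finType;
  tm_state : finType;
  tm_start : tm_state;
  tm_accept : pred tm_state;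
  tm_trans : tm_state -> {ffun 'I_tm_tapes.+1 -> symbol tm_work} ->
    option (tm_state * {ffun 'I_tm_tapes.+1 -> symbol tm_work * direction})
}.

Record config (M : turing_machine) := Config {
  cstate : tm_state M;
  ctapes : {ffun 'I_(tm_tapes M).+1 -> tape (tm_work M)}
}.

Definition step (M : turing_machine) (c : config M) : option (config M) :=
  match tm_trans (cstate c) [ffun i => thead (ctapes c i)] with
  | None => None
  | Some (q, act) => Some (Config q
      [ffun i => tape_move (act i).2 (tape_write (act i).1 (ctapes c i))])
  end.

Definition halted (M : turing_machine) (c : config M) : bool :=
  ~~ isSome (step c).

Definition init (M : turing_machine) (w : seq bool) : config M :=
  Config (tm_start M)
    [ffun i => tape_of_seq (if i == ord0 then map (bit (tm_work M)) w else [::])].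

(* A halted machine keeps its configuration. *)
Definition run (M : turing_machine) (w : seq bool) (t : nat) : config M :=
  iter t (fun c => odflt c (step c)) (init M w).

Definition space (M : turing_machine) (c : config M) : nat :=
  \sum_i tape_size (ctapes c i).

(* The bits on the first tape from the head up to the first non-bit symbol. *)
Definition output (M : turing_machine) (c : config M) : seq bool :=
  leading_bits (thead (ctapes c ord0) :: tright (ctapes c ord0)).

(** * Promise problems, PSPACE and polynomial-time reductions *)

(* Disjointness of the two sets is not recorded: it follows from membership in
   PSPACE, and is therefore part of PSPACE-completeness. *)
Record promise_problem := PromiseProblem {
  yes_instance : seq bool -> Prop;
  no_instance : seq bool -> Prop
}.

Definition PSPACE (Q : promise_problem) : Prop :=
  exists (M : turing_machine) (p : {poly nat}), forall w : seq bool,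
    [/\ exists t, halted (run M w t),
        forall t, space (run M w t) <= p.[size w]%R,
        yes_instance Q w ->
          forall t, halted (run M w t) -> tm_accept (cstate (run M w t))
      & no_instance Q w ->
          forall t, halted (run M w t) -> ~~ tm_accept (cstate (run M w t))].

Definition polytime_computable (f : seq bool -> seq bool) : Prop :=
  exists (M : turing_machine) (p : {poly nat}), forall w : seq bool,
    exists t, [/\ t <= p.[size w]%R, halted (run M w t)
                & output (run M w t) = f w].

Definition karp_reducible (Q Q' : promise_problem) : Prop :=
  exists f : seq bool -> seq bool,
    [/\ polytime_computable f,
        forall w, yes_instance Q w -> yes_instance Q' (f w)
      & forall w, no_instance Q w -> no_instance Q' (f w)].

Definition PSPACE_hard (Q : promise_problem) : Prop :=
  forall Q', PSPACE Q' -> karp_reducible Q' Q.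

Definition PSPACE_complete (Q : promise_problem) : Prop :=
  PSPACE Q /\ PSPACE_hard Q.

(** * Directed graphs and pebblings; [e u v] is the edge from [u] to [v] *)

Section Pebbling.
Variables (V : finType) (e : rel V).

Definition acyclic : Prop := forall c : seq V, cycle e c -> c = [::].

Definition preds (v : V) : {set V} := [set u | e u v].

Definition fan_in_le (d : nat) : Prop := forall v, #|preds v| <= d.

Definition is_sink (v : V) : Prop := forall w, ~~ e v w.

Definition unique_sink (z : V) : Prop := forall v, is_sink v <-> v = z.

Definition placement (P P' : {set V}) : bool :=
  [exists v, [&& v \notin P, preds v \subset P & P' == v |: P]].

Definition standard_move (P P' : {set V}) : bool :=
  placement P P' || [exists v, (v \in P) && (P' == P :\ v)].

Definition reversible_move (P P' : {set V}) : bool :=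
  placement P P' ||
  [exists v, [&& v \in P, preds v \subset P & P' == P :\ v]].

(* The configurations are P_0 = set0 followed by the members of [Ps]. *)
Definition pebbling (move : rel {set V}) (z : V) (Ps : seq {set V}) : bool :=
  path move set0 Ps && (last set0 Ps == [set z]).

Definition pebbling_space (Ps : seq {set V}) : nat :=
  \max_(P <- set0 :: Ps) #|P|.

Definition is_pebbling_price (move : rel {set V}) (z : V) (k : nat) : Prop :=
  (exists2 Ps, pebbling move z Ps & pebbling_space Ps = k) /\
  (forall Ps, pebbling move z Ps -> k <= pebbling_space Ps).

End Pebbling.

(** * The gap problem for pebbling price *)

(* Least significant bit first; [nat_bits 0 = [:: false]]. *)
Definition nat_bits (m : nat) : seq bool :=
  mkseq (fun i => odd (m %/ 2 ^ i)) (trunc_log 2 m).+1.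

Definition int_bits (s : int) : seq bool := (s < 0)%R :: nat_bits `|s|.

(* The number of vertices in unary, the adjacency matrix by rows, and the bound
   in binary with its sign. *)
Definition encode (n : nat) (e : rel 'I_n) (s : int) : seq bool :=
  nseq n true ++ false ::
    [seq e u v | u <- enum 'I_n, v <- enum 'I_n] ++ int_bits s.

(* [w] encodes a single-sink DAG of fan-in at most 2 and an integer [s], and the
   pebbling price [k] of that DAG satisfies [C k s]. *)
Definition encodes_with_price
    (move : forall V : finType, rel V -> rel {set V})
    (C : nat -> int -> Prop) (w : seq bool) : Prop :=
  exists (n : nat) (e : rel 'I_n) (s : int) (z : 'I_n) (k : nat),
    w = encode e s /\
    [/\ acyclic e, fan_in_le e 2, unique_sink e z,
        is_pebbling_price (move _ e) z k & C k s].

Definition gap_pebbling_price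
    (move : forall V : finType, rel V -> rel {set V}) (K : nat) :
    promise_problem :=
  PromiseProblem
    (encodes_with_price move (fun k s => (k%:Z <= s)%R))
    (encodes_with_price move (fun k s => (s + K%:Z <= k%:Z)%R)).

(* Main.v *)
(* One reduction serves both games: a true formula gives a graph with a reversible pebbling of space S, a
   false one a graph all of whose standard pebblings need space S + K.

   A macro node of height h with a list of items is a gadget: h parallel chains, each reading the items in
   order, topped by a pyramid. Pebbling its apex from scratch keeps, by Cook's argument, h pebbles in the
   gadget while the items are pebbled in order; reversibly, h pebbles and a lower-order overhead suffice, with
   Bennett's recursion along the chains. Nodes for literals, clauses and quantifiers are nested with heights
   so large that a pebbling near the budget must commit to a truth value at each quantifier and verify every
   clause under that assignment; repeating each node many times makes the lost slack exceed K. A spine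
   through all vertices turns the graph into a single-sink DAG.

   PSPACE enters through Savitch's recursion. Bits of a middle configuration are quantified existentially and
   the choice of a half universally, so that the leaves are one-step statements: local clauses when the
   configurations are those of a machine, single pebbling moves when they are sets of pebbled vertices. The
   first use gives hardness, the second membership. All data of the reductions are definable by arithmetic
   expressions with bounded sums, which compile to a stack language and then to Turing machines running in
   polynomial time; depth-first evaluation of a formula with definable leaves runs in polynomial space. *)
Require Import Defs.
From mathcomp Require Import all_boot all_order all_algebra.
From HB Require Import structures.
From mathcomp Require Import zify ring.
From Stdlib Require Import Classical FunctionalExtensionality.

Set Implicit Arguments.
Unset Strict Implicit.
Unset Printing Implicit Defensive.

Local Open Scope nat_scope.

(** * Lower bounds from blocked gadgets *)

(** The additive gap needs no amplification: every resource comes in blocks wider than the slack,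
    where the slack is what remains of the threshold [rS + K] after paying for the locked quantifier
    nodes, one check, one selector, all excuses and [n] blocks of literal tokens. So an extra
    literal or a second selector overruns the budget, however large [K] is. The check of a clause is
    higher than what is left beside all excuses, so some excuse must be dropped and pebbled anew
    during the check. This needs the tokens of its literal and the selector of its clause, which
    certifies a true literal. Tokens are too high to be rebuilt inside the quantifier node of their
    variable, so inside it the set of asserted literals only shrinks, and what a leaf sees was
    asserted earlier. Check 0, during which no excuse can be rebuilt, allows at most [n] asserted
    literals; clauses that mention a single variable force one per variable. Hence leaves see total
    assignments, and two leaves below the same outer nodes agree on the outer variables. *)

Section Runs.
Variables (V : finType) (e : rel V).

Lemma standard_moveP (P P' : {set V}) : standard_move e P P' ->
  (exists x, [/\ x \notin P, preds e x \subset P & P' = x |: P]) \/ P' \subset P.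
Proof.
case/orP => /existsP [x].
  by case/and3P=> xP sub /eqP ->; left; exists x.
by case/andP=> xP /eqP ->; right; apply: subD1set.
Qed.

End Runs.

Section Gadgets.
Variables (V : finType) (e : rel V) (nd : eqType).
Variables (hgt len : nd -> nat) (it : nd -> nat -> V) (ch py : nd -> nat -> nat -> V).
Variables (own : V -> nd) (lo hi : V -> nat) (valid : pred nd).

(** Edges are only required to exist, since further predecessors can only hinder a pebbling. [lo]
    and [hi] delimit the chains below a vertex; they keep apart the pebbles found in neighbouring
    subpyramids. *)
Record gadget_graph : Prop := GadgetGraph {
  gg_hgt : forall v, valid v -> 0 < hgt v;
  gg_diag : forall v b, py v 0 b = ch v b (len v);
  gg_ch : forall v b k, valid v -> b < hgt v -> k <= len v ->
    [/\ own (ch v b k) = v, lo (ch v b k) = b & hi (ch v b k) = b];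
  gg_py : forall v s c, valid v -> c + s < hgt v ->
    [/\ own (py v s c) = v, lo (py v s c) = c & hi (py v s c) = c + s];
  gg_echS : forall v b k, valid v -> b < hgt v -> k < len v ->
    e (ch v b k) (ch v b k.+1);
  gg_eit : forall v b k, valid v -> b < hgt v -> k < len v ->
    e (it v k) (ch v b k.+1);
  gg_epyl : forall v s c, valid v -> c + s.+1 < hgt v -> e (py v s c) (py v s.+1 c);
  gg_epyr : forall v s c, valid v -> c + s.+1 < hgt v -> e (py v s c.+1) (py v s.+1 c)
}.

Hypothesis gg : gadget_graph.

Definition out (v : nd) : V := py v (hgt v).-1 0.

Definition weight (v : nd) (P : {set V}) : nat := #|[set x in P | own x == v]|.

Lemma sum_weight (s : seq nd) (P : {set V}) : uniq s -> \sum_(v <- s) weight v P <= #|P|.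
Proof.
move=> us; rewrite /weight.
have -> : \sum_(v <- s) #|[set x in P | own x == v]| =
          #|[set x in P | own x \in s]|.
  elim: s us => [|v s IHs] /=.
    rewrite big_nil; symmetry; apply/eqP; rewrite cards_eq0; apply/eqP/setP=> x.
    by rewrite !inE andbF.
  case/andP=> vs us; rewrite big_cons IHs // -cardsUI.
  have -> : [set x in P | own x == v] :&: [set x in P | own x \in s] = set0.
    apply/setP=> x; rewrite !inE; case: (x \in P) => //=.
    by case: eqP => //= ->; rewrite (negbTE vs).
  rewrite cards0 addn0.
  by apply: eq_card => x; rewrite !inE; case: (x \in P).
by apply: subset_leq_card; apply/subsetP=> x; rewrite inE => /andP [].
Qed.

Section OneNode.
Variable v : nd.
Hypothesis vv : valid v.
Notation h := (hgt v).
Implicit Types P Q : {set V}.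

Fixpoint freec P b k : bool :=
  (ch v b k \notin P) && (if k is k'.+1 then freec P b k' else true).

(** Some path from the bottom of a chain to [py v s c] carries no pebble. *)
Fixpoint freep P s c : bool :=
  if s is s'.+1 then (py v s c \notin P) && (freep P s' c || freep P s' c.+1)
  else freec P c (len v).

(* an unpebbled path from the end of chain [b] (excluded) up to [py v s c] *)
Fixpoint upp P b s c : bool :=
  if s is s'.+1 then (py v s c \notin P) && (upp P b s' c || upp P b s' c.+1)
  else c == b.

(** All paths from the bottoms of the chains to the apex are blocked. This is weaker than a pebble
    on the apex, and it cannot begin without full height being reached. *)
Definition held P : bool := ~~ freep P h.-1 0.

Lemma freecN P b k j : freec P b k -> j <= k -> ch v b j \notin P.
Proof.
elim: k => [|k IHk] /=; first by rewrite leqn0 => /andP[nP _] /eqP ->.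
case/andP=> nP fr; rewrite leq_eqVlt => /orP[/eqP -> //|]; exact: IHk.
Qed.

Lemma freec_sub P Q b k : Q \subset P -> freec P b k -> freec Q b k.
Proof.
move=> sub; elim: k => [|k IHk] /= /andP[nP fr]; rewrite ?IHk // andbT;
by apply: contra nP; apply: (subsetP sub).
Qed.

Lemma freep_sub P Q s c : Q \subset P -> freep P s c -> freep Q s c.
Proof.
move=> sub; elim: s c => [|s IHs] c /=; first exact: freec_sub.
case/andP=> nP /orP fr; apply/andP; split; first by apply: contra nP; apply: (subsetP sub).
by case: fr => /IHs ->; rewrite ?orbT.
Qed.

Lemma upp_sub P Q b s c : Q \subset P -> upp P b s c -> upp Q b s c.
Proof.
move=> sub; elim: s c => [|s IHs] c //= /andP[nP /orP fr].
apply/andP; split; first by apply: contra nP; apply: (subsetP sub).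
by case: fr => /IHs ->; rewrite ?orbT.
Qed.

Lemma freep_split P s c : freep P s c -> exists b, [/\ c <= b <= c + s, freec P b (len v) & upp P b s c].
Proof.
elim: s c => [|s IHs] c /=; first by move=> fr; exists c; rewrite addn0 leqnn eqxx.
case/andP=> nP /orP [] /IHs [b [rng fr up]]; exists b; rewrite nP up ?orbT; split=> //; lia.
Qed.

Lemma freep_join P b s c : freec P b (len v) -> upp P b s c -> freep P s c.
Proof.
move=> fr; elim: s c => [|s IHs] c /=; first by move/eqP->.
by case/andP=> -> /orP [] /IHs ->; rewrite ?orbT.
Qed.

Lemma uppN P b s c : py v 0 b \notin P -> upp P b s c -> py v s c \notin P.
Proof. by move=> nP; case: s => [|s] /=; [move/eqP->|case/andP]. Qed.

Section Place.
Variables (P : {set V}) (x : V).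
Hypotheses (xP : x \notin P) (prx : preds e x \subset P).

Lemma pred_in u : e u x -> u \in P.
Proof. by move=> eux; apply: (subsetP prx); rewrite inE. Qed.

Lemma upp_place b s c : c + s < h -> py v 0 b \notin P -> upp P b s c -> upp (x |: P) b s c.
Proof.
move=> + nP; elim: s c => [|s IHs] c lt //= /andP[npP up].
rewrite !inE negb_or npP andbT.
have lt1 : c + s < h by lia.
have lt2 : c.+1 + s < h by lia.
have -> /= : py v s.+1 c != x.
  apply/eqP => eqx; case/orP: up => up.
    have := pred_in (_ : e (py v s c) x); rewrite -eqx (gg_epyl gg) // => /(_ isT).
    by apply/negP; apply: uppN up.
  have := pred_in (_ : e (py v s c.+1) x); rewrite -eqx (gg_epyr gg) // => /(_ isT).
  by apply/negP; apply: uppN up.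
by case/orP: up => up; rewrite (IHs _ _ up) ?orbT.
Qed.

Lemma freec_place b k : b < h -> k <= len v -> x != ch v b 0 -> freec P b k -> freec (x |: P) b k.
Proof.
move=> bh + nx; elim: k => [|k IHk] kl /=.
  by rewrite !andbT !inE eq_sym negb_or nx.
case/andP=> nP fr; rewrite !inE negb_or nP IHk // ?(ltnW kl) // !andbT.
apply/eqP => eqx.
have := pred_in (_ : e (ch v b k) x); rewrite -eqx (gg_echS gg) // => /(_ isT).
by apply/negP; apply: freecN fr _.
Qed.

(** A placement requires all predecessors to be pebbled, so on a pebble-free path it can only hit
    the first vertex. The placement that blocks the last free path is thus at the bottom of a chain,
    and the rest of that path is still free. *)
Lemma block_place : ~~ held P -> held (x |: P) ->
  exists b, [/\ b < h, x = ch v b 0, upp (x |: P) b h.-1 0 &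
    forall k, 0 < k <= len v -> ch v b k \notin x |: P].
Proof.
rewrite negbK => fr hd; have h0 := gg_hgt gg vv.
case/freep_split: (fr) => b [rng frb up].
have bh : b < h by lia.
have nP : py v 0 b \notin P by rewrite (gg_diag gg); apply: freecN frb _.
have up' : upp (x |: P) b h.-1 0 by apply: upp_place => //; lia.
have [eqx|nx] := eqVneq x (ch v b 0); last first.
  by case/negP: hd; apply: freep_join up'; apply: freec_place.
exists b; split=> // -[//|k] /andP[_ kl].
rewrite !inE negb_or (freecN frb) // andbT; apply/eqP=> eqx'.
have := pred_in (_ : e (ch v b k) x); rewrite -eqx' (gg_echS gg) // => /(_ isT).
by apply/negP; apply: (freecN frb); lia.
Qed.

End Place.

Definition subset_in lo0 hi0 P := [set x in P | [&& own x == v, lo0 <= lo x & hi x <= hi0]].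

Lemma blocked_chain P b k : b < h -> k <= len v -> ~~ freec P b k ->
  exists2 y, y \in P & [/\ own y = v, lo y = b & hi y = b].
Proof.
move=> bh; elim: k => [|k IHk] kl /=.
  rewrite andbT negbK => inP; exists (ch v b 0) => //; exact: (gg_ch gg).
rewrite negb_and negbK => /orP[inP|]; last by apply: IHk; apply: ltnW.
by exists (ch v b k.+1) => //; apply: (gg_ch gg).
Qed.

(** Always stepping to the left child of a blocked subpyramid meets a pebble. As its [lo] is [c], it
    lies outside the subpyramid of the right child. [blocked_right] is the mirror image. *)
Lemma blocked_left P s c : c + s < h -> ~~ freep P s c ->
  exists2 y, y \in P & [/\ own y = v, lo y = c & hi y <= c + s].
Proof.
elim: s => [|s IHs] lt /=.
  by case/blocked_chain; [lia|done|] => y yP [? ? hy]; exists y => //; split=> //; lia.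
rewrite negb_and negbK negb_or => /orP[inP|/andP[nf _]].
  by exists (py v s.+1 c) => //; case: (gg_py gg vv lt) => -> -> ->; split.
by case: IHs => //; [lia|] => y yP [? ? hy]; exists y => //; split=> //; lia.
Qed.

Lemma blocked_right P s c : c + s < h -> ~~ freep P s c ->
  exists2 y, y \in P & [/\ own y = v, c <= lo y & hi y = c + s].
Proof.
elim: s c => [|s IHs] c lt /=.
  by case/blocked_chain; [lia|done|] => y yP [? ly hy]; exists y => //; split=> //; lia.
rewrite negb_and negbK negb_or => /orP[inP|/andP[_ nf]].
  by exists (py v s.+1 c) => //; case: (gg_py gg vv lt) => -> -> ->; split.
by case: (IHs c.+1) => //; [lia|] => y yP [? ly hy]; exists y => //; split=> //; lia.
Qed.

(* Cook's argument: an unpebbled path from chain [b] to the apex meets, at each of its steps, a sibling all of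
   whose source paths are blocked, which yields one more pebble outside the current subpyramid. *)
Lemma count_blocked P b s c : c + s < h -> upp P b s c -> ~~ freep P s c ->
  s < #|subset_in c (c + s) P|.
Proof.
elim: s c => [|s IHs] c lt.
  move=> _ /=; case/blocked_chain; [lia|done|] => y yP [oy ly hy].
  by apply/card_gt0P; exists y; rewrite !inE yP oy ly hy eqxx addn0 leqnn.
move=> /= /andP[nP up]; rewrite nP negb_or /= => /andP[nf1 nf2].
suff [y [yP1 [D [DP sD yD]]]] : exists y, y \in subset_in c (c + s.+1) P /\
   exists D : {set V}, [/\ s < #|D|, D \subset subset_in c (c + s.+1) P & y \notin D].
  apply: (@leq_trans #|y |: D|); first by rewrite cardsU1 yD; lia.
  by apply: subset_leq_card; rewrite subUset sub1set yP1.
case/orP: up => up.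
  case: (blocked_right _ nf2); [lia|] => y yP [oy ly hy].
  exists y; split; first by rewrite !inE yP oy eqxx /=; lia.
  exists (subset_in c (c + s) P); split; first by apply: IHs up nf1; lia.
    by apply/subsetP=> z; rewrite !inE => /andP[-> /and3P[-> -> hz]] /=; lia.
  by rewrite !inE yP oy eqxx /=; lia.
case: (blocked_left _ nf1); [lia|] => y yP [oy ly hy].
exists y; split; first by rewrite !inE yP oy eqxx /=; lia.
exists (subset_in c.+1 (c.+1 + s) P); split; first by apply: IHs up nf2; lia.
  by apply/subsetP=> z; rewrite !inE => /andP[-> /and3P[-> lz hz]] /=; lia.
by rewrite !inE yP oy eqxx /=; lia.
Qed.

Lemma weight_blocked P b : upp P b h.-1 0 -> held P -> h <= weight v P.
Proof.
move=> up hd; have h0 := gg_hgt gg vv.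
have /(_ _ up hd) := @count_blocked P b h.-1 0.
rewrite prednK // add0n => /(_ (leqnn _)) /leq_trans; apply.
by apply: subset_leq_card; apply/subsetP=> z; rewrite !inE => /andP[-> /and3P[]].
Qed.

Lemma heldS P Q : P \subset Q -> held P -> held Q.
Proof. by move=> sub; apply: contra; apply: freep_sub. Qed.

Lemma out_held P : out v \in P -> held P.
Proof.
rewrite /out /held => oP; case E: h.-1 => [|s] /=; rewrite E in oP.
  apply/negP => /freecN /(_ (leqnn _)); by rewrite -(gg_diag gg) oP.
by rewrite oP.
Qed.

Lemma held_weight P : held P -> 0 < weight v P.
Proof.
have h0 := gg_hgt gg vv.
case/blocked_left; [lia|] => y yP [oy _ _].
by apply/card_gt0P; exists y; rewrite inE yP oy eqxx.
Qed.

Lemma held_set0 : held set0 = false.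
Proof.
apply/negbF; elim: h.-1 0 => [|s IHs] c /=; last by rewrite inE IHs.
by elim: (len v) => [|k IHk] /=; rewrite inE.
Qed.

End OneNode.

Section Time.
Variables (P : nat -> {set V}) (tmax : nat).
Hypothesis mv : forall t, t < tmax -> standard_move e (P t) (P t.+1).

Fixpoint passes a b (l : seq V) : Prop :=
  if l is x :: l' then exists t, [/\ a <= t, t <= b, x \in P t & passes t b l'] else a <= b.

Lemma passes_le a b l : passes a b l -> a <= b.
Proof. by case: l => [|x l] //= [t [at_ tb _ _]]; apply: leq_trans at_ tb. Qed.

Lemma passes_cat a b l1 l2 : passes a b (l1 ++ l2) -> exists c, [/\ passes a c l1, passes c b l2 & a <= c <= b].
Proof.
elim: l1 a => [|x l1 IHl] a /=.
  by move=> ps; exists a; split=> //; rewrite leqnn (passes_le ps).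
case=> t [at_ tb xt /IHl [c [p1 p2 ac]]]; exists c; split=> //; last lia.
by exists t; split=> //; lia.
Qed.

Lemma passes_trans a b c l1 l2 : passes a b l1 -> passes b c l2 -> passes a c (l1 ++ l2).
Proof.
elim: l1 a => [|x l1 IHl] a /= p1 p2.
  by elim: l2 a p1 p2 => [|y l2 _] a /= ab; [lia|case=> t [? ? ? ?]; exists t; split=> //; lia].
case: p1 => t [r1 r2 r3 r4]; exists t; split=> //; last exact: IHl.
by have := passes_le r4; have := passes_le p2; lia.
Qed.

Lemma passes_mem a b l x : passes a b l -> x \in l -> exists t, a <= t <= b /\ x \in P t.
Proof.
elim: l a => [|y l IHl] a //= [t [at_ tb xt ps]]; rewrite inE => /orP[/eqP->|].
  by exists t; split=> //; lia.
by move=> /(IHl _ ps) [t' [r xt']]; exists t'; split=> //; lia.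
Qed.

Lemma passes_wide a b a' b' l : a' <= a -> b <= b' -> passes a b l -> passes a' b' l.
Proof.
elim: l a a' => [|x l IHl] a a' /= aa bb; first by lia.
case=> t [at_ tb xt ps]; exists t; split=> //; [lia|lia|].
exact: IHl ps.
Qed.

(** [t0] is the last time at which [held] switches on; a removal cannot switch it on, so
    [block_place] describes the configuration at [t0]. *)
Lemma last_block v a b : valid v -> a <= b <= tmax -> ~~ held v (P a) -> held v (P b) ->
  exists t0 r, [/\ a < t0 <= b, r < hgt v, upp v (P t0) r (hgt v).-1 0,
    (forall k, 0 < k <= len v -> ch v r k \notin P t0) & forall t, t0 <= t <= b -> held v (P t)].
Proof.
move=> vv ab na; have [d Ed] : exists d, b = a + d by exists (b - a); lia.
elim: d b Ed ab => [|d IHd] b Ed ab hb; first by move: na; rewrite -[a]addn0 -Ed hb.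
have Eb : b = (a + d).+1 by lia.
have mb : standard_move e (P (a + d)) (P b) by rewrite Eb; apply: mv; lia.
case hd : (held v (P (a + d))).
  have [|t0 [r [r1 r2 r3 r4 r5]]] := IHd _ (erefl _) _ hd; first lia.
  exists t0, r; split=> //; first lia.
  move=> t tr; have [->//|tb] := eqVneq t b; apply: r5; lia.
case/standard_moveP: mb => [[x [xP prx Pb]]|sub]; last first.
  by move: (heldS sub hb); rewrite hd.
rewrite Pb in hb.
have [|r [rh ex up nch]] := block_place vv xP prx _ hb; first by rewrite hd.
exists b, r; rewrite Pb; split=> //; first lia.
by move=> t tb; rewrite (_ : t = b) ?Pb //; lia.
Qed.

Lemma weight_transition v a b : valid v -> a <= b <= tmax -> ~~ held v (P a) -> held v (P b) ->
  exists t, a < t <= b /\ hgt v <= weight v (P t).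
Proof.
move=> vv ab na hb; have [t0 [r [r1 r2 r3 r4 r5]]] := last_block vv ab na hb.
exists t0; split=> //; apply: weight_blocked r3 _ => //; apply: r5; lia.
Qed.

Lemma first_on x a b : x \notin P a -> x \in P b -> a <= b ->
  exists t, [/\ a < t <= b, x \in P t & forall t', a <= t' < t -> x \notin P t'].
Proof.
move=> na + ab; have [d Ed] : exists d, b = a + d by exists (b - a); lia.
elim: d b Ed ab => [|d IHd] b Ed ab hb; first by move: hb; rewrite Ed addn0 (negbTE na).
case hd : (x \in P (a + d)).
  have [|t [r1 r2 r3]] := IHd _ (erefl _) _ hd; first lia.
  by exists t; split=> //; lia.
case ex : [exists i : 'I_d.+1, x \in P (a + i)].
  have exn : exists i, (i < d.+1) && (x \in P (a + i)).
    by case/existsP: ex => i xi; exists i; rewrite ltn_ord.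
  have [i /andP[id xi] imin] := ex_minnP exn.
  have i0 : 0 < i by case: i xi {id imin} => //; rewrite addn0 (negbTE na).
  exists (a + i); split=> //; first lia.
  move=> t' tr; apply/negP => xt; have := imin (t' - a); rewrite subnKC ?xt; lia.
exists b; split=> //; first lia.
move=> t' tr; apply/negP => xt; case/existsP: ex.
have lt : t' - a < d.+1 by lia.
by exists (Ordinal lt) => /=; rewrite subnKC //; lia.
Qed.

Lemma placed_preds x t : t < tmax -> x \notin P t -> x \in P t.+1 -> forall u, e u x -> u \in P t.
Proof.
move=> lt nx xt u eu; case/standard_moveP: (mv lt) => [[y [yP pry Py]]|sub].
  move: xt; rewrite Py !inE (negbTE nx) orbF => /eqP exy; subst y.
  by apply: (subsetP pry); rewrite inE.
by move: nx; rewrite (subsetP sub _ xt).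
Qed.

Definition items v := mkseq (it v) (len v).

(** Just before the first pebble on [ch v r k.+1] both [ch v r k] and [it v k] are pebbled, so the
    items appear in order. The last clause says that the vertex reached is empty up to [te]; the
    alternative [te = t0] covers the empty prefix. *)
Lemma chain_passes v r t0 b k : valid v -> r < hgt v -> t0 <= b <= tmax -> k <= len v ->
  (forall j, 0 < j <= k -> ch v r j \notin P t0) ->
  ch v r k \in P b ->
  exists te, [/\ t0 <= te <= b, passes t0 te (mkseq (it v) k) &
     te = t0 \/ forall t, t0 <= t <= te -> ch v r k \notin P t].
Proof.
move=> vv rh.
elim: k b => [|k IHk] b tb kl nch on.
  by exists t0; split=> //=; [lia|left].
have [t1 [r1 on1 min1]] : exists t, [/\ t0 < t <= b, ch v r k.+1 \in P t & forall t', t0 <= t' < t -> ch v r k.+1 \notin P t'].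
  by apply: first_on on _; [apply: nch|]; lia.
have lt1 : t1.-1 < tmax by lia.
have Et1 : t1.-1.+1 = t1 by lia.
have prs : forall u, e u (ch v r k.+1) -> u \in P t1.-1.
  by apply: placed_preds => //; rewrite ?Et1 //; apply: min1; lia.
have onk : ch v r k \in P t1.-1 by apply: prs; apply: (gg_echS gg).
have onit : it v k \in P t1.-1 by apply: prs; apply: (gg_eit gg).
have [| | |te [te1 te2 te3]] := IHk t1.-1 _ _ _ onk; [lia|lia| |].
  by move=> j jr; apply: nch; lia.
exists t1.-1; split; first lia; last by right=> t tr; apply: min1; lia.
rewrite mkseqS -cats1.
apply: (passes_trans te2); exists t1.-1; split=> //=; lia.
Qed.

(* From the last moment [t0] at which the gadget becomes blocked, one chain is traversed from scratch; until its
   end is pebbled the path above it stays empty, so that all other paths must remain blocked. *)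
Lemma node_interval v a b : valid v -> a <= b <= tmax -> ~~ held v (P a) -> out v \in P b ->
  exists t0 te, [/\ a < t0, t0 <= te <= b, passes t0 te (items v) &
     forall t, t0 <= t <= te -> hgt v <= weight v (P t)].
Proof.
move=> vv ab na ob; have h0 := gg_hgt gg vv.
have hb : held v (P b) by apply: out_held.
have [t0 [r [r1 r2 up nch hd]]] := last_block vv ab na hb.
have upt d : t0 + d <= b -> (forall t, t0 <= t < t0 + d -> py v 0 r \notin P t) -> upp v (P (t0 + d)) r (hgt v).-1 0.
  elim: d => [|d IHd] db off; first by rewrite addn0.
  rewrite addnS; have lt : t0 + d < tmax by lia.
  have up1 : upp v (P (t0 + d)) r (hgt v).-1 0 by apply: IHd => [|t tr]; [lia|apply: off; lia].
  case/standard_moveP: (mv lt) => [[y [yP pry ->]]|sub]; last exact: upp_sub up1.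
  by apply: upp_place => //; [lia|apply: off; lia].
(* If the end of chain [r] were never pebbled, the path above it would stay free up to the apex,
   which carries a pebble at [b]. *)
have [te0 [te0r onr]] : exists te0, t0 <= te0 <= b /\ ch v r (len v) \in P te0.
  apply: NNPP => nex.
  have off t : t0 <= t <= b -> py v 0 r \notin P t.
    by move=> tr; rewrite (gg_diag gg); apply/negP => on; apply: nex; exists t.
  have upb : upp v (P b) r (hgt v).-1 0.
    by have := upt (b - t0); rewrite subnKC; [apply; [lia|move=> t tr; apply: off; lia]|lia].
  by move: ob; apply/negP; apply: uppN upb; apply: off; lia.
have [|te [te1 te2 te3]] := chain_passes vv r2 _ (leqnn _) nch onr; first lia.
exists t0, te; split=> //; [lia|lia|].
move=> t tr; have := upt (t - t0); rewrite subnKC; last lia.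
move=> upt'; apply: (@weight_blocked v vv (P t) r); last by apply: hd; lia.
case: te3 => [Ete|off].
  by apply: upt' => [|t' tr']; lia.
apply: upt'; first lia.
by move=> t' tr'; rewrite (gg_diag gg); apply: off; lia.
Qed.

End Time.
End Gadgets.

(** * Reachability by reversible pebblings *)

Section Reach.
Variables (V : finType) (e : rel V).
Hypothesis irr : forall v, ~~ e v v.
Implicit Types (A B C : {set V}) (s : nat).

Inductive rr s : {set V} -> {set V} -> Prop :=
  | rr_refl A : #|A| <= s -> rr s A A
  | rr_step A B C : #|A| <= s -> reversible_move e A B -> rr s B C -> rr s A C.

Lemma rr_path s A B : rr s A B -> exists2 l, path (reversible_move e) A l &
  last A l = B /\ (forall C, C \in A :: l -> #|C| <= s).
Proof.
elim=> {A B} [A As|A B C As mAB _ [l pl [ll la]]].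
  by exists [::] => //; split=> // C; rewrite inE => /eqP->.
exists (B :: l); rewrite /= ?mAB //; split=> // D; rewrite inE => /orP[/eqP->//|]; exact: la.
Qed.

Lemma rr_trans s A B C : rr s A B -> rr s B C -> rr s A C.
Proof. by elim=> // {A B} A A' B As mA _ IH /IH; apply: rr_step. Qed.

Lemma rr_size s A B : rr s A B -> #|A| <= s /\ #|B| <= s.
Proof. by elim=> // {A B} A A' B As mA _ []. Qed.

Lemma rr_leq s s' A B : s <= s' -> rr s A B -> rr s' A B.
Proof.
move=> le; elim=> [D Ds|D D' E Ds mv _ IH]; first by apply: rr_refl; apply: leq_trans le.
by apply: rr_step mv IH; apply: leq_trans le.
Qed.

Lemma preds_irr x (A : {set V}) : preds e x \subset A -> preds e x \subset A :\ x.
Proof.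
move=> /subsetP sub; apply/subsetP=> u pu; rewrite !inE sub // andbT.
by apply: contraTneq pu => ->; rewrite inE irr.
Qed.

Lemma reversible_move_sym A B : reversible_move e A B -> reversible_move e B A.
Proof.
case/orP=> /existsP[x /and3P[xA sub /eqP->]]; apply/orP.
  right; apply/existsP; exists x; rewrite !inE eqxx /= setU1K ?eqxx ?andbT //.
  by apply: subset_trans sub _; apply: subsetUr.
left; apply/existsP; exists x; rewrite !inE eqxx /= setD1K ?eqxx ?andbT //.
exact: preds_irr.
Qed.

Lemma rr_sym s A B : rr s A B -> rr s B A.
Proof.
elim=> [D Ds|D D' E Ds mv h IH]; first exact: rr_refl.
apply: rr_trans IH _; apply: rr_step (reversible_move_sym mv) _; first by case: (rr_size h).
exact: rr_refl.
Qed.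

Lemma rr_put s A x : preds e x \subset A -> #|A| < s -> rr s A (x |: A).
Proof.
move=> sub As; case xA : (x \in A).
  by rewrite (setUidPr _) ?sub1set //; apply: rr_refl; apply: ltnW.
apply: rr_step (rr_refl _); first exact: ltnW.
  by apply/orP; left; apply/existsP; exists x; rewrite xA sub eqxx.
by rewrite cardsU1 xA.
Qed.

Lemma placement_frame y A B : placement e A B ->
  y |: A = y |: B \/ placement e (y |: A) (y |: B).
Proof.
case/existsP=> x /and3P[xA sub /eqP->].
have [<-|nxy] := eqVneq x y; first by left; rewrite setUA setUid.
right; apply/existsP; exists x; rewrite !inE negb_or nxy xA /= setUCA eqxx andbT.
by apply: subset_trans sub _; apply: subsetUr.
Qed.

(** Moves of [y] itself become stutters and all other moves keep their predecessors, so keeping [y]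
    throughout costs one pebble. *)
Lemma rr_frame y s A B : rr s A B -> rr s.+1 (y |: A) (y |: B).
Proof.
have cy (D : {set V}) : #|D| <= s -> #|y |: D| <= s.+1 by rewrite cardsU1; lia.
elim=> [D Ds|D D' E Ds mv h IH]; first by apply: rr_refl; apply: cy.
have [eqD|mv'] : y |: D = y |: D' \/ reversible_move e (y |: D) (y |: D').
- case/orP: (mv) => [/(placement_frame y)[]|rm]; [by left|by move=> pl; right; apply/orP; left|].
  have [eD|nD] := eqVneq (y |: D) (y |: D'); [by left|right].
  apply: reversible_move_sym; apply/orP; left.
  case/orP: (reversible_move_sym mv) => [/(placement_frame y)[eD|//]|]; first by rewrite eD eqxx in nD.
  case/existsP=> x /and3P[xD' _ /eqP eD].
  case/existsP: rm => x' /and3P[_ _ /eqP eD']; move: xD'; rewrite eD' eD !inE => /andP[nx].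
  by rewrite eqxx.
- by rewrite eqD.
by apply: rr_step mv' IH; apply: cy.
Qed.

(** By [rr_sym] the same space allows the reverse passage. *)
Definition tog s A u := rr s A (u |: A).

Fixpoint adds (f : nat -> V) i A : {set V} := if i is i'.+1 then f i' |: adds f i' A else A.

Lemma addsP f i A x : reflect (x \in A \/ exists2 k, k < i & x = f k) (x \in adds f i A).
Proof.
apply: (iffP idP).
  elim: i => [|i IHi] /=; first by left.
  rewrite !inE => /orP[/eqP->|/IHi[]]; [by right; exists i|by left|].
  by case=> k ki ->; right; exists k => //; apply: ltnW.
case=> [xA|[k ki ->]]; first by elim: i => //= i IHi; rewrite inE IHi orbT.
elim: i ki => //= i IHi; rewrite ltnS leq_eqVlt inE => /orP[/eqP->|/IHi->]; rewrite ?inE ?eqxx ?orbT //.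
Qed.

Lemma card_adds f i A : #|adds f i A| <= #|A| + i.
Proof. by elim: i => [|i IHi] /=; rewrite ?addn0 // cardsU1; lia. Qed.

Lemma rr_frames f i s A B : rr s A B -> rr (s + i) (adds f i A) (adds f i B).
Proof. by move=> h; elim: i => [|i IHi] /=; rewrite ?addn0 // addnS; apply: rr_frame. Qed.

Lemma adds_swap f i A y : y |: adds f i A = adds f i (y |: A).
Proof. by elim: i => //= i <-; rewrite setUCA. Qed.

Lemma tog_frames f i s A u : tog s A u -> tog (s + i) (adds f i A) u.
Proof. by move/(rr_frames f i); rewrite /tog adds_swap. Qed.

Lemma tog_in s A u : u \in A -> #|A| <= s -> tog s A u.
Proof. by move=> uA As; rewrite /tog (setUidPr _) ?sub1set //; apply: rr_refl. Qed.

Lemma tog_leq s s' A u : s <= s' -> tog s A u -> tog s' A u.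
Proof. exact: rr_leq. Qed.

Lemma rr_adds f i s A : #|A| <= s -> (forall k, k < i -> tog s A (f k)) -> rr (s + i) A (adds f i A).
Proof.
move=> As; elim: i => [|i IHi] H /=; first by rewrite addn0; apply: rr_refl.
apply: (@rr_trans _ _ (adds f i A)); first by apply: rr_leq (IHi _) => [|k ki]; [lia|apply: H; lia].
by apply: (tog_leq (_ : s + i <= _)); [lia|apply: tog_frames; apply: H].
Qed.

(* [f k] becomes available, [B] is entered and left, so that toggling in [B] lifts to toggling in [A]. *)
Lemma tog_via s A B u : rr s A B -> tog s B u -> tog s.+1 A u.
Proof.
move=> AB Bu; apply: (@rr_trans _ _ B); first by apply: rr_leq AB.
apply: (@rr_trans _ _ (u |: B)); first by apply: rr_leq Bu.
by apply: rr_frame; apply: rr_sym.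
Qed.

End Reach.

Section NodeUpper.
Variables (V : finType) (e : rel V) (nd : eqType).
Variables (hgt len : nd -> nat) (it : nd -> nat -> V) (ch py : nd -> nat -> nat -> V).
Variable valid : pred nd.
Hypothesis irr : forall v, ~~ e v v.

Record gadget_preds : Prop := GadgetPreds {
  gp_hgt : forall v, valid v -> 0 < hgt v;
  gp_diag : forall v b, py v 0 b = ch v b (len v);
  gp_ch0 : forall v b u, valid v -> b < hgt v -> ~~ e u (ch v b 0);
  gp_chS : forall v b k u, valid v -> b < hgt v -> k < len v ->
    e u (ch v b k.+1) -> u = ch v b k \/ u = it v k;
  gp_py : forall v s c u, valid v -> c + s.+1 < hgt v ->
    e u (py v s.+1 c) -> u = py v s c \/ u = py v s c.+1
}.

Hypothesis gp : gadget_preds.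

Variables (v : nd) (A : {set V}) (s g q : nat).
Hypotheses (vv : valid v) (As : #|A| < s).
Hypothesis ti : forall k, k < len v -> tog e s A (it v k).
Hypotheses (lg : len v <= 2 ^ g) (hq : hgt v <= 2 ^ q).

(* Bennett's recursion: go through the middle, then remove it *)
Lemma chain_jump b i j k : b < hgt v -> j <= 2 ^ i -> k + j <= len v ->
  rr e (s + i + 2) (ch v b k |: A) (ch v b (k + j) |: (ch v b k |: A)).
Proof.
move=> bh; elim: i j k => [|i IHi] j k ji kl.
  case: j ji kl => [|[|//]] _ kl.
    rewrite [k + 0]addn0 setUA setUid; apply: rr_refl; rewrite cardsU1; lia.
  have t1 := ti (_ : k < len v); rewrite addn1 in kl *.
  have c1 : #|it v k |: A| <= s by case: (rr_size (t1 kl)).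
  apply: (@rr_trans _ _ _ _ (ch v b k |: (it v k |: A))).
    by apply: (rr_leq (_ : s.+1 <= _)); [lia|apply: (rr_frame irr); apply: t1].
  apply: (@rr_trans _ _ _ _ (ch v b k.+1 |: (ch v b k |: (it v k |: A)))).
    apply: rr_put; last by rewrite cardsU1; lia.
    apply/subsetP=> u; rewrite inE => /(gp_chS gp vv bh kl) [] ->; rewrite !inE eqxx ?orbT //.
  apply: (rr_leq (_ : s.+2 <= _)); first lia.
  by apply: (rr_frame irr); apply: (rr_frame irr); apply: (rr_sym irr); apply: t1.
have [j1 [j2 [Ej j1i j2i]]] : exists j1 j2, [/\ j = j1 + j2, j1 <= 2 ^ i & j2 <= 2 ^ i].
  exists (minn j (2 ^ i)), (j - minn j (2 ^ i)); move: ji; rewrite expnS; split; lia.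
have h1 : rr e (s + i + 2) _ _ := IHi j1 k j1i (_ : k + j1 <= len v).
have h2 : rr e (s + i + 2) _ _ := IHi j2 (k + j1) j2i (_ : k + j1 + j2 <= len v).
have Ek : k + j1 + j2 = k + j by lia.
rewrite Ek in h2.
apply: (@rr_trans _ _ _ _ (ch v b (k + j1) |: (ch v b k |: A))).
  by apply: rr_leq (h1 _); lia.
apply: (@rr_trans _ _ _ _ (ch v b (k + j) |: (ch v b (k + j1) |: (ch v b k |: A)))).
  rewrite -!(setUCA [set ch v b k]); apply: (rr_leq (_ : (s + i + 2).+1 <= _)); first lia.
  by apply: (rr_frame irr); apply: h2; lia.
apply: (rr_leq (_ : (s + i + 2).+1 <= _)); first lia.
by apply: (rr_frame irr); apply: (rr_sym irr); apply: h1; lia.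
Qed.

Lemma chain_tog b : b < hgt v -> tog e (s + g + 3) A (ch v b (len v)).
Proof.
move=> bh.
have p0 : rr e (s + g + 2) A (ch v b 0 |: A).
  apply: rr_put; last lia.
  by apply/subsetP=> u; rewrite inE (negbTE (gp_ch0 gp _ vv bh)).
have := @chain_jump b g (len v) 0 bh lg; rewrite add0n => /(_ (leqnn _)) pj.
by apply: tog_leq (tog_via irr p0 pj); lia.
Qed.

(** Overhead logarithmic in the height. The right side of the pyramid is a path [x k, ..., x 0]
    ending in the apex, and [y j] is the other predecessor of [x j]. The vertices [y 0, ..., y k.-1]
    are pebbled one after the other, each smaller than the one before by one row, which pays for the
    pebble already left; then comes [x k], and the path is walked up one pebble per step. Finally
    all but the apex is undone. *)
Lemma pyramid_tog i r c : r < 2 ^ i -> c + r < hgt v ->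
  tog e (s + g + 3 + r + i) A (py v r c).
Proof.
elim: i r c => [|i IHi] r c.
  case: r => // _; rewrite addn0 (gp_diag gp) !addn0; exact: chain_tog.
elim/ltn_ind: r c => r IHr c ri cr.
have [small|big] := ltnP r (2 ^ i); first by apply: tog_leq (IHi _ _ small cr); lia.
(* With this [k] the vertex [x k] lies in row [2 ^ i - 1], within reach of the induction on [i],
   while [2 * k <= r.+1] leaves room for both the [y j] and the walk along the [x j]. *)
pose k := r.+1 - 2 ^ i.
have i0 : 0 < 2 ^ i by rewrite expn_gt0.
rewrite expnS in ri.
have k0 : 0 < k by rewrite /k; lia.
have kr : k <= r by rewrite /k; lia.
have k2 : 2 * k <= r.+1 by rewrite /k; lia.
set S := s + g + 3 + r + i.
pose y j := py v (r - j.+1) (c + j).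
pose x j := py v (r - j) (c + j).
pose xs j := x (k - j.+1).
pose Y := adds y k A.
pose B := x k |: Y.
have sA : #|A| <= S by rewrite /S; lia.
have hY j : j <= k -> rr e S A (adds y j A).
  elim: j => [|j IHj] jk /=; first exact: rr_refl.
  apply: (@rr_trans _ _ _ _ (adds y j A)); first by apply: IHj; lia.
  apply: (tog_leq (_ : s + g + 3 + (r - j.+1) + i.+1 + j <= S)); first by rewrite /S; lia.
  by apply: (tog_frames irr); apply: IHr; rewrite ?expnS; lia.
have hB : rr e S Y B.
  apply: (tog_leq (_ : s + g + 3 + (r - k) + i + k <= S)); first by rewrite /S; lia.
  by apply: (tog_frames irr); apply: IHi; rewrite /k; lia.
have cB : #|B| <= #|A| + k.+1.
  by rewrite cardsU1; have := card_adds y k A; rewrite -/Y; lia.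
have pX j : j < k -> preds e (xs j) \subset adds xs j B.
  move=> jk; apply/subsetP=> u; rewrite inE => eu.
  have [] : u = y (k - j.+1) \/ u = x (k - j).
    move: eu; rewrite /xs /x /y.
    have -> : r - (k - j.+1) = (r - (k - j.+1).+1).+1 by lia.
    have -> : k - j = (k - j.+1).+1 by lia.
    by rewrite addnS; apply: (gp_py gp vv); lia.
  - move=> ->; apply/addsP; left; rewrite inE; apply/orP; right; apply/addsP; right.
    by exists (k - j.+1) => //; lia.
  - move=> ->; apply/addsP; case: j jk {eu} => [|j] jk.
      by left; rewrite subn0 setU11.
    by right; exists j => //; rewrite /xs; congr x; lia.
have hX j : j <= k -> rr e S B (adds xs j B).
  elim: j => [|j IHj] jk /=; first by apply: rr_refl; rewrite /S; lia.
  apply: (@rr_trans _ _ _ _ (adds xs j B)); first by apply: IHj; lia.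
  by apply: rr_put; [exact: pX|have := card_adds xs j B; rewrite /S; lia].
have Ex : py v r c = xs k.-1 by rewrite /xs /x prednK // subnn subn0 addn0.
apply: (@rr_trans _ _ _ _ B).
  by apply: rr_leq (rr_trans (hY k (leqnn _)) hB); rewrite /S; lia.
apply: (@rr_trans _ _ _ _ (py v r c |: B)).
  have := hX k (leqnn _); rewrite -{1}(prednK k0) /= -Ex => h1.
  apply: rr_trans (rr_leq _ h1) _; first by rewrite /S; lia.
  apply: (rr_leq (_ : S.+1 <= _)); first by rewrite /S; lia.
  by apply: (rr_frame irr); apply: (rr_sym irr); apply: hX; lia.
apply: (rr_leq (_ : S.+1 <= _)); first by rewrite /S; lia.
by apply: (rr_frame irr); apply: (rr_sym irr); apply: rr_trans (hY k _) hB.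
Qed.

Lemma node_tog : tog e (s + g + q + 2 + hgt v) A (py v (hgt v).-1 0).
Proof.
have h0 := gp_hgt gp vv.
by apply: tog_leq (pyramid_tog (i := q) (_ : (hgt v).-1 < _) _); lia.
Qed.

End NodeUpper.

(** * Macro nodes of the reduction *)

Fixpoint qval (univ : nat -> bool) (leaf : seq bool -> bool) (k : nat) (A : seq bool) : bool :=
  if k is k'.+1 then
    if univ (size A) then qval univ leaf k' (rcons A false) && qval univ leaf k' (rcons A true)
    else qval univ leaf k' (rcons A false) || qval univ leaf k' (rcons A true)
  else leaf A.

(* literal [2 * i + b] says that variable [i] has value [b] *)
Definition cnf (n m : nat) (lit : nat -> nat -> bool) (A : seq bool) : bool :=
  all (fun j => has (fun l => lit j l && (nth false A l./2 == odd l)) (iota 0 n.*2)) (iota 0 m).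

(* [TT l r]: tokens asserting the literal l; [SS j r]: tokens selecting the clause j - 1, with [j = 0] for the check
   that at most n literals are asserted and [j = m + 1] for never; [EE j l r]: excuse of literal l in clause j;
   [ZZ j r]: check of clause j - 1; [NN i b r]: variable i set to b; [Top]: the final chain. *)
Inductive mnode := TT of nat & nat | SS of nat & nat | EE of nat & nat & nat | ZZ of nat & nat
  | NN of nat & nat & nat | Top.

Lemma mnode_eq_dec (u v : mnode) : {u = v} + {u <> v}.
Proof. by decide equality; apply: (@eq_comparable nat). Qed.

HB.instance Definition _ := hasDecEq.Build mnode (compareP mnode_eq_dec).

(** [plam] is the overhead of toggling one node reversibly. [ptau], [ptaus], [pom] and [prho] are
    the numbers of copies of literal tokens, selectors, excuses, and of check and quantifier nodes;
    [pdz] and [pd] are the basic heights of the latter two. *)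
Record params := Params {
  pn : nat; pm : nat; plit : nat -> nat -> bool; puniv : nat -> bool;
  plam : nat; ptau : nat; pom : nat; ptaus : nat; pdz : nat; pd : nat; prho : nat }.

Section Macro.
Variable p : params.

Definition NE := pn p * 2 * pm p * pom p.

(** The excuse of a literal outside the clause is tied to a selector that no check reads, so it
    cannot be rebuilt during a check. *)
Definition star j l := if plit p j l then j.+1 else (pm p).+1.

Definition enode k := EE (k %/ (pn p * 2 * pom p)) (k %/ pom p %% (pn p * 2)) (k %% pom p).

Definition znode k := ZZ (k %/ prho p) (k %% prho p).

(** Each node is repeated [prho] times, more often than there are pebbles, so that in every pass
    some copy is not held at the beginning. *)
Definition itms i : seq mnode :=
  if i < pn p then mkseq (NN i 0) (prho p) ++ mkseq (NN i 1) (prho p)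
  else mkseq znode ((pm p).+1 * prho p).

(** A universal [NN i b] reads the tokens of its own value after the inner items, which forces this
    value inside. An existential node reads none and leaves the value free. *)
Definition itm (v : mnode) : seq mnode :=
  match v with
  | EE j l r => mkseq (TT l) (ptau p) ++ mkseq (SS (star j l)) (ptaus p)
  | ZZ j r => mkseq enode NE ++ mkseq (SS j) (ptaus p)
  | NN i b r => itms i.+1 ++ (if puniv p i then mkseq (TT (i * 2 + b)) (ptau p) else [::])
  | _ => [::]
  end.

(* the space that is left for the items of level i *)
Definition sbud i := NE + pn p * ptau p + ptaus p + pdz p + 2 * plam p + 8 + (pn p - i) * (pd p + plam p + 2).

(** A token of variable [i] just fits into the space of level [i], beside the excuses and the tokens
    of the variables up to [i]; inside one more quantifier node it no longer fits. Likewise [DS] is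
    chosen so that selectors fit only while no check is in progress. *)
Definition DT i := sbud i - (NE + i.+1 * ptau p + plam p + 4).
Definition DS := pdz p + plam p + 4.

Definition mhgt (v : mnode) : nat :=
  match v with
  | TT l r => DT l./2
  | SS j r => DS
  | EE _ _ _ => 1
  | ZZ j r => pdz p + (if j == 0 then 0 else pom p)
  | NN _ _ _ => pd p
  | Top => 1
  end.

Definition mvalid (v : mnode) : bool :=
  match v with
  | TT l r => (l < pn p * 2) && (r < ptau p)
  | SS j r => (j <= (pm p).+1) && (r < ptaus p)
  | EE j l r => [&& j < pm p, l < pn p * 2 & r < pom p]
  | ZZ j r => (j <= pm p) && (r < prho p)
  | NN i b r => [&& i < pn p, b < 2 & r < prho p]
  | Top => true
  end.

Lemma NE_alt : NE = pm p * (pn p * 2 * pom p).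
Proof. by rewrite /NE [in RHS]mulnA [pm p * _]mulnC. Qed.

Lemma enode_valid k : k < NE -> mvalid (enode k).
Proof.
move=> kN /=.
have om0 : 0 < pom p by move: kN; rewrite NE_alt; case: (pom p) => //; rewrite !muln0.
have n0 : 0 < pn p * 2 by move: kN; rewrite NE_alt; case: (pn p * 2) => //; rewrite !mul0n muln0.
by apply/and3P; split; rewrite ?ltn_mod // ltn_divLR -?NE_alt // muln_gt0 n0.
Qed.

Lemma enode_inj : {in [pred k | k < NE] &, injective enode}.
Proof.
move=> k k'; rewrite !inE => kN kN' [e1 e2 e3].
have Ek x : x = (x %/ (pn p * 2 * pom p)) * (pn p * 2) * pom p + (x %/ pom p %% (pn p * 2)) * pom p + x %% pom p.
  rewrite {1}(divn_eq x (pom p)) [in X in X + _](divn_eq (x %/ pom p) (pn p * 2)).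
  by rewrite -divnMA [pom p * _]mulnC mulnDl.
by rewrite (Ek k) (Ek k') e1 e2 e3.
Qed.

Lemma uniq_enode : uniq (mkseq enode NE).
Proof.
rewrite map_inj_in_uniq ?iota_uniq // => k k'; rewrite !mem_iota !add0n => kN kN'.
exact: enode_inj.
Qed.

Lemma enodeP j l r : mvalid (EE j l r) -> exists2 k, k < NE & EE j l r = enode k.
Proof.
case/and3P=> jm ln ro; exists (j * (pn p * 2 * pom p) + (l * pom p + r)).
  have h1 : l * pom p + r < pn p * 2 * pom p.
    apply: (@leq_trans (l.+1 * pom p)); [rewrite mulSn; lia|exact: leq_mul].
  apply: (@leq_trans (j.+1 * (pn p * 2 * pom p))); first by rewrite mulSn; lia.
  by rewrite NE_alt leq_mul.
have om0 : 0 < pom p by lia.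
have h1 : l * pom p + r < pn p * 2 * pom p.
  apply: (@leq_trans (l.+1 * pom p)); [rewrite mulSn; lia|exact: leq_mul].
set x := j * _ + _; have Ex : x = (j * (pn p * 2) + l) * pom p + r by rewrite /x mulnDl -(mulnA j) addnA.
have e1 : x %/ (pn p * 2 * pom p) = j.
  have d0 : 0 < pn p * 2 * pom p by apply: leq_ltn_trans h1.
  by rewrite /x divnMDl // divn_small // addn0.
have e2 : x %/ pom p %% (pn p * 2) = l.
  by rewrite Ex divnMDl // [r %/ _]divn_small // addn0 modnMDl modn_small.
have e3 : x %% pom p = r by rewrite Ex modnMDl modn_small.
by rewrite /enode e1 e2 e3.
Qed.

Lemma itm_valid v u : mvalid v -> u \in itm v -> mvalid u.
Proof.
have T l u' : l < pn p * 2 -> u' \in mkseq (TT l) (ptau p) -> mvalid u'.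
  by move=> ln /mapP[r]; rewrite mem_iota add0n => /= rt -> /=; rewrite ln.
have S j u' : j <= (pm p).+1 -> u' \in mkseq (SS j) (ptaus p) -> mvalid u'.
  by move=> ln /mapP[r]; rewrite mem_iota add0n => /= rt -> /=; rewrite ln.
case: v => //= [j l r /and3P[jm ln ro]|j r /andP[jm rr]|i b r /and3P[iN b2 rr]].
- rewrite mem_cat => /orP[/T|/S]; apply=> //; rewrite /star; case: ifP; lia.
- rewrite mem_cat => /orP[/mapP[k]|/S]; last by apply; lia.
  by rewrite mem_iota add0n => /= kN ->; apply: enode_valid.
- rewrite mem_cat => /orP[|]; last by case: ifP => // _ /T; apply; lia.
  rewrite /itms; case: ifP => iN'.
    by rewrite mem_cat => /orP[] /mapP[k]; rewrite mem_iota add0n => /= kN -> /=; rewrite iN' kN.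
  case/mapP=> k; rewrite mem_iota add0n => /= kN -> /=.
  have r0 : 0 < prho p by lia.
  by rewrite ltn_mod r0 andbT -ltnS ltn_divLR.
Qed.

End Macro.

(** * Small standard pebblings make the formula true *)

Section Lower.
Variable p : params.
Variables (V : finType) (e : rel V).
Variables (len : mnode -> nat) (it : mnode -> nat -> V) (ch py : mnode -> nat -> nat -> V).
Variables (own : V -> mnode) (lo hi : V -> nat).
Local Notation hgt := (mhgt p).
Local Notation valid := (mvalid p).
Hypothesis gg : gadget_graph e hgt len it ch py own lo hi valid.
Local Notation out := (out hgt py).
Local Notation weight := (weight own).
Local Notation held := (held hgt len ch py).
Hypothesis items_itm : forall v, valid v -> v <> Top -> items len it v = map out (itm p v).
Hypothesis items_top : subseq (map out (itms p 0)) (items len it Top).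

Variables (P : nat -> {set V}) (tmax smax : nat).
Hypothesis mv : forall t, t < tmax -> standard_move e (P t) (P t.+1).
Hypothesis small : forall t, t <= tmax -> #|P t| <= smax.
Local Notation passes := (passes P).
Local Notation n := (pn p).
Local Notation m := (pm p).

Hypothesis n_pos : 0 < n.
Hypothesis rho_big : smax < prho p.
Hypothesis clause_of : forall i, i < n -> exists2 j, j < m & forall l, l < n * 2 -> plit p j l -> l./2 = i.
(** Each of these inequalities excludes one configuration: a token rebuilt inside the node of its
    variable, a selector rebuilt during a check, [n.+1] asserted literals during check 0, all
    excuses held during the check of a clause, two selectors held during a check. *)
Hypothesis lock_T : forall i, i < n -> smax < i.+1 * pd p + DT p i.
Hypothesis lock_S : smax < n * pd p + pdz p + DS p.
Hypothesis few_T : smax < n * pd p + pdz p + ptaus p + NE p + n.+1 * ptau p.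
Hypothesis drop_E : smax < n * pd p + pdz p + pom p + ptaus p + NE p.
Hypothesis one_S : smax < n * pd p + pdz p + 2 * ptaus p.

Lemma budget (vs : seq mnode) t : t <= tmax -> uniq vs -> \sum_(v <- vs) weight v (P t) <= smax.
Proof. by move=> tt us; apply: leq_trans (small tt); apply: sum_weight. Qed.

Definition locked (vs : seq mnode) a b :=
  uniq vs /\ forall t v, a <= t <= b -> v \in vs -> hgt v <= weight v (P t).

Lemma lockedW vs a b a' b' : locked vs a b -> a <= a' -> b' <= b -> locked vs a' b'.
Proof. by move=> [us lk] aa bb; split=> // t v tr; apply: lk; lia. Qed.

Lemma locked_sum vs a b t : locked vs a b -> a <= t <= b ->
  \sum_(v <- vs) hgt v <= \sum_(v <- vs) weight v (P t).
Proof. by move=> [_ lk] tr; rewrite !big_seq; apply: leq_sum => v vin; apply: lk. Qed.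

(** If [v] became held after [a], it would contain [hgt v] pebbles at some moment in between, too
    many beside the locked gadgets. *)
Lemma stable vs v a b t : valid v -> v \notin vs -> locked vs a b -> b <= tmax ->
  smax < \sum_(u <- vs) hgt u + hgt v -> a <= t <= b -> held v (P t) -> held v (P a).
Proof.
move=> vv vin lk bt big tr ht; apply: contraT => na; exfalso.
have [|t' [tr' w]] := weight_transition gg mv vv _ na ht; first lia.
have us : uniq (v :: vs) by rewrite /= vin; case: lk.
have tt : t' <= tmax by lia.
have tr2 : a <= t' <= b by lia.
move: big w (budget tt us) (locked_sum lk tr2); rewrite big_cons.
by move: (\sum_(u <- vs) hgt u) (\sum_(u <- vs) weight u (P t')) => x y; lia.
Qed.

Lemma passes_held a b l v : valid v -> passes a b l -> out v \in l -> exists2 t, a <= t <= b & held v (P t).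
Proof.
by move=> vv ps oin; case: (passes_mem ps oin) => t [tr ot]; exists t => //; apply: (out_held gg).
Qed.

(** A held gadget contains a pebble, and there are more nodes than pebbles. So some node is not held
    at [a] and is traversed from scratch. *)
Lemma fresh (f : nat -> mnode) N a b : smax < N -> {in [pred k | k < N] &, injective f} ->
  (forall k, k < N -> valid (f k) /\ f k <> Top) -> passes a b (map out (mkseq f N)) -> b <= tmax ->
  exists k t0 te, [/\ k < N, a <= t0 /\ t0 <= te <= b, passes t0 te (map out (itm p (f k))) &
    forall t, t0 <= t <= te -> hgt (f k) <= weight (f k) (P t)].
Proof.
move=> Nbig finj fv ps bt; have ab := passes_le ps.
have [k /andP[kN nh]] : exists k, (k < N) && ~~ held (f k) (P a).
  apply: NNPP => nex.
  have us : uniq (mkseq f N).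
    by rewrite map_inj_in_uniq ?iota_uniq // => k k'; rewrite !mem_iota !add0n => kN kN'; apply: finj.
  have := budget (leq_trans ab bt) us.
  apply/negP; rewrite -ltnNge; apply: leq_trans Nbig _.
  rewrite big_map; apply: (@leq_trans (\sum_(k <- iota 0 N) 1)); first by rewrite sum1_size size_iota.
  rewrite !big_seq; apply: leq_sum => k; rewrite mem_iota add0n => /= kN.
  apply: (held_weight gg); first by case: (fv k kN).
  by apply: contraT => nh; case: nex; exists k; rewrite kN.
have [vk nT] := fv k kN.
have [t [tr ot]] : exists t, a <= t <= b /\ out (f k) \in P t.
  by apply: passes_mem ps _; apply: map_f; apply: map_f; rewrite mem_iota.
have [|t0 [te [r1 r2 r3 r4]]] := node_interval gg mv vk _ nh ot; first lia.
exists k, t0, te; split=> //; first lia.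
by rewrite -items_itm.
Qed.

Definition outer vs i := size vs = i /\ forall v, v \in vs -> exists i' b r, v = NN i' b r /\ i' < i.

Lemma outer_sum vs i : outer vs i -> \sum_(u <- vs) hgt u = i * pd p.
Proof.
case=> <- H; rewrite big_seq (eq_bigr (fun _ => pd p)); last by move=> v /H [i' [b [r [-> _]]]].
by rewrite -big_seq big_const_seq count_predT iter_addn_0 mulnC.
Qed.

Lemma outer_notin vs i v : outer vs i -> (forall i' b r, v = NN i' b r -> i <= i') -> v \notin vs.
Proof. by case=> _ H nv; apply/negP => /H [i' [b [r [/nv]]]]; lia. Qed.

Lemma T_stable vs i a b t l r : l./2 < i -> i <= n -> l < n * 2 -> r < ptau p -> outer vs i -> locked vs a b -> b <= tmax ->
  a <= t <= b -> held (TT l r) (P t) -> held (TT l r) (P a).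
Proof.
move=> li i_n ln rt ov lk bt tr; apply: stable lk bt _ tr; first by rewrite /= ln.
  exact: outer_notin ov _.
rewrite (outer_sum ov) /=.
have := lock_T (_ : l./2 < n); rewrite (leq_trans li i_n) => /(_ isT) /leq_trans; apply.
by rewrite leq_add2r leq_mul.
Qed.

Definition full l t := all (fun r => held (TT l r) (P t)) (iota 0 (ptau p)).

Lemma full_stable vs i a b t l : l./2 < i -> i <= n -> l < n * 2 -> outer vs i -> locked vs a b -> b <= tmax ->
  a <= t <= b -> full l t -> full l a.
Proof.
move=> li i_n ln ov lk bt tr /allP fl; apply/allP => r; rewrite mem_iota add0n => /= rt.
by apply: T_stable ov lk bt tr _ => //; apply: fl; rewrite mem_iota.
Qed.

Lemma passes_full vs i a b l : l./2 < i -> i <= n -> l < n * 2 -> outer vs i -> locked vs a b -> b <= tmax ->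
  passes a b (map out (mkseq (TT l) (ptau p))) -> full l a.
Proof.
move=> li i_n ln ov lk bt ps; apply/allP => r; rewrite mem_iota add0n => /= rt.
have vT : valid (TT l r) by rewrite /= ln.
have [|t tr ht] := passes_held vT ps; last exact: T_stable ov lk bt tr ht.
by apply: map_f; apply: map_f; rewrite mem_iota.
Qed.

Section Leaf.
Variables (vs : seq mnode) (a b j r : nat).
Hypotheses (ov : outer vs n) (bt : b <= tmax) (vz : valid (ZZ j r)).
Hypothesis lk : locked (ZZ j r :: vs) a b.
Hypothesis ps : passes a b (map out (itm p (ZZ j r))).

Let hz := hgt (ZZ j r).

(** Locked nodes count with their heights, every other held gadget with one pebble at least. *)
Lemma leaf_sum hs t : a <= t <= b -> uniq hs ->
  (forall v, v \in hs -> [/\ valid v, held v (P t) & match v with ZZ _ _ => false | NN _ _ _ => false | _ => true end]) ->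
  n * pd p + hz + size hs <= smax.
Proof.
move=> tr uh H; have tt : t <= tmax by lia.
have us : uniq ((ZZ j r :: vs) ++ hs).
  rewrite cat_uniq uh andbT; case: (lk) => -> _ /=.
  apply/hasPn => v /H [_ _] kd; rewrite /= inE negb_or; apply/andP; split.
    by apply/eqP => Ev; rewrite Ev in kd.
  by apply: outer_notin ov _ => i' b' r' Ev; rewrite Ev in kd.
have := budget tt us; rewrite big_cat /=; apply: leq_trans; apply: leq_add.
  by apply: leq_trans (locked_sum lk tr); rewrite big_cons (outer_sum ov) addnC.
rewrite -sum1_size !big_seq; apply: leq_sum => v /H [vv hv _]; exact: (held_weight gg).
Qed.

Definition fullS j' t := all (fun r' => held (SS j' r') (P t)) (iota 0 (ptaus p)).

Lemma passes_fullS a' b' j' : j' <= m.+1 -> a <= a' -> b' <= b -> passes a' b' (map out (mkseq (SS j') (ptaus p))) -> fullS j' a.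
Proof.
move=> jm aa bb ps'; apply/allP => r'; rewrite mem_iota add0n => /= rt.
have vS : valid (SS j' r') by rewrite /= jm.
have [|t tr ht] := passes_held vS ps'; first by apply: map_f; apply: map_f; rewrite mem_iota.
apply: (@stable (ZZ j r :: vs) (SS j' r') a b t) => //; last lia.
  by rewrite inE negb_or; apply/andP; split; [apply/eqP|apply: outer_notin ov _].
by rewrite big_cons (outer_sum ov) /=; apply: leq_trans lock_S _; lia.
Qed.

Lemma leaf_S : fullS j a.
Proof.
move: ps; rewrite /= map_cat => /passes_cat [c [p1 p2 cr]].
apply: passes_fullS p2; [|lia|lia]; move: vz => /= /andP[]; lia.
Qed.

Lemma uniq_SS j' : uniq (mkseq (SS j') (ptaus p)).
Proof. by rewrite map_inj_uniq ?iota_uniq // => x y []. Qed.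

Lemma fullS_mem j' t v : j' <= m.+1 -> fullS j' t -> v \in mkseq (SS j') (ptaus p) ->
  [/\ valid v, held v (P t) & match v with ZZ _ _ => false | NN _ _ _ => false | _ => true end].
Proof.
move=> jm /allP fS /mapP[r']; rewrite mem_iota add0n => /= rt ->; rewrite /= jm; split=> //.
by apply: fS; rewrite mem_iota.
Qed.

Lemma jm1 : j <= m.+1. Proof. by move: vz => /= /andP[]; lia. Qed.

Lemma leaf_only j' : j' <= m.+1 -> fullS j' a -> j' = j.
Proof.
move=> jm fS; apply/eqP/negPn/negP => nj.
have ab : a <= a <= b by have := passes_le ps; lia.
have := @leaf_sum (mkseq (SS j) (ptaus p) ++ mkseq (SS j') (ptaus p)) a ab.
rewrite cat_uniq !uniq_SS /= andbT size_cat !size_mkseq.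
have -> /= : ~~ has (in_mem^~ (mem (mkseq (SS j) (ptaus p)))) (mkseq (SS j') (ptaus p)).
  apply/hasPn => v /mapP[r' _ ->]; apply/mapP => -[r'' _ [e1 _]]; by rewrite e1 eqxx in nj.
move=> /(_ isT) h; have : n * pd p + hz + (ptaus p + ptaus p) <= smax.
  apply: h => v; rewrite mem_cat => /orP[]; apply: fullS_mem => //; [exact: jm1|exact: leaf_S].
by move: one_S; rewrite /hz /=; lia.
Qed.

(** An excuse that is not held at the start is pebbled from scratch during the check, which passes
    its tokens and its selector; stability carries both back to [a], where only the selector [j] is
    complete. *)
Lemma leaf_E j' l r' : valid (EE j' l r') -> ~~ held (EE j' l r') (P a) -> full l a /\ star p j' l = j.
Proof.
move=> vE nh; have [k kN Ek] := enodeP vE.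
have ab := passes_le ps.
have [t [tr ot]] : exists t, a <= t <= b /\ out (EE j' l r') \in P t.
  apply: passes_mem ps _; apply: map_f; rewrite /= mem_cat Ek map_f // mem_iota; lia.
have [|t0 [te [r1 r2 r3 r4]]] := node_interval gg mv vE _ nh ot; first lia.
move: r3; rewrite items_itm // /= map_cat => /passes_cat [c [p1 p2 cr]].
have := vE; rewrite /= => /and3P[jm ln ro].
split.
  apply: (@passes_full vs n a b l) => //; [lia| |].
    by case: lk => us lk'; split=> [|t' v tr' vin]; [case/andP: us|apply: lk'; rewrite ?inE ?vin ?orbT].
  by apply: passes_wide p1; lia.
have sm : star p j' l <= m.+1 by rewrite /star; case: ifP; lia.
by apply: leaf_only => //; apply: passes_fullS p2 => //; lia.
Qed.

Definition lits t := [seq l <- iota 0 (n * 2) | full l t].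

(** No value of [star] is 0, so by [leaf_E] all excuses are held at [a]; beside them there is room
    for the tokens of [n] literals only. *)
Lemma leaf_few : j = 0 -> size (lits a) <= n.
Proof.
move=> j0; have ab : a <= a <= b by have := passes_le ps; lia.
pose Ts := [seq TT l r' | l <- lits a, r' <- iota 0 (ptau p)].
have := @leaf_sum (mkseq (SS j) (ptaus p) ++ mkseq (enode p) (NE p) ++ Ts) a ab.
have uT : uniq Ts.
  by apply: allpairs_uniq; rewrite ?filter_uniq ?iota_uniq // => -[x y] [x' y'] _ _ [-> ->].
have hE v : v \in mkseq (enode p) (NE p) -> [/\ valid v, held v (P a) & match v with EE _ _ _ => true | _ => false end].
  case/mapP=> k; rewrite mem_iota add0n => /= kN ->; have vE := enode_valid kN; split=> //.
  apply: contraT => nh; have [_] := leaf_E vE nh; rewrite j0 /star; by case: ifP.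
have hT v : v \in Ts -> [/\ valid v, held v (P a) & match v with TT _ _ => true | _ => false end].
  case/allpairsP => -[l r'] [] /=; rewrite mem_filter !mem_iota !add0n => /andP[/allP fl /= ln] rt ->; split=> //=.
    by rewrite ln.
  by apply: fl; rewrite mem_iota.
rewrite !cat_uniq uniq_SS uniq_enode uT !andbT !has_cat !negb_or !size_cat !size_mkseq size_allpairs size_iota.
have -> /= : ~~ has (in_mem^~ (mem (mkseq (SS j) (ptaus p)))) (mkseq (enode p) (NE p)).
  by apply/hasPn => v /hE [_ _]; case: v => // *; apply/mapP => -[].
have -> /= : ~~ has (in_mem^~ (mem (mkseq (SS j) (ptaus p)))) Ts.
  by apply/hasPn => v /hT [_ _]; case: v => // *; apply/mapP => -[].
have -> /= : ~~ has (in_mem^~ (mem (mkseq (enode p) (NE p)))) Ts.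
  by apply/hasPn => v /hT [_ _]; case: v => // *; apply/mapP => -[].
move=> /(_ isT) h.
have : n * pd p + hz + (ptaus p + (NE p + size (lits a) * ptau p)) <= smax.
  apply: h => v; rewrite !mem_cat => /or3P[].
  - by apply: fullS_mem; [exact: jm1|exact: leaf_S].
  - by case/hE => ? ? kd; split=> //; move: kd; case: (v).
  - by case/hT => ? ? kd; split=> //; move: kd; case: (v).
move=> le1; rewrite leqNgt; apply/negP => lt.
have : n.+1 * ptau p <= size (lits a) * ptau p by rewrite leq_mul2r lt orbT.
by move: few_T le1; rewrite /hz /= j0 /=; lia.
Qed.

(** The additional height [pom] leaves no room for all excuses, and a missing one names a literal of
    the clause by [leaf_E]. *)
Lemma leaf_lit : 0 < j -> exists l, [/\ l < n * 2, plit p j.-1 l & full l a].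
Proof.
move=> j0; have ab : a <= a <= b by have := passes_le ps; lia.
apply: NNPP => nex.
have := @leaf_sum (mkseq (SS j) (ptaus p) ++ mkseq (enode p) (NE p)) a ab.
have hE v : v \in mkseq (enode p) (NE p) -> [/\ valid v, held v (P a) & match v with EE _ _ _ => true | _ => false end].
  case/mapP=> k; rewrite mem_iota add0n => /= kN ->; have vE := enode_valid kN; split=> //.
  apply: contraT => nh; have [fl] := leaf_E vE nh; rewrite /star; case: ifP => [lt Ej|_ Ej].
    by case: nex; exists (k %/ pom p %% (n * 2)); split=> //; [case/and3P: vE|rewrite -Ej].
  by move: vz; rewrite /= -Ej => /andP[]; lia.
rewrite !cat_uniq uniq_SS uniq_enode !andbT !size_cat !size_mkseq.
have -> /= : ~~ has (in_mem^~ (mem (mkseq (SS j) (ptaus p)))) (mkseq (enode p) (NE p)).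
  by apply/hasPn => v /hE [_ _]; case: v => // *; apply/mapP => -[].
move=> /(_ isT) h.
have : n * pd p + hz + (ptaus p + NE p) <= smax.
  apply: h => v; rewrite mem_cat => /orP[].
  - by apply: fullS_mem; [exact: jm1|exact: leaf_S].
  - by case/hE => ? ? kd; split=> //; move: kd; case: (v).
by move: drop_E; rewrite /hz /=; case: eqP; lia.
Qed.

End Leaf.

Definition exact c i (A : seq bool) := size A = i /\ forall l, l./2 < i -> full l c = (nth false A l./2 == odd l).

Lemma znode_block j : map (znode p) (iota (j * prho p) (prho p)) = mkseq (ZZ j) (prho p).
Proof.
rewrite -[j * _]addn0 iotaDl -map_comp; apply/eq_in_map => k; rewrite mem_iota add0n => /= kr.
have r0 : 0 < prho p by lia.
by rewrite /znode divnMDl // modnMDl divn_small // modn_small // addn0.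
Qed.

Lemma fresh_leaf vs a b j : outer vs n -> locked vs a b -> b <= tmax -> j <= m -> passes a b (map out (mkseq (ZZ j) (prho p))) ->
  exists r t0 te, [/\ valid (ZZ j r), a <= t0 /\ t0 <= te <= b, passes t0 te (map out (itm p (ZZ j r))) &
    locked (ZZ j r :: vs) t0 te].
Proof.
move=> ov lk bt jm ps.
have [| |r [t0 [te [r1 [r2 r3] r4 r5]]]] := fresh rho_big _ _ ps bt.
- by move=> x y _ _ [].
- by move=> k kr; rewrite /= jm.
exists r, t0, te; split=> //; first by rewrite /= jm.
split; first by rewrite /= (outer_notin ov) //; case: lk.
by move=> t v tr; rewrite inE => /orP[/eqP->|vin]; [exact: r5|case: lk => _; apply=> //; lia].
Qed.

(** Everything is pulled back to the start [c] of a check 0. There at most [n] literals are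
    asserted, while a literal found at a later check was asserted already at [c]; the one-variable
    clauses thus give one literal per variable. *)
Lemma lower_base vs a b : b <= tmax -> outer vs n -> locked vs a b -> passes a b (map out (itms p n)) ->
  exists c A, [/\ a <= c <= b, exact c n A & cnf n m (plit p) A].
Proof.
move=> bt ov lk; rewrite /itms ltnn mulSn /mkseq iotaD add0n !map_cat => /passes_cat [x [p1 p2 xr]].
have := p1; rewrite -[0](mul0n (prho p)) znode_block => p1'.
have lkx : locked vs a x by apply: lockedW lk _ _; lia.
have [|r [c [te [r1 [r2 r3] r4 r5]]]] := fresh_leaf ov lkx _ (leq0n m) p1'; first lia.
have cT : te <= tmax by lia.
have few := leaf_few ov cT r1 r5 r4 erefl.
have lk2 : locked vs c b by apply: lockedW lk _ _; lia.
have sat j : j < m -> exists l, [/\ l < n * 2, plit p j l & full l c].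
  move=> jm; have mj : m = j + (1 + (m - j).-1) by lia.
  move: p2; rewrite mj !mulnDl mul1n !iotaD !map_cat.
  case/passes_cat => y [_ /passes_cat [z [p3 _ zr]] yr].
  move: p3; rewrite -mulSn znode_block => p3.
  have lky : locked vs y z by apply: lockedW lk _ _; lia.
  have [|r' [t0 [te' [s1 [s2 s3] s4 s5]]]] := fresh_leaf ov lky _ jm p3; first lia.
  have te'T : te' <= tmax by lia.
  have [l [l1 l2 l3]] := leaf_lit ov te'T s1 s5 s4 (ltn0Sn j).
  exists l; split=> //; apply: (full_stable (i := n) _ _ l1 ov lk2 bt _ l3) => //; lia.
have some i : i < n -> exists l, [/\ l < n * 2, l./2 = i & full l c].
  move=> iN; have [j jm H] := clause_of iN; have [l [l1 l2 l3]] := sat j jm.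
  by exists l; split=> //; apply: H.
(* At most [n] asserted literals cover all [n] variables, so none is covered twice. *)
have uh : uniq (map half (lits c)).
  apply: leq_size_uniq (iota_uniq 0 n) _ _; last by rewrite size_map size_iota.
  move=> i; rewrite mem_iota add0n => /= /some [l [l1 <- l3]].
  by apply: map_f; rewrite mem_filter l3 mem_iota.
have one l l' : l < n * 2 -> l' < n * 2 -> full l c -> full l' c -> l./2 = l'./2 -> l = l'.
  move=> ln ln' fl fl' eh.
  have il : index l (lits c) < size (lits c) by rewrite index_mem mem_filter fl mem_iota.
  have il' : index l' (lits c) < size (lits c) by rewrite index_mem mem_filter fl' mem_iota.
  have := nth_uniq 0 (_ : index l (lits c) < size (map half (lits c))) (_ : index l' (lits c) < size (map half (lits c))) uh.
  rewrite size_map => /(_ il il'); rewrite !(nth_map 0) // !nth_index -?index_mem // eh eqxx.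
  move=> /esym/eqP Ei; have := nth_index 0 (_ : l \in lits c); rewrite -index_mem => /(_ il) <-.
  by rewrite Ei nth_index // -index_mem.
have ex l : l < n * 2 -> full l c = (full (l./2 * 2 + 1) c == odd l).
  move=> ln; have lhn : l./2 < n by lia.
  have [l' [l'n eh fl']] := some _ lhn.
  have El y : y = y./2 * 2 + odd y by rewrite -[LHS]odd_double_half addnC -muln2.
  have l2n : l./2 * 2 + 1 < n * 2 by lia.
  have l2h : (l./2 * 2 + 1)./2 = l./2 by lia.
  case ol : (odd l).
    by rewrite [in LHS](El l) ol eqb_id.
  have [ol'|ol'] := boolP (odd l').
    have -> : l./2 * 2 + 1 = l' by rewrite -eh [RHS]El ol'.
    rewrite fl'.
    apply/negbTE/negP => fl; have : l = l' by apply: one.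
    by move=> ll; rewrite -ll ol in ol'.
  have ll : l = l' by rewrite (El l) (El l') eh ol (negbTE ol').
  rewrite ll fl' eqbF_neg; symmetry; apply/negP; rewrite -ll => f1.
  have E1 : l./2 * 2 + 1 = l' by apply: one; rewrite // l2h eh.
  by move: ol'; rewrite -E1 oddD oddM andbF.
exists c, (mkseq (fun i => full (i * 2 + 1) c) n); split; first lia.
- split=> [|l ln]; first by rewrite size_mkseq.
  by rewrite nth_mkseq // ex //; lia.
- apply/allP => j; rewrite mem_iota add0n => /= jm; apply/hasP.
  have [l [l1 l2 l3]] := sat j jm; exists l; first by rewrite mem_iota -muln2.
  by rewrite l2 nth_mkseq -?ex //; lia.
Qed.

Lemma fresh_NN vs a b i r0 : i < n -> outer vs i -> locked vs a b -> b <= tmax -> r0 < 2 -> passes a b (map out (mkseq (NN i r0) (prho p))) ->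
  exists r t0 te, [/\ a <= t0 /\ t0 <= te <= b, passes t0 te (map out (itm p (NN i r0 r))),
    outer (NN i r0 r :: vs) i.+1 & locked (NN i r0 r :: vs) t0 te].
Proof.
move=> iN ov lk bt r2 ps.
have [| |r [t0 [te [s1 [s2 s3] s4 s5]]]] := fresh rho_big _ _ ps bt.
- by move=> x y _ _ [].
- by move=> k kr; rewrite /= iN r2.
exists r, t0, te; split=> //.
  case: (ov) => sv H; split=> [|v]; first by rewrite /= sv.
  rewrite inE => /orP[/eqP->|/H [i' [b' [r' [-> lt]]]]]; first by exists i, r0, r.
  by exists i', b', r'; split=> //; lia.
split.
  rewrite /=; case: lk => -> _; rewrite andbT; apply: outer_notin ov _ => i' b' r' []; lia.
by move=> t v tr; rewrite inE => /orP[/eqP->|vin]; [exact: s5|case: lk => _; apply=> //; lia].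
Qed.

Lemma exact_take c i j A : j <= i -> exact c i A -> exact c j (take j A).
Proof.
move=> ji [sA eA]; split=> [|l lj]; first by rewrite size_takel // sA.
by rewrite nth_take // eA //; lia.
Qed.

(** What is asserted at [c'] is asserted at [c], and a total assignment contained in another one
    equals it. *)
Lemma exact_stable vs a b c c' i A A' : i <= n -> outer vs i -> locked vs a b -> b <= tmax -> a <= c -> c <= c' <= b ->
  exact c i A -> exact c' i A' -> A = A'.
Proof.
move=> iN ov lk bt ac cc [sA eA] [sA' eA'].
have lk' : locked vs c b by apply: lockedW lk _ _.
apply: (@eq_from_nth _ false); first by rewrite sA sA'.
move=> k; rewrite sA => ki.
pose l := k * 2 + nth false A' k.
have lh : l./2 = k by rewrite /l; case: nth; lia.
have lo' : odd l = nth false A' k by rewrite /l oddD oddM andbF oddb.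
have : full l c' by rewrite eA' ?lh // lo'.
move/(full_stable (_ : l./2 < i) iN (_ : l < n * 2) ov lk' bt cc).
rewrite lh => /(_ ki); rewrite /l => H.
have : full (k * 2 + nth false A' k) c by apply: H; case: nth; lia.
by rewrite eA -/l ?lh // lo' => /eqP.
Qed.

(** The two branches are seen at different times [c0] and [c1]; they share the outer variables
    because the outer nodes stay locked throughout. For a universal variable the tokens read after
    the inner leaf fix the value in each branch; for an existential one the first branch
    suffices. *)
Lemma lower k i vs a b : i + k = n -> b <= tmax -> outer vs i -> locked vs a b -> passes a b (map out (itms p i)) ->
  exists c A, [/\ a <= c <= b, exact c i A & qval (puniv p) (cnf n m (plit p)) k A].
Proof.
elim: k i vs a b => [|k IHk] i vs a b ik bt ov lk ps.
  have Ei : i = n by lia.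
  by rewrite Ei in ov ps *; apply: lower_base bt ov lk ps.
have iN : i < n by lia.
move: ps; rewrite /itms iN map_cat => /passes_cat [x [p0 p1 xr]].
have branch y z (b' : bool) : a <= y -> z <= b -> passes y z (map out (mkseq (NN i b') (prho p))) ->
    exists c A, [/\ y <= c <= z, exact c i.+1 A, qval (puniv p) (cnf n m (plit p)) k A & puniv p i -> nth false A i = b'].
  move=> ay zb ps.
  have lky : locked vs y z by apply: lockedW lk _ _.
  have [| |r [t0 [te [s1 s2 s3 s4]]]] := fresh_NN iN ov lky _ _ ps; [lia|by case: (b')|].
  move: s2; rewrite /= map_cat => /passes_cat [w [q1 q2 wr]].
  have lkw : locked (NN i b' r :: vs) t0 w by apply: lockedW s4 _ _; lia.
  have [||c [A [cr eA qA]]] := IHk i.+1 _ t0 w _ _ s3 lkw q1; [lia|lia|].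
  exists c, A; split=> //; first lia.
  move=> ui; rewrite ui in q2.
  have lkc : locked (NN i b' r :: vs) c te by apply: lockedW s4 _ _; lia.
  have fl : full (i * 2 + b') c.
    apply: (passes_full (i := i.+1) _ _ _ s3 lkc) => //; [by case: (b'); lia|by case: (b'); lia|lia|].
    by apply: passes_wide q2; lia.
  case: eA => sA eA; move: fl; rewrite eA; last by case: (b'); lia.
  have -> : (i * 2 + b')./2 = i by case: (b'); lia.
  by rewrite oddD oddM andbF oddb => /eqP.
have [|c0 [A0 [c0r e0 q0 u0]]] := branch a x false (leqnn _) _ p0; first lia.
have [|c1 [A1 [c1r e1 q1 u1]]] := branch x b true _ (leqnn _) p1; first lia.
have E01 : take i A0 = take i A1.
  apply: (exact_stable (c := c0) (c' := c1) (ltnW iN) ov lk bt); [lia|lia| |]; exact: exact_take.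
exists c0, (take i A0); split; [lia|exact: exact_take|].
have rc A : size A = i.+1 -> A = rcons (take i A) (nth false A i).
  move=> sA; rewrite -take_nth ?sA // take_oversize // sA; lia.
case: (e0) => sA0 _; case: (e1) => sA1 _.
rewrite /= size_takel ?sA0 //; case: ifP => ui.
  move: q0 q1; rewrite {1}(rc A0) // {1}(rc A1) // u0 // u1 // -E01 => -> ->; done.
by move: q0; rewrite {1}(rc A0) //; case: nth => ->; rewrite ?orbT.
Qed.

Lemma lower_top : P 0 = set0 -> out Top \in P tmax -> qval (puniv p) (cnf n m (plit p)) n [::].
Proof.
move=> P0 oT.
have [||t0 [te [r1 r2 r3 _]]] := node_interval gg mv (isT : valid Top) (_ : 0 <= tmax <= tmax) _ oT.
- by rewrite leqnn.
- by rewrite P0 held_set0.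
have ps : passes t0 te (map out (itms p 0)).
  elim: (map _ _) (items _ _ _) t0 r3 items_top {r1 r2} => [|x l IHl] l' t0 ps sub; first exact: passes_le ps.
  elim: l' t0 ps sub => [|y l' IHl'] t0 //= [t [s1 s2 s3 s4]]; case: eqP => [Exy sub|_ sub].
    by exists t; rewrite Exy; split=> //; apply: IHl s4 sub.
  have [t' [w1 w2 w3 w4]] := IHl' _ s4 sub.
  by exists t'; split=> //; lia.
have [|||c [A [_ [sA _] qA]]] := lower (k := n) (i := 0) (vs := [::]) (add0n n) _ _ _ ps; first lia.
- by split.
- by split.
by move: qA; rewrite (size0nil sA).
Qed.

End Lower.

(** * Cheap reversible pebblings from a true formula *)

Section Upper.
Variable p : params.
Variables (V : finType) (e : rel V).
Variables (len : mnode -> nat) (it : mnode -> nat -> V) (ch py : mnode -> nat -> nat -> V).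
Local Notation hgt := (mhgt p).
Local Notation valid := (mvalid p).
Hypothesis irr : forall v, ~~ e v v.
Hypothesis gp : gadget_preds e hgt len it ch py valid.
Local Notation out := (out hgt py).
Hypothesis items_itm : forall v, valid v -> v <> Top -> items len it v = map out (itm p v).
Hypothesis out_inj : forall u v, valid u -> valid v -> out u = out v -> u = v.
Local Notation n := (pn p).
Local Notation m := (pm p).
Local Notation lam := (plam p).
Local Notation tau := (ptau p).
Local Notation taus := (ptaus p).
Local Notation om := (pom p).
Hypothesis log_bound : exists g q, g + q + 2 <= lam /\ forall v, valid v -> len v <= 2 ^ g /\ hgt v <= 2 ^ q.
Hypothesis items_top : forall k, k < len Top ->
  (exists2 u, valid u /\ it Top k = out u & u \in itms p 0 \/ exists j r, u = SS j r) \/ preds e (it Top k) = set0.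
Hypothesis n_pos : 0 < n.

Local Notation rr := (rr e).
Local Notation tog := (tog e).
Implicit Types (A B : {set V}) (s : nat).

Lemma ntog s A v : valid v -> #|A| < s -> (forall k, k < len v -> tog s A (it v k)) ->
  tog (s + lam + hgt v) A (out v).
Proof.
move=> vv As ti; have [g [q [gq /(_ v vv) [lg hq]]]] := log_bound.
by apply: tog_leq (node_tog irr gp vv As ti lg hq); lia.
Qed.

Lemma mtog s A v : valid v -> v <> Top -> #|A| < s -> (forall u, u \in itm p v -> tog s A (out u)) ->
  tog (s + lam + hgt v) A (out v).
Proof.
move=> vv vT As ti; apply: ntog => // k kl.
have : it v k \in items len it v by apply: map_f; rewrite mem_iota.
by rewrite items_itm // => /mapP[u uin ->]; apply: ti.
Qed.

Definition Tset l A := adds (fun r => out (TT l r)) tau A.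
Definition Sset j A := adds (fun r => out (SS j r)) taus A.
Definition EA := adds (fun k => out (enode p k)) (NE p) set0.

Fixpoint ctx (al : seq bool) i : {set V} :=
  if i is i'.+1 then Tset (i' * 2 + nth false al i') (ctx al i') else EA.

Lemma card_ctx al i : #|ctx al i| <= NE p + i * tau.
Proof.
elim: i => [|i IHi] /=; first by apply: leq_trans (card_adds _ _ _) _; rewrite cards0; lia.
by apply: leq_trans (card_adds _ _ _) _; rewrite mulSn; lia.
Qed.

Lemma ctx_rcons al b i : i <= size al -> ctx (rcons al b) i = ctx al i.
Proof. by elim: i => //= i IHi il; rewrite IHi 1?ltnW // nth_rcons il. Qed.

Lemma ctx_E al i k : k < NE p -> out (enode p k) \in ctx al i.
Proof.
move=> kN; elim: i => [|i IHi] /=; apply/addsP; [right|left] => //.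
by exists k.
Qed.

Lemma ctx_T al i k r : k < i -> r < tau -> out (TT (k * 2 + nth false al k) r) \in ctx al i.
Proof.
move=> + rt; elim: i => //= i IHi; rewrite ltnS leq_eqVlt => /orP[/eqP->|/IHi ki]; apply/addsP; [right|left] => //.
by exists r.
Qed.

Lemma rr_T s A l : l < n * 2 -> #|A| < s -> rr (s + lam + DT p l./2 + tau) A (Tset l A).
Proof.
move=> ln As; apply: (rr_adds irr) => [|r rt]; first lia.
by apply: (@mtog s A (TT l r)) => //; rewrite /= ln.
Qed.

Lemma rr_S s A j : j <= m.+1 -> #|A| < s -> rr (s + lam + DS p + taus) A (Sset j A).
Proof.
move=> jm As; apply: (rr_adds irr) => [|r rt]; first lia.
by apply: (@mtog s A (SS j r)) => //; rewrite /= jm.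
Qed.

Lemma sbudS i : i < n -> sbud p i = sbud p i.+1 + (pd p + lam + 2).
Proof. by move=> iN; rewrite /sbud (_ : n - i = (n - i.+1).+1) ?mulSn; lia. Qed.

Lemma sbud_min i : NE p + n * tau + taus + pdz p + 2 * lam + 8 <= sbud p i.
Proof. exact: leq_addr. Qed.

Lemma mul_tau i : i <= n -> i * tau <= n * tau.
Proof. by move=> h; rewrite leq_mul. Qed.

Lemma DT_eq i : i < n -> DT p i + (NE p + i.+1 * tau + lam + 4) = sbud p i.
Proof. by move=> iN; rewrite /DT subnK //; have := sbud_min i; have := mul_tau iN; lia. Qed.

Lemma excuse_tog s B j l r : valid (EE j l r) -> #|B| < s ->
  (forall r, r < tau -> out (TT l r) \in B) -> (forall r, r < taus -> out (SS (star p j l) r) \in B) ->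
  tog (s + lam + 1) B (out (EE j l r)).
Proof.
move=> vE Bs HT HS; apply: (mtog vE) => // u; rewrite mem_cat => /orP[] /mapP[k]; rewrite mem_iota add0n => /= kt ->.
  by apply: tog_in; [exact: HT|exact: ltnW].
by apply: tog_in; [exact: HS|exact: ltnW].
Qed.

(** Check 0 runs with all excuses in place. For the check of a clause, the [pom] excuses of a true
    literal are removed first to pay for the additional height; with tokens and selector present,
    each can be toggled whenever the chains read it. *)
Lemma leaf_tog al u : size al = n -> cnf n m (plit p) al -> u \in itms p n -> tog (sbud p n) (ctx al n) (out u).
Proof.
move=> sal sat uin; have := uin; rewrite /itms ltnn => /mapP[k]; rewrite mem_iota add0n => /= kN Eu.
have r0 : 0 < prho p by lia.
have vu : valid u by rewrite Eu /= ltn_mod r0 andbT -ltnS ltn_divLR.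
move: Eu vu; rewrite /znode; set j := k %/ _; set r := k %% _; move=> -> /= /andP[jm rr0].
have cA := card_ctx al n; set A := ctx al n in cA *.
have AB : rr (NE p + n * tau + 1 + lam + DS p + taus) A (Sset j A) by apply: rr_S; lia.
have cB : #|Sset j A| <= NE p + n * tau + taus by apply: leq_trans (card_adds _ _ _) _; lia.
have vz : valid (ZZ j r) by rewrite /= jm.
have SB r' : r' < taus -> out (SS j r') \in Sset j A by move=> rt; apply/addsP; right; exists r'.
have EB k' : k' < NE p -> out (enode p k') \in Sset j A by move=> kt; apply/addsP; left; apply: ctx_E.
have [j0|j0] := posnP j.
  have zt : tog (NE p + n * tau + taus + 1 + lam + hgt (ZZ j r)) (Sset j A) (out (ZZ j r)).
    apply: mtog => //; first lia.
    move=> v; rewrite mem_cat => /orP[] /mapP[k']; rewrite mem_iota add0n => /= kt ->; apply: tog_in; try lia.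
      exact: EB.
    exact: SB.
  have hz : hgt (ZZ j r) = pdz p by rewrite /= j0 addn0.
  rewrite hz in zt.
  apply: (tog_leq (_ : (sbud p n - 1).+1 <= _)); first by have := sbud_min n; lia.
  by apply: (tog_via irr (rr_leq _ AB) (rr_leq _ zt)); rewrite ?/DS /sbud; lia.
have [l l2n /andP[lit /eqP al_l]] : exists2 l, l \in iota 0 n.*2 & plit p j.-1 l && (nth false al l./2 == odd l).
  by apply/hasP; move/allP: sat; apply; rewrite mem_iota; lia.
rewrite mem_iota add0n -muln2 in l2n.
have El : l = l./2 * 2 + nth false al l./2 by rewrite al_l; lia.
have stj : star p j.-1 l = j by rewrite /star lit prednK.
pose f r := out (EE j.-1 l r).
pose F := [set f (r' : nat) | r' : 'I_om].
have vE r' : r' < om -> valid (EE j.-1 l r') by move=> rt /=; rewrite rt andbT; lia.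
have FP x : reflect (exists2 r', r' < om & x = f r') (x \in F).
  apply: (iffP imsetP) => [[r' _ ->]|[r' rt ->]]; first by exists r'.
  by exists (Ordinal rt).
have cF : #|F| = om.
  rewrite card_imset ?card_ord // => r1 r2 /out_inj H; apply: val_inj.
  by have [] := H (vE _ (ltn_ord _)) (vE _ (ltn_ord _)).
have FB : F \subset Sset j A.
  apply/subsetP=> x /FP[r' rt ->]; have [k' kN' Ek] := enodeP (vE _ rt); rewrite /f Ek; exact: EB.
pose B := Sset j A :\: F.
have cB' : #|B| + om <= NE p + n * tau + taus.
  by rewrite /B cardsD (setIidPr FB) cF subnK // -cF; apply: subset_leq_card.
have inB v : valid v -> out v \in Sset j A -> (forall j l r, v <> EE j l r) -> out v \in B.
  move=> vv vS nE; rewrite inE vS andbT; apply/FP => -[r' rt /out_inj Ev].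
  by apply: (nE j.-1 l r'); apply: Ev => //; apply: vE.
have SB' r' : r' < taus -> out (SS j r') \in B.
  by move=> rt; apply: inB => //; [rewrite /= rt andbT; lia|apply: SB].
have TB' r' : r' < tau -> out (TT l r') \in B.
  move=> rt; apply: inB => //; first by rewrite /= rt andbT.
  by apply/addsP; left; rewrite [l in TT l]El; apply: ctx_T => //; lia.
pose s := #|B| + 1.
have et r' : r' < om -> tog (s + lam + 1) B (f r').
  by move=> rt; apply: excuse_tog => //; [exact: vE|rewrite /s; lia|rewrite stj].
have EqB : adds f om B = Sset j A.
  apply/setP=> x; apply/addsP/idP => [[|[r' rt ->]]|xS].
  - by rewrite inE => /andP[].
  - by apply: (subsetP FB); apply/FP; exists r'.
  have [/FP|xF] := boolP (x \in F); first by right.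
  by left; rewrite inE xF.
have BB : rr (s + lam + 1 + om) B (Sset j A).
  by rewrite -EqB; apply: (rr_adds irr) => [|r' rt]; [rewrite /s; lia|exact: et].
have zt : tog (s + lam + 1 + lam + (pdz p + om)) B (out (ZZ j r)).
  have hz : hgt (ZZ j r) = pdz p + om by rewrite /=; case: eqP j0 => // ->.
  rewrite -hz; apply: mtog => //; first by rewrite /s; lia.
  move=> v; rewrite mem_cat => /orP[] /mapP[k']; rewrite mem_iota add0n => /= kt ->.
    have [/FP[r' rt ->]|xF] := boolP (out (enode p k') \in F); first exact: et.
    by apply: tog_in; [rewrite inE xF EB|rewrite /s; lia].
  by apply: tog_in; [exact: SB'|rewrite /s; lia].
have AB' : rr (sbud p n - 1) A B.
  apply: (@rr_trans _ _ _ _ (Sset j A)); first by apply: rr_leq AB; rewrite /DS /sbud; lia.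
  by apply: (rr_sym irr); apply: rr_leq BB; rewrite /s /sbud; lia.
apply: tog_leq (tog_via irr AB' (rr_leq _ zt)); first by have := sbud_min n; lia.
by rewrite /s /sbud; lia.
Qed.

(** For an existential variable the tokens laid down need not match the name of the node: [NN i 0]
    and [NN i 1] are both passed with the satisfying value. *)
Lemma upper k i al u : i + k = n -> size al = i -> qval (puniv p) (cnf n m (plit p)) k al ->
  u \in itms p i -> tog (sbud p i) (ctx al i) (out u).
Proof.
elim: k i al u => [|k IHk] i al u ik sal qv uin.
  have Ei : i = n by lia.
  by rewrite Ei in sal uin *; apply: leaf_tog.
have iN : i < n by lia.
have [b [r [Eu b2 rr0]]] : exists (b : bool) r, [/\ u = NN i b r, true & r < prho p].
  move: uin; rewrite /itms iN mem_cat => /orP[] /mapP[r]; rewrite mem_iota add0n => /= rt ->.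
    by exists false, r.
  by exists true, r.
have vu : valid u by rewrite Eu /= iN rr0; case: (b).
have [b' [ub qb]] : exists b', (puniv p i -> b' = b) /\ qval (puniv p) (cnf n m (plit p)) k (rcons al b').
  move: qv => /=; rewrite sal; case: ifP => [ui /andP[q0 q1]|ui /orP[q|q]]; last first.
  - by exists true.
  - by exists false.
  by exists b; split=> //; case: (b).
pose B := ctx (rcons al b') i.+1.
have EB : B = Tset (i * 2 + b') (ctx al i).
  by rewrite /B /= ctx_rcons ?sal // nth_rcons sal ltnn eqxx.
have lh : (i * 2 + b')./2 = i by case: (b'); lia.
have AB : rr (sbud p i - 3) (ctx al i) B.
  rewrite EB; have := @rr_T (NE p + i * tau + 1) (ctx al i) (i * 2 + b').
  rewrite lh => H; apply: rr_leq (H _ _).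
  - by have := DT_eq iN; rewrite mulSn; lia.
  - by case: (b'); lia.
  - by have := card_ctx al i; lia.
have IH v : v \in itms p i.+1 -> tog (sbud p i.+1) B (out v).
  by apply: IHk; rewrite ?size_rcons ?sal //; lia.
have cB : #|B| < sbud p i.+1.
  by have := card_ctx (rcons al b') i.+1; have := sbud_min i.+1; have := mul_tau iN; rewrite -/B; lia.
have nt : tog (sbud p i.+1 + lam + pd p) B (out u).
  have := @mtog (sbud p i.+1) B _ vu; rewrite Eu /=; apply => // v.
  rewrite mem_cat => /orP[/IH //|]; case: ifP => // ui /mapP[k']; rewrite mem_iota add0n => /= kt ->.
  apply: tog_in; last exact: ltnW.
  by rewrite EB -(ub ui); apply/addsP; right; exists k'.
have := sbudS iN => Es.
apply: tog_leq (tog_via irr (rr_leq (s' := sbud p i - 1) _ AB) (rr_leq _ nt)); lia.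
Qed.

Lemma sbud0 i : sbud p i <= sbud p 0.
Proof. by rewrite /sbud leq_add2l leq_mul //; lia. Qed.

(** Excuses are acquired one by one, each time laying down its tokens and its selector and taking
    them up again. Literals of either value are allowed here, as no quantifier node is in
    progress. *)
Lemma rr_EA : rr (sbud p 0 + 1) set0 EA.
Proof.
rewrite /EA; have: NE p <= NE p by []; move: {-2}(NE p) => N; elim: N => [|k IHk] kN /=.
  by apply: rr_refl; rewrite cards0.
apply: rr_trans (IHk _) _; first exact: ltnW.
set A := adds _ k _.
have cA : #|A| <= NE p by apply: leq_trans (card_adds _ _ _) _; rewrite cards0; lia.
have vE := enode_valid kN; rewrite /enode in vE *.
move: vE; set j := k %/ _; set l := _ %% (n * 2); set r := _ %% _ => vE.
have [jm ln ro] := and3P vE.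
have sm : star p j l <= m.+1 by rewrite /star; case: ifP; lia.
pose B := Sset (star p j l) (Tset l A).
have lh : l./2 < n by lia.
have cT : #|Tset l A| <= NE p + tau by apply: leq_trans (card_adds _ _ _) _; lia.
have cB : #|B| <= NE p + tau + taus by apply: leq_trans (card_adds _ _ _) _; lia.
have st : tau <= n * tau by rewrite leq_pmull.
have sm0 := sbud_min 0.
have h1 : rr (sbud p 0) A (Tset l A).
  apply: rr_leq (@rr_T (NE p + 1) _ l ln _); last lia.
  by have := DT_eq lh; have := sbud0 l./2; have := leq_pmull tau (isT : 0 < (l./2).+1); lia.
have h2 : rr (sbud p 0) (Tset l A) B.
  by apply: rr_leq (@rr_S (NE p + tau + 1) _ (star p j l) sm _); rewrite /DS; lia.
rewrite addn1; apply: (tog_via irr (rr_trans h1 h2)).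
apply: tog_leq (@excuse_tog (NE p + tau + taus + 1) B j l r vE _ _ _); [lia|lia| |].
  by move=> r' rt; apply/addsP; left; apply/addsP; right; exists r'.
by move=> r' rt; apply/addsP; right; exists r'.
Qed.

Lemma upper_top : qval (puniv p) (cnf n m (plit p)) n [::] -> rr (sbud p 0 + lam + 3) set0 [set out Top].
Proof.
move=> qv; have sm0 := sbud_min 0.
have cE : #|EA| <= NE p by apply: leq_trans (card_adds _ _ _) _; rewrite cards0; lia.
have tT : tog (sbud p 0 + lam + 1) EA (out Top).
  apply: (@ntog (sbud p 0) EA Top) => //; first lia.
  move=> k kl; case: (items_top kl) => [[u [vu ->] [uin|[j [r Eu]]]]|p0].
  - exact: (@upper n 0 [::] u).
  - apply: tog_leq (@mtog (NE p + 1) EA u vu _ _ _); rewrite ?Eu //= /DS; lia.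
  - by apply: rr_put; [rewrite p0 sub0set|lia].
apply: (@rr_trans _ _ _ _ EA); first by apply: rr_leq rr_EA; lia.
apply: (@rr_trans _ _ _ _ (out Top |: EA)); first by apply: rr_leq tT; lia.
(* The excuses are taken up by the reverse of [rr_EA], with the final pebble as a frame. *)
apply: (rr_sym irr); rewrite -[X in rr _ X _]setU0.
by apply: rr_leq (rr_frame irr (out Top) rr_EA); lia.
Qed.

End Upper.

(** * The pebbling instance as a graph on ordinals *)

Lemma pair_div B a b : b < B -> (a * B + b) %/ B = a.
Proof. by move=> bB; rewrite divnMDl ?divn_small ?addn0 //; apply: leq_ltn_trans bB. Qed.

Lemma pair_mod B a b : b < B -> (a * B + b) %% B = b.
Proof. by move=> bB; rewrite modnMDl modn_small. Qed.

Lemma pair_lt B a b a' b' : b < B -> a < a' -> a * B + b < a' * B + b'.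
Proof. by move=> bB aa; have := leq_mul aa (leqnn B); rewrite mulSn; lia. Qed.

Lemma pair_bound B a b N : b < B -> a < N -> a * B + b < N * B.
Proof. by move=> bB aN; rewrite -[N * B]addn0; apply: pair_lt. Qed.

Section Code.
Variables (p : params) (B : nat).
Local Notation n := (pn p).
Local Notation m := (pm p).

Definition pack ty a b r := ((ty * B + a) * B + b) * B + r.

(** The type is the leading digit and quantifier nodes are ordered by [n - i], so that items have
    smaller codes than the nodes reading them. Edges then increase vertex numbers, which gives
    acyclicity. *)
Definition mc (v : mnode) : nat :=
  match v with
  | SS j r => pack 0 j 0 r
  | TT l r => pack 1 l 0 r
  | EE j l r => pack 2 j l r
  | ZZ j r => pack 3 j 0 r
  | NN i b r => pack 4 (n - i) b r
  | Top => 0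
  end.

Definition dec (v : nat) : mnode :=
  let r := v %% B in let b := v %/ B %% B in let a := v %/ B %/ B %% B in
  match v %/ B %/ B %/ B with
  | 0 => SS a r
  | 1 => TT a r
  | 2 => EE a b r
  | 3 => ZZ a r
  | _ => NN (n - a) b r
  end.

(** Five types with three digits of a node, one bit for chain or pyramid, two coordinates in the
    gadget. *)
Definition nver := 5 * B * B * B * 2 * B * B.

Definition chc v b k := ((mc v * 2 + 0) * B + b) * B + k.

Definition pyc v s c := if s == 0 then chc v c (size (itm p v)) else ((mc v * 2 + 1) * B + s) * B + c.

Definition outc v := pyc v (mhgt p v).-1 0.

Definition uy u := u %% B.
Definition ux u := u %/ B %% B.
Definition uk u := u %/ B %/ B %% 2.
Definition uv u := u %/ B %/ B %/ 2.

Definition vok u :=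
  let v := dec (uv u) in
  [&& mc v == uv u, mvalid p v &
    if uk u == 0 then (ux u < mhgt p v) && (uy u <= size (itm p v))
    else (0 < ux u) && (uy u + ux u < mhgt p v)].

Definition isout u := (u == outc (dec (uv u))) && (if dec (uv u) is SS _ _ then true else if dec (uv u) is NN 0 _ _ then true else false).

(** What the spine has to read: numbers that are no gadget vertex, and the apexes of selectors and
    of the quantifier nodes of level 0. Every other vertex has a successor in some gadget. *)
Definition marked u := ~~ vok u || isout u.

(** Vertex 0 is the bottom of a chain of [SS 0 0]; having no predecessors, it is a harmless item for
    the remaining places of the spine. *)
Definition tgt u := if marked u then u else 0.

Definition edge u w :=
  if w < nver then
    let v := dec (uv w) in
    vok w && (if uk w == 0 then (0 < uy w) && ((u == w.-1) || (u == outc (nth Top (itm p v) (uy w).-1)))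
              else (u == pyc v (ux w).-1 (uy w)) || (u == pyc v (ux w).-1 (uy w).+1))
  else (nver < w) && ((u == w.-1) || (u == tgt (w - nver).-1)).

Hypothesis n_pos : 0 < n.
Hypothesis m_pos : 0 < m.
Hypothesis tau_pos : 0 < ptau p.
Hypothesis taus_pos : 0 < ptaus p.
Hypothesis om_pos : 0 < pom p.
Hypothesis rho_pos : 0 < prho p.
Hypothesis nB : n * 2 < B.
Hypothesis mB : m.+2 <= B.
Hypothesis tauB : ptau p <= B.
Hypothesis tausB : ptaus p <= B.
Hypothesis omB : pom p <= B.
Hypothesis rhoB : prho p <= B.
Hypothesis fitB : forall v, mvalid p v -> v <> Top -> mhgt p v < B /\ size (itm p v) < B.
Hypothesis hgt_pos : forall v, mvalid p v -> 0 < mhgt p v.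

Lemma pack_div ty a b r : a < B -> b < B -> r < B -> pack ty a b r %/ B %/ B %/ B = ty.
Proof. by move=> aB bB rB; rewrite /pack !pair_div. Qed.

Lemma mcK v : mvalid p v -> v <> Top -> dec (mc v) = v.
Proof.
have B0 : 0 < B by lia.
case: v => //= [l r|j r|j l r|j r|i b r] H _; rewrite /dec pack_div; try lia; rewrite /pack ?pair_div ?pair_mod ?subKn //; lia.
Qed.

Lemma mc_bound v : mvalid p v -> v <> Top -> mc v < 5 * B * B * B.
Proof.
have B0 : 0 < B by lia.
case: v => //= [l r|j r|j l r|j r|i b r] H _; rewrite /pack; do 3! (apply: pair_bound; first lia); lia.
Qed.

Lemma itm_not_top v u : u \in itm p v -> u <> Top.
Proof.
have T l u' N : u' \in mkseq (TT l) N -> u' <> Top by case/mapP=> ? _ ->.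
have S l u' N : u' \in mkseq (SS l) N -> u' <> Top by case/mapP=> ? _ ->.
case: v => //= [j l r|j r|i b r]; rewrite mem_cat => /orP[].
- exact: T.
- exact: S.
- by case/mapP=> ? _ ->.
- exact: S.
- by rewrite /itms; case: ifP => _; rewrite ?mem_cat; [case/orP|]; case/mapP=> ? _ ->.
- by case: ifP => // _; exact: T.
Qed.

Lemma mc_item v u : mvalid p v -> v <> Top -> u \in itm p v -> mc u < mc v.
Proof.
have B0 : 0 < B by lia.
move=> vv vT uin; have vu := itm_valid vv uin.
have T l N : u \in mkseq (TT l) N -> exists r, u = TT l r by case/mapP=> r _ ->; exists r.
have S l N : u \in mkseq (SS l) N -> exists r, u = SS l r by case/mapP=> r _ ->; exists r.
have LT ty ty' a b r a' b' r' : ty < ty' -> a < B -> b < B -> r < B -> pack ty a b r < pack ty' a' b' r'.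
  by move=> tt aB bB rB; rewrite /pack; do 3! (apply: pair_lt; first done).
case: v vv vT uin => //= [j l r|j r|i b r] vv _; rewrite mem_cat => /orP[].
- by case/T=> r' Eu; move: vu; rewrite Eu /= => vu; apply: LT; lia.
- by case/S=> r' Eu; move: vu; rewrite Eu /= => vu; apply: LT; lia.
- by case/mapP=> k _ Eu; move: vu; rewrite Eu /= => vu; apply: LT; lia.
- by case/S=> r' Eu; move: vu; rewrite Eu /= => vu; apply: LT; lia.
- have N b' N' : i.+1 < n -> u \in mkseq (NN i.+1 b') N' -> mc u < pack 4 (n - i) b r.
    move=> iN /mapP[r' _ Eu]; move: vu; rewrite Eu /= => vu; rewrite /pack.
    by do 2! (apply: pair_lt; first lia); lia.
  rewrite /itms; case: ifP => iN.
    by rewrite mem_cat => /orP[]; exact: N.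
  by case/mapP=> k _ Eu; move: vu; rewrite Eu /= => vu; apply: LT; lia.
- case: ifP => // _ /T [r' Eu]; move: vu; rewrite Eu /= => vu; apply: LT; lia.
Qed.

Lemma code_bound v kd x y : mvalid p v -> v <> Top -> kd < 2 -> x < B -> y < B -> ((mc v * 2 + kd) * B + x) * B + y < nver.
Proof.
move=> vv vT k2 xB yB; rewrite /nver; do 3! (apply: pair_bound; first done).
exact: mc_bound.
Qed.

Lemma codeK v kd x y u : u = ((mc v * 2 + kd) * B + x) * B + y -> mvalid p v -> v <> Top -> kd < 2 -> x < B -> y < B ->
  [/\ uy u = y, ux u = x, uk u = kd & uv u = mc v].
Proof.
by move=> -> vv vT k2 xB yB; rewrite /uy /ux /uk /uv !pair_div // !pair_mod.
Qed.

Lemma uE u : 0 < B -> u = ((uv u * 2 + uk u) * B + ux u) * B + uy u.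
Proof.
move=> B0; rewrite /uy /ux /uk /uv {1}(divn_eq u B) {1}(divn_eq (u %/ B) B).
by rewrite {1}(divn_eq (u %/ B %/ B) 2).
Qed.

Lemma chc_ok v b k : mvalid p v -> v <> Top -> b < mhgt p v -> k <= size (itm p v) ->
  [/\ chc v b k < nver, vok (chc v b k) & [/\ uy (chc v b k) = k, ux (chc v b k) = b, uk (chc v b k) = 0 & dec (uv (chc v b k)) = v]].
Proof.
move=> vv vT bh ks; have [hB sB] := fitB vv vT.
have [||e1 e2 e3 e4] := codeK (erefl (chc v b k)) vv vT (isT : 0 < 2); [lia|lia|].
split; first by apply: code_bound => //; lia.
  by rewrite /vok e1 e2 e3 e4 mcK // eqxx vv /= bh.
by rewrite e4 mcK.
Qed.

Lemma pyc_ok v s c : mvalid p v -> v <> Top -> 0 < s -> c + s < mhgt p v ->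
  [/\ pyc v s c < nver, vok (pyc v s c) & [/\ uy (pyc v s c) = c, ux (pyc v s c) = s, uk (pyc v s c) = 1 & dec (uv (pyc v s c)) = v]].
Proof.
move=> vv vT s0 ch; have [hB sB] := fitB vv vT.
have E : pyc v s c = ((mc v * 2 + 1) * B + s) * B + c by rewrite /pyc; case: eqP s0 => // ->.
have [||e1 e2 e3 e4] := codeK E vv vT (isT : 1 < 2); [lia|lia|].
split; first by rewrite E; apply: code_bound => //; lia.
  by rewrite /vok e1 e2 e3 e4 mcK // eqxx vv /= s0 ch.
by rewrite e4 mcK.
Qed.

Lemma vokP u : u < nver -> vok u -> exists v, [/\ mvalid p v, v <> Top, dec (uv u) = v &
  (exists b k, [/\ u = chc v b k, b < mhgt p v & k <= size (itm p v)]) \/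
  (exists s c, [/\ u = pyc v s c, 0 < s & c + s < mhgt p v])].
Proof.
have B0 : 0 < B by lia.
move=> uN /and3P[/eqP e1 vv H]; exists (dec (uv u)).
have vT : dec (uv u) <> Top by rewrite /dec; case: (uv u %/ B %/ B %/ B) => [|[|[|[|?]]]].
split=> //; move: H; case: eqP => [k0 /andP[xh ys]|k0 /andP[x0 yx]]; [left|right].
  by exists (ux u), (uy u); split=> //; rewrite /chc e1 {1}(uE u B0) k0.
exists (ux u), (uy u); split=> //.
rewrite /pyc; case: eqP x0 => [->//|_ _]; rewrite e1 {1}(uE u B0).
have lt2 : uk u < 2 by rewrite ltn_mod.
by have -> : uk u = 1 by lia.
Qed.

Lemma outc_ok v : mvalid p v -> v <> Top -> [/\ outc v < nver, vok (outc v) & dec (uv (outc v)) = v].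
Proof.
move=> vv vT; have h0 := hgt_pos vv; rewrite /outc.
have [h1|h1] := eqVneq (mhgt p v).-1 0.
  by rewrite h1 /pyc eqxx; have [? ? [_ _ _ ?]] := chc_ok vv vT h0 (leqnn _).
by have [||? ? [_ _ _ ?]] := @pyc_ok v (mhgt p v).-1 0 vv vT; [lia|lia|].
Qed.

Lemma out_lt v u b k : mvalid p v -> v <> Top -> mvalid p u -> u <> Top -> mc u < mc v -> outc u < chc v b k.
Proof.
move=> vv vT vu uT lt; have [o1 o2 o3] := outc_ok vu uT.
have B0 : 0 < B by lia.
have e : uv (outc u) = mc u by move: o2 => /and3P[/eqP <- _ _]; rewrite o3.
rewrite (uE (outc u) B0) e /chc; have mB' x : x %% B < B by rewrite ltn_mod.
have lt2 : uk (outc u) < 2 by rewrite ltn_mod.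
do 2! (apply: pair_lt; first exact: mB'); lia.
Qed.

Lemma edge_lt u w : edge u w -> u < w.
Proof.
rewrite /edge; case: ltnP => wN; last first.
  case/andP=> w0 /orP[/eqP->|/eqP->]; first lia.
  by rewrite /tgt; case: ifP => _; lia.
case/andP=> vw; have [v [vv vT Ev [[b [k [Ew bh ks]]]|[s [c [Ew s0 sh]]]]]] := vokP wN vw.
  have [_ _ [e1 e2 e3 e4]] := chc_ok vv vT bh ks; rewrite Ev Ew e1 e3 /=.
  case/andP=> k0 /orP[/eqP->|/eqP->]; first by rewrite /chc; lia.
  have uin : nth Top (itm p v) k.-1 \in itm p v by apply: mem_nth; apply: leq_trans ks; rewrite prednK.
  apply: out_lt => //; [exact: itm_valid uin|exact: itm_not_top uin|exact: mc_item uin].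
have [hB sB] := fitB vv vT.
have [_ _ [e1 e2 e3 e4]] := pyc_ok vv vT s0 sh; rewrite Ev Ew e1 e2 e3 /=.
rewrite /pyc; case: (s) s0 sh => [//|s'] _ sh /=.
case: (s' =P 0) => [_|s'0]; last first.
  have B1 : c < B by lia.
  have B2 : c.+1 < B by lia.
  by case/orP=> /eqP->; apply: pair_lt => //; lia.
have B1 : size (itm p v) < B by [].
by case/orP=> /eqP->; rewrite /chc; do 2! (apply: pair_lt; first lia); lia.
Qed.

Lemma usedP v : mvalid p v -> v <> Top -> ~~ (if v is SS _ _ then true else if v is NN 0 _ _ then true else false) ->
  exists v', [/\ mvalid p v', v' <> Top & v \in itm p v'].
Proof.
case: v => //= [l r|j l r|j r|i b r] H _ H'.
- exists (EE 0 l 0); split=> //; first by rewrite /= m_pos om_pos; lia.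
  by rewrite /= mem_cat map_f // mem_iota; lia.
- exists (ZZ 0 0); split=> //=.
  have [k kN ->] := enodeP (H : mvalid p (EE j l r)).
  by rewrite mem_cat map_f // mem_iota.
- exists (NN n.-1 0 0); split=> //=; first by rewrite rho_pos; lia.
  rewrite prednK // mem_cat /itms ltnn; apply/orP; left.
  apply/mapP; exists (j * prho p + r); last by rewrite /znode pair_div ?pair_mod //; lia.
  by rewrite mem_iota add0n /=; apply: pair_bound; lia.
- exists (NN i.-1 0 0); split=> //=; first by rewrite rho_pos; case: (i) H' H => // i'; lia.
  case: i H H' => // i H _ /=; rewrite mem_cat /itms; have -> : i.+1 < n by lia.
  have [-> | ->] : b = 0 \/ b = 1 by lia.
    by rewrite !mem_cat map_f // mem_iota; lia.
  by rewrite !mem_cat [NN i.+1 1 r \in mkseq (NN i.+1 1) _]map_f ?orbT // mem_iota; lia.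
Qed.

Lemma edge_it v b k : mvalid p v -> v <> Top -> b < mhgt p v -> k < size (itm p v) ->
  edge (chc v b k) (chc v b k.+1) /\ edge (outc (nth Top (itm p v) k)) (chc v b k.+1).
Proof.
move=> vv vT bh ks; have [o1 o2 [e1 e2 e3 e4]] := chc_ok vv vT bh ks.
rewrite /edge o1 o2 e1 e3 e4 eqxx /=; split; last by rewrite eqxx orbT.
by rewrite /chc addnS eqxx.
Qed.

Lemma edge_py v s c : mvalid p v -> v <> Top -> c + s.+1 < mhgt p v ->
  edge (pyc v s c) (pyc v s.+1 c) /\ edge (pyc v s c.+1) (pyc v s.+1 c).
Proof.
move=> vv vT cs; have [o1 o2 [e1 e2 e3 e4]] := pyc_ok vv vT (ltn0Sn s) cs.
by rewrite /edge o1 o2 e1 e2 e3 e4 /= !eqxx orbT.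
Qed.

Lemma edge_out u : u < nver -> exists2 w, w < nver * 2 + 1 & edge u w.
Proof.
move=> uN; have [mu|nmu] := boolP (marked u).
  exists (nver + u.+1); first lia.
  by rewrite /edge ifN -?leqNgt ?leq_addr // addKn /= /tgt mu eqxx orbT andbT; lia.
move: nmu; rewrite negb_or negbK => /andP[vu no].
have [v [vv vT Ev [[b [k [Eu bh ks]]]|[s [c [Eu s0 sh]]]]]] := vokP uN vu.
  have [kl|kl] := ltnP k (size (itm p v)).
    exists (chc v b k.+1); last by rewrite Eu; have [] := edge_it vv vT bh kl.
    by have [] := chc_ok vv vT bh kl; lia.
  have Ek : k = size (itm p v) by lia.
  have Eu' : u = pyc v 0 b by rewrite Eu Ek.
  have [h1|h1] := leqP (mhgt p v) 1.
    have hv1 : mhgt p v = 1 by move: h1 bh; clear; lia.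
    have b0 : b = 0 by move: h1 bh; clear; lia.
    have Eo : u = outc v by rewrite Eu' /outc hv1 b0.
    move: no; rewrite /isout Ev Eo eqxx /= => no.
    have [v' [vv' vT' vin]] := usedP vv vT no.
    have il : index v (itm p v') < size (itm p v') by rewrite index_mem.
    have [_] := edge_it vv' vT' (hgt_pos vv') il; rewrite nth_index // => ed.
    by exists (chc v' 0 (index v (itm p v')).+1) => //; have [] := chc_ok vv' vT' (hgt_pos vv') il; lia.
  have [bh1|bh1] := ltnP b.+1 (mhgt p v).
    have h : b + 1 < mhgt p v by lia.
    exists (pyc v 1 b); last by rewrite Eu'; have [] := edge_py vv vT h.
    by have [] := pyc_ok vv vT (isT : 0 < 1) h; lia.
  have h : b.-1 + 1 < mhgt p v by lia.
  exists (pyc v 1 b.-1); last by rewrite Eu'; have [_] := edge_py vv vT h; rewrite prednK //; lia.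
  by have [] := pyc_ok vv vT (isT : 0 < 1) h; lia.
have [cs1|cs1] := ltnP (c + s.+1) (mhgt p v).
  exists (pyc v s.+1 c); last by rewrite Eu; have [] := edge_py vv vT cs1.
  by have [] := pyc_ok vv vT (ltn0Sn s) cs1; lia.
have [c0|c0] := posnP c.
  have Es : s = (mhgt p v).-1 by move: cs1 sh; rewrite c0; clear; lia.
  have Eo : u = outc v by rewrite Eu /outc c0 Es.
  move: no; rewrite /isout Ev Eo eqxx /= => no.
  have [v' [vv' vT' vin]] := usedP vv vT no.
  have il : index v (itm p v') < size (itm p v') by rewrite index_mem.
  have [_] := edge_it vv' vT' (hgt_pos vv') il; rewrite nth_index // => ed.
  by exists (chc v' 0 (index v (itm p v')).+1) => //; have [] := chc_ok vv' vT' (hgt_pos vv') il; lia.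
have h : c.-1 + s.+1 < mhgt p v by lia.
exists (pyc v s.+1 c.-1); last by rewrite Eu; have [_] := edge_py vv vT h; rewrite prednK.
by have [] := pyc_ok vv vT (ltn0Sn s) h; lia.
Qed.

End Code.

Section Graph.
Variables (p : params) (B : nat).
Local Notation n := (pn p).
Local Notation m := (pm p).
Local Notation N0 := (nver B).
Local Notation N := (N0 * 2).+1.

Record good_params : Prop := GoodParams {
  gd_n : 0 < n; gd_m : 0 < m; gd_tau : 0 < ptau p; gd_taus : 0 < ptaus p; gd_om : 0 < pom p; gd_rho : 0 < prho p;
  gd_nB : n * 2 < B; gd_mB : m.+2 <= B; gd_tauB : ptau p <= B; gd_tausB : ptaus p <= B;
  gd_omB : pom p <= B; gd_rhoB : prho p <= B;
  gd_fit : forall v, mvalid p v -> v <> Top -> mhgt p v < B /\ size (itm p v) < B;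
  gd_hgt : forall v, mvalid p v -> 0 < mhgt p v }.

Hypothesis gd : good_params.

Let B0 : 0 < B. Proof. by have := gd_nB gd; lia. Qed.

Definition gedge : rel 'I_N := fun u v => edge p B u v.

Definition gch v b k : 'I_N := inord (if v is Top then N0 + k else chc p B v b k).
Definition glen v := if v is Top then N0 else size (itm p v).
Definition gpy v s c : 'I_N := if s == 0 then gch v c (glen v) else inord (pyc p B v s c).
Definition git v k : 'I_N := inord (if v is Top then tgt p B k else outc p B (nth Top (itm p v) k)).
Definition gown (x : 'I_N) := if x < N0 then dec p B (uv B x) else Top.
Definition glo (x : 'I_N) := if x < N0 then (if uk B x == 0 then ux B x else uy B x) else 0.
Definition ghi (x : 'I_N) := if x < N0 then (if uk B x == 0 then ux B x else uy B x + ux B x) else 0.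

Lemma top_dec v : v = Top \/ v <> Top.
Proof. by case: v; [right..|left]. Qed.

Lemma gchE v b k : v <> Top -> gch v b k = inord (chc p B v b k).
Proof. by case: v. Qed.

Lemma glenE v : v <> Top -> glen v = size (itm p v).
Proof. by case: v. Qed.

Lemma gpyE v s c : v <> Top -> gpy v s c = inord (pyc p B v s c).
Proof. by move=> vT; rewrite /gpy /pyc; case: eqP => // _; rewrite gchE // glenE. Qed.

Lemma gitE v k : v <> Top -> git v k = inord (outc p B (nth Top (itm p v) k)).
Proof. by case: v. Qed.

Lemma chc_okg v b k : mvalid p v -> v <> Top -> b < mhgt p v -> k <= size (itm p v) ->
  [/\ chc p B v b k < N0, vok p B (chc p B v b k) &
    [/\ uy B (chc p B v b k) = k, ux B (chc p B v b k) = b, uk B (chc p B v b k) = 0 & dec p B (uv B (chc p B v b k)) = v]].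
Proof. by case: gd => *; apply: chc_ok. Qed.

Lemma pyc_okg v s c : mvalid p v -> v <> Top -> 0 < s -> c + s < mhgt p v ->
  [/\ pyc p B v s c < N0, vok p B (pyc p B v s c) &
    [/\ uy B (pyc p B v s c) = c, ux B (pyc p B v s c) = s, uk B (pyc p B v s c) = 1 & dec p B (uv B (pyc p B v s c)) = v]].
Proof. by case: gd => *; apply: pyc_ok. Qed.

Lemma outc_okg v : mvalid p v -> v <> Top ->
  [/\ outc p B v < N0, vok p B (outc p B v) & dec p B (uv B (outc p B v)) = v].
Proof. by case: gd => *; apply: outc_ok. Qed.

Lemma edge_itg v b k : mvalid p v -> v <> Top -> b < mhgt p v -> k < size (itm p v) ->
  edge p B (chc p B v b k) (chc p B v b k.+1) /\ edge p B (outc p B (nth Top (itm p v) k)) (chc p B v b k.+1).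
Proof. by case: gd => *; apply: edge_it. Qed.

Lemma edge_pyg v s c : mvalid p v -> v <> Top -> c + s.+1 < mhgt p v ->
  edge p B (pyc p B v s c) (pyc p B v s.+1 c) /\ edge p B (pyc p B v s c.+1) (pyc p B v s.+1 c).
Proof. by case: gd => *; apply: edge_py. Qed.

Lemma gval k : k < N -> (inord k : 'I_N) = k :> nat.
Proof. exact: inordK. Qed.

Lemma chc_val v b k : mvalid p v -> v <> Top -> b < mhgt p v -> k <= size (itm p v) -> gch v b k = chc p B v b k :> nat.
Proof. by move=> vv vT bh ks; rewrite gchE // gval //; have [o _ _] := chc_okg vv vT bh ks; lia. Qed.

Lemma top_val b k : k <= N0 -> gch Top b k = N0 + k :> nat.
Proof. by move=> kN; rewrite /gch gval //; lia. Qed.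

Lemma pyc_val v s c : mvalid p v -> v <> Top -> c + s < mhgt p v -> gpy v s c = pyc p B v s c :> nat.
Proof.
move=> vv vT cs; rewrite gpyE // gval //; have [s0|s0] := posnP s; last first.
  by have [o _ _] := pyc_okg vv vT s0 cs; lia.
by rewrite s0 /pyc eqxx; rewrite s0 addn0 in cs; have [o _ _] := chc_okg vv vT cs (leqnn _); lia.
Qed.

Lemma outc_val v : mvalid p v -> v <> Top -> (inord (outc p B v) : 'I_N) = outc p B v :> nat.
Proof. by move=> vv vT; rewrite gval //; have [o _ _] := outc_okg vv vT; lia. Qed.

Lemma nth_ok v k : mvalid p v -> k < size (itm p v) -> mvalid p (nth Top (itm p v) k) /\ nth Top (itm p v) k <> Top.
Proof. by move=> vv ks; have uin := mem_nth Top ks; split; [exact: itm_valid uin|exact: itm_not_top uin]. Qed.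

Lemma gout v : v <> Top -> out (mhgt p) gpy v = inord (outc p B v).
Proof. by move=> vT; rewrite /out gpyE. Qed.

Lemma tgt_lt k : k < N0 -> tgt p B k < N.
Proof. by move=> kN; rewrite /tgt; case: ifP => _; lia. Qed.

Lemma gedge_lt (x y : 'I_N) : gedge x y -> x < y.
Proof. by case: gd => *; apply: edge_lt; eassumption. Qed.

Lemma gedge_irr (x : 'I_N) : ~~ gedge x x.
Proof. by apply/negP => /gedge_lt; rewrite ltnn. Qed.

Lemma edge_spine u k : edge p B u (N0 + k) = (0 < k) && ((u == (N0 + k).-1) || (u == tgt p B k.-1)).
Proof. by rewrite /edge ifN -?leqNgt ?leq_addr // addKn -{1}[N0]addn0 ltn_add2l. Qed.

Lemma edge_top_step k : edge p B (N0 + k) (N0 + k.+1) /\ edge p B (tgt p B k) (N0 + k.+1).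
Proof. by rewrite !edge_spine addnS /= !eqxx orbT. Qed.

Lemma graph_gg : gadget_graph gedge (mhgt p) glen git gch gpy gown glo ghi (mvalid p).
Proof.
split.
- exact: (gd_hgt gd).
- by move=> v b; rewrite /gpy eqxx.
- move=> v b k vv bh kl; rewrite /gown /glo /ghi; have [vT|vT] := top_dec v.
    rewrite vT in bh kl *; rewrite top_val // ltnNge leq_addr /=.
    by case: b bh.
  rewrite glenE // in kl; have [o1 _ [e1 e2 e3 e4]] := chc_okg vv vT bh kl.
  by rewrite chc_val // o1 e2 e3 e4.
- move=> v s c vv cs; rewrite /gown /glo /ghi; have [vT|vT] := top_dec v.
    rewrite vT in cs *; have -> : s = 0 by case: s cs => //= s; rewrite addnS.
    by rewrite /gpy eqxx top_val // ltnNge leq_addr /=; case: c cs.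
  have [s0|s0] := posnP s.
    rewrite s0 ?addn0 in cs *; have [o1 _ [e1 e2 e3 e4]] := chc_okg vv vT cs (leqnn _).
    by rewrite /gpy eqxx chc_val ?glenE // o1 e2 e3 e4.
  have [o1 _ [e1 e2 e3 e4]] := pyc_okg vv vT s0 cs.
  by rewrite pyc_val // o1 e1 e2 e3 e4.
- move=> v b k vv bh kl; rewrite /gedge; have [vT|vT] := top_dec v.
    by rewrite vT in bh kl *; rewrite !top_val //; [case: (edge_top_step k)|apply: ltnW].
  rewrite glenE // in kl; rewrite !chc_val //; last exact: ltnW.
  by case: (edge_itg vv vT bh kl).
- move=> v b k vv bh kl; rewrite /gedge; have [vT|vT] := top_dec v.
    by rewrite vT in bh kl *; rewrite /git gval ?tgt_lt // top_val //; case: (edge_top_step k).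
  rewrite glenE // in kl; rewrite chc_val // gitE //; have [vn nT] := nth_ok vv kl; rewrite outc_val //.
  by case: (edge_itg vv vT bh kl).
- move=> v s c vv cs; have vT : v <> Top by move=> vT; rewrite vT /= addnS in cs.
  rewrite /gedge !pyc_val //; last lia.
  by case: (edge_pyg vv vT cs).
- move=> v s c vv cs; have vT : v <> Top by move=> vT; rewrite vT /= addnS in cs.
  rewrite /gedge !pyc_val //; last lia.
  by case: (edge_pyg vv vT cs).
Qed.

Lemma graph_gp : gadget_preds gedge (mhgt p) glen git gch gpy (mvalid p).
Proof.
split.
- exact: (gd_hgt gd).
- by move=> v b; rewrite /gpy eqxx.
- move=> v b u vv bh; rewrite /gedge; have [vT|vT] := top_dec v.
    by rewrite vT top_val // edge_spine.
  have [o1 _ [e1 e2 e3 e4]] := chc_okg vv vT bh (leq0n _).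
  by rewrite chc_val // /edge o1 e1 e3 /= andbF.
- move=> v b k u vv bh kl; rewrite /gedge; have [vT|vT] := top_dec v.
    rewrite vT in bh kl *; rewrite top_val // edge_spine addnS /=.
    case/orP => /eqP eu; [left|right]; apply: val_inj => /=; rewrite eu.
      by rewrite top_val //; apply: ltnW.
    by rewrite /git gval ?tgt_lt.
  rewrite glenE // in kl; have [o1 o2 [e1 e2 e3 e4]] := chc_okg vv vT bh kl.
  rewrite chc_val // /edge o1 o2 e1 e3 e4 /= => /orP[] /eqP eu; [left|right]; apply: val_inj => /=; rewrite eu.
    by rewrite chc_val // ?(ltnW kl) // /chc addnS.
  by rewrite gitE //; have [vn nT] := nth_ok vv kl; rewrite outc_val.
- move=> v s c u vv cs; have vT : v <> Top by move=> vT; rewrite vT /= addnS in cs.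
  have [o1 o2 [e1 e2 e3 e4]] := pyc_okg vv vT (ltn0Sn s) cs.
  rewrite /gedge pyc_val // /edge o1 o2 e1 e2 e3 e4 /= => /orP[] /eqP eu; [left|right]; apply: val_inj => /=; rewrite eu pyc_val //; lia.
Qed.

Lemma graph_items v : mvalid p v -> v <> Top -> items glen git v = map (out (mhgt p) gpy) (itm p v).
Proof.
move=> vv vT; rewrite /items glenE //; apply: (@eq_from_nth _ (inord 0)); first by rewrite size_mkseq size_map.
move=> k; rewrite size_mkseq => ks; rewrite nth_mkseq // (nth_map Top) // gitE // gout //.
by case: (nth_ok vv ks).
Qed.

Lemma outc_inj u v : mvalid p u -> u <> Top -> mvalid p v -> v <> Top -> outc p B u = outc p B v -> u = v.
Proof.
move=> vu uT vv vT eq; have [_ _ <-] := outc_okg vu uT; have [_ _ <-] := outc_okg vv vT.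
by rewrite eq.
Qed.

Lemma graph_out_inj u v : mvalid p u -> mvalid p v -> out (mhgt p) gpy u = out (mhgt p) gpy v -> u = v.
Proof.
move=> vu vv eq; have eqn : nat_of_ord (out (mhgt p) gpy u) = out (mhgt p) gpy v by rewrite eq.
have oT : nat_of_ord (out (mhgt p) gpy Top) = N0 + N0 by rewrite /out /gpy /= top_val.
have [uT|uT] := top_dec u; have [vT|vT] := top_dec v.
- by rewrite uT vT.
- move: eqn; rewrite uT oT gout // outc_val //; have [o _ _] := outc_okg vv vT; lia.
- move: eqn; rewrite vT oT gout // outc_val //; have [o _ _] := outc_okg vu uT; lia.
- by move: eqn; rewrite !gout // !outc_val //; apply: outc_inj.
Qed.

Lemma itms0_valid v : v \in itms p 0 -> [/\ mvalid p v, v <> Top & exists b r, v = NN 0 b r].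
Proof.
rewrite /itms (gd_n gd) mem_cat => /orP[] /mapP[r]; rewrite mem_iota add0n => /= rr ->.
  by rewrite /= (gd_n gd) rr; split=> //; exists 0, r.
by rewrite /= (gd_n gd) rr; split=> //; exists 1, r.
Qed.

Lemma marked_out v : mvalid p v -> (exists j r, v = SS j r) \/ (exists b r, v = NN 0 b r) -> marked p B (outc p B v).
Proof.
move=> vv kd; have vT : v <> Top by case: kd => -[? [? ->]].
have [o1 o2 o3] := outc_okg vv vT; rewrite /marked /isout o2 o3 eqxx /=.
by case: kd => -[? [? ->]].
Qed.

Lemma mc_out_lt u v : mvalid p v -> v <> Top -> mvalid p u -> u <> Top -> mc p B u < mc p B v -> outc p B u < outc p B v.
Proof.
move=> vv vT vu uT lt; rewrite ltnNge leq_eqVlt; apply/negP => /orP[/eqP eq|lt'].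
  by move: lt; rewrite (outc_inj vv vT vu uT eq) ltnn.
have code w : mvalid p w -> w <> Top -> exists x y, outc p B w = ((mc p B w * 2 + x) * B + y.1) * B + y.2 /\ [/\ x < 2, y.1 < B & y.2 < B].
  move=> vw wT; have [o1 o2 o3] := outc_okg vw wT.
  have e : uv B (outc p B w) = mc p B w by move: o2 => /and3P[/eqP <- _ _]; rewrite o3.
  exists (uk B (outc p B w)), (ux B (outc p B w), uy B (outc p B w)) => /=; split.
    by rewrite -e; apply: uE.
  by rewrite /uk /ux /uy !ltn_mod B0.
have [x [[y1 y2] [E1 [/= x2 yB1 yB2]]]] := code _ vu uT; have [x' [[z1 z2] [E2 [/= x2' zB1 zB2]]]] := code _ vv vT.
move: lt'; rewrite E1 E2 => /ltn_geF; rewrite ltnW //.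
by do 2! (apply: pair_lt; first done); lia.
Qed.

Lemma sorted_subseq (s : seq nat) M : sorted ltn s -> (forall x, x \in s -> x < M) -> subseq s (iota 0 M).
Proof.
move=> ss sM; have -> : s = filter (mem s) (iota 0 M); last exact: filter_subseq.
apply: (irr_sorted_eq ltn_trans ltnn ss); first by apply: sorted_filter (iota_ltn_sorted _ _); apply: ltn_trans.
by move=> x; rewrite mem_filter mem_iota add0n /=; apply/idP/andP => [xs|[]//]; split=> //; apply: sM.
Qed.

(** The spine reads marked vertices in increasing order, and vertex numbers increase along
    [itms p 0], so its nodes are read in the order that the lower bound needs. *)
Lemma graph_items_top : subseq (map (out (mhgt p) gpy) (itms p 0)) (items glen git Top).
Proof.
have Eo : map (out (mhgt p) gpy) (itms p 0) = map (git Top) (map (outc p B) (itms p 0)).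
  rewrite -map_comp; apply/eq_in_map => v vin; have [vv vT [b [r Ev]]] := itms0_valid vin.
  by rewrite gout // /git /= /tgt marked_out //; right; exists b, r.
rewrite Eo; apply: map_subseq; apply: sorted_subseq; last first.
  by move=> x /mapP[v /itms0_valid[vv vT _] ->]; have [] := outc_okg vv vT.
have : sorted (relpre (mc p B) ltn) (itms p 0).
  rewrite -sorted_map /itms (gd_n gd) map_cat -!map_comp.
  have -> : [seq (mc p B \o NN 0 0) i | i <- iota 0 (prho p)] ++ [seq (mc p B \o NN 0 1) i | i <- iota 0 (prho p)] =
    map (fun x => ((4 * B + n) * B) * B + (x %/ prho p) * B + x %% prho p) (iota 0 (prho p * 2)).
    rewrite muln2 -addnn iotaD map_cat add0n; congr (_ ++ _).
      apply/eq_in_map => x; rewrite mem_iota add0n => /= xr.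
      by rewrite divn_small // modn_small //= /pack subn0 !(mul0n, addn0).
    have -> : iota (prho p) (prho p) = map (addn (prho p)) (iota 0 (prho p)) by rewrite -iotaDl addn0.
    rewrite -map_comp; apply/eq_in_map => x; rewrite mem_iota add0n => /= xr.
    have -> : prho p + x = 1 * prho p + x by rewrite mul1n.
    by rewrite pair_div // pair_mod //= /pack subn0 mulnDl.
  rewrite sorted_map; apply: (sub_sorted (e := ltn)); last exact: iota_ltn_sorted.
  have r0 := gd_rho gd; have rB := gd_rhoB gd.
  move=> x y /= xy; rewrite -!addnA ltn_add2l.
  have [qq|qq] := ltnP (x %/ prho p) (y %/ prho p).
    by apply: pair_lt => //; apply: leq_trans rB; rewrite ltn_mod.
  have qe : x %/ prho p = y %/ prho p by apply/eqP; rewrite eqn_leq qq andbT leq_div2r // ltnW.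
  by move: xy; rewrite {1}(divn_eq x (prho p)) {1}(divn_eq y (prho p)) qe !ltn_add2l.
have: forall v, v \in itms p 0 -> mvalid p v /\ v <> Top by move=> v /itms0_valid[].
elim: (itms p 0) => //= v [|w l] //= IHl H /andP[vw pw].
have [vv vT] := H v (mem_head _ _); have [ww wT] : mvalid p w /\ w <> Top by apply: H; rewrite !inE eqxx orbT.
by rewrite mc_out_lt //=; apply: IHl => // u uin; apply: H; rewrite inE uin orbT.
Qed.

Lemma graph_items_top2 k : k < glen Top ->
  (exists2 u, mvalid p u /\ git Top k = out (mhgt p) gpy u & u \in itms p 0 \/ exists j r, u = SS j r) \/
  preds gedge (git Top k) = set0.
Proof.
move=> /= kN; rewrite /git /= /tgt; case: ifP => [mk|_]; last first.
  right; apply/setP=> u; rewrite !inE /gedge gval //; apply/negbTE.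
  have vv : mvalid p (SS 0 0) by rewrite /= (gd_taus gd).
  have vT : SS 0 0 <> Top by [].
  have Ec : chc p B (SS 0 0) 0 0 = 0 by [].
  have [o1 _ [e1 e2 e3 e4]] := chc_okg vv vT (gd_hgt gd vv) (leq0n _).
  by rewrite Ec in o1 e1 e3; rewrite /edge o1 e1 e3 /= andbF.
move: mk; rewrite /marked; case vk: (vok p B k) => /=; last first.
  move=> _; right; apply/setP=> u; rewrite !inE /gedge gval; last lia.
  by rewrite /edge kN vk.
case/andP=> /eqP Ek kd; left.
have [v [vv vT Ev _]] := vokP (gd_n gd) (gd_m gd) (gd_tau gd) (gd_taus gd) (gd_om gd) (gd_rho gd) (gd_nB gd)
  (gd_mB gd) (gd_tauB gd) (gd_tausB gd) (gd_omB gd) (gd_rhoB gd) kN vk.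
rewrite Ev in Ek kd; exists v; first by rewrite gout // Ek.
case: v vv vT kd {Ev Ek} => //= [j r|[|//] b r].
  by move=> *; right; exists j, r.
move=> /and3P[_ b2 rr] _ _; left; rewrite /itms (gd_n gd) mem_cat.
have [-> | ->] : b = 0 \/ b = 1 by lia.
  by rewrite map_f // mem_iota.
by rewrite [NN 0 1 r \in mkseq (NN 0 1) _]map_f ?orbT // mem_iota.
Qed.

Lemma graph_acyclic : acyclic gedge.
Proof.
case=> [//|x c] /= cy; exfalso.
have [y yin lty] : exists2 y, y \in x :: c & forall z, z \in x :: c -> y <= z.
  exists [arg min_(y < x in [pred y | y \in x :: c]) (y : nat)].
    by case: arg_minnP => [|y]; rewrite !inE ?eqxx.
  by case: arg_minnP => [|y _ H z zin]; rewrite ?inE ?eqxx //; apply: H.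
have := prev_cycle (e := gedge) (p := x :: c) cy yin => /gedge_lt; rewrite ltnNge lty //.
by rewrite mem_prev.
Qed.

Lemma edge_two w : exists x y, forall u, edge p B u w -> u = x \/ u = y.
Proof.
rewrite /edge; case: (ltnP w N0) => _; last first.
  by exists w.-1, (tgt p B (w - N0).-1) => u /andP[_ /orP[] /eqP ->]; [left|right].
case: (uk B w =P 0) => _.
  exists w.-1, (outc p B (nth Top (itm p (dec p B (uv B w))) (uy B w).-1)) => u.
  by case/and3P=> _ _ /orP[] /eqP ->; [left|right].
exists (pyc p B (dec p B (uv B w)) (ux B w).-1 (uy B w)), (pyc p B (dec p B (uv B w)) (ux B w).-1 (uy B w).+1) => u.
by case/andP=> _ /orP[] /eqP ->; [left|right].
Qed.

Lemma graph_fan_in : fan_in_le gedge 2.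
Proof.
move=> v; have [x [y H]] := edge_two v.
apply: (@leq_trans #|[set (inord x : 'I_N); inord y]|); last by rewrite cards2; case: eqP.
apply: subset_leq_card; apply/subsetP=> u; rewrite !inE => /H [] <-; apply/orP; [left|right]; by rewrite inord_val.
Qed.

Lemma graph_top : out (mhgt p) gpy Top = ord_max.
Proof. by apply: val_inj; rewrite /= /out /gpy /= top_val //; lia. Qed.

Lemma graph_sink : unique_sink gedge ord_max.
Proof.
move=> v; split=> [sk|-> w]; last first.
  by apply/negP => /gedge_lt /=; have := ltn_ord w; lia.
apply/val_inj/eqP => /=; rewrite eqn_leq -ltnS ltn_ord leqNgt /=; apply/negP => vN.
have [vN0|vN0] := ltnP v N0.
  have [w wN ew] : exists2 w, w < N0 * 2 + 1 & edge p B v w by case: gd => *; apply: edge_out.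
  by have := sk (inord w); rewrite /gedge gval ?ew //; lia.
have := sk (inord v.+1); rewrite /gedge gval // /edge ifN /= ?eqxx ?andbT; lia.
Qed.

End Graph.

(** * Existence of prices, and the sizes in the reduction *)

Section Prices.
Variables (V : finType) (e : rel V).

Lemma reversible_standard P P' : reversible_move e P P' -> standard_move e P P'.
Proof.
case/orP=> [pl|/existsP[x /and3P[xP _ eP]]]; apply/orP; [by left|right].
by apply/existsP; exists x; rewrite xP eP.
Qed.

Lemma rr_pebbling s z : rr e s set0 [set z] -> exists2 Ps, pebbling (reversible_move e) z Ps & pebbling_space Ps <= s.
Proof.
case/rr_path=> l pl [ll ls]; exists l; first by rewrite /pebbling pl ll eqxx.
by apply/bigmax_leqP_seq => P Pin _; apply: ls.
Qed.

Lemma pebbling_price (move : rel {set V}) z Ps : pebbling move z Ps ->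
  exists2 k, is_pebbling_price move z k & k <= pebbling_space Ps.
Proof.
move: {2}(pebbling_space Ps) (leqnn (pebbling_space Ps)) => b.
elim/ltn_ind: b Ps => b IH Ps le pb.
have [[Qs [qb lt]]|nex] := classic (exists Qs, pebbling move z Qs /\ pebbling_space Qs < pebbling_space Ps).
  have [k pk kq] := IH _ (leq_trans lt le) Qs (leqnn _) qb; exists k => //.
  by apply: leq_trans kq _; apply: ltnW.
exists (pebbling_space Ps) => //; split; first by exists Ps.
by move=> Qs qb; rewrite leqNgt; apply/negP => lt; apply: nex; exists Qs.
Qed.

End Prices.

(** Both the empty set and the target can be filled up in topological order to all vertices; the
    second filling is reversed. This shows that a false formula too yields a graph that has a
    price. *)
Lemma forward_pebbling N (e : rel 'I_N.+1) (z : 'I_N.+1) : (forall u v, e u v -> u < v) -> rr e N.+1 set0 [set z].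
Proof.
move=> lt; have irr v : ~~ e v v by apply/negP => /lt; rewrite ltnn.
have up A k : k <= N.+1 -> rr e N.+1 A (adds (fun k => inord k : 'I_N.+1) k A).
  elim: k => [|k IHk] kN /=; first by apply: rr_refl; rewrite -[X in _ <= X]card_ord max_card.
  apply: rr_trans (IHk _) _; first exact: ltnW.
  set D := adds _ _ _; case kD : ((inord k : 'I_N.+1) \in D).
    by rewrite (setUidPr _) ?sub1set //; apply: rr_refl; rewrite -[X in _ <= X]card_ord max_card.
  apply: rr_put.
    apply/subsetP=> u; rewrite inE => /lt; rewrite inordK // => uk.
    by rewrite /D; apply/addsP; right; exists u; rewrite ?inord_val.
  rewrite -[X in _ < X]card_ord -cardsT; apply: proper_card; apply/properP; split; first exact: subsetT.
  by exists (inord k); rewrite ?kD.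
have full A : adds (fun k => inord k : 'I_N.+1) N.+1 A = setT.
  by apply/setP=> x; rewrite [RHS]inE; apply/addsP; right; exists (x : nat); rewrite ?inord_val.
apply: rr_trans (up set0 N.+1 (leqnn _)) _; rewrite full.
by apply: rr_sym => //; rewrite -(full [set z]); apply: up.
Qed.

Lemma good_gen p B : 0 < pn p -> 0 < pm p -> 0 < ptau p -> 0 < ptaus p -> 0 < pom p -> 0 < pdz p -> 0 < pd p ->
  sbud p 0 + plam p + 3 <= prho p -> ptau p + ptaus p <= prho p -> NE p + ptaus p <= prho p ->
  pdz p + pom p + plam p + 4 <= prho p -> pd p <= prho p ->
  (pm p + 4) * 2 * prho p + pn p * 2 + pm p + 3 <= B -> good_params p B.
Proof.
move=> n0 m0 t0 ts0 o0 dz0 d0 S1 S2 S3 S4 S5 B1.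
have B2 : 2 * prho p + (pm p).+1 * prho p + prho p + 3 + pm p + pn p * 2 <= B.
  by apply: leq_trans B1; rewrite !mulnDl mulSn; lia.
have half_lt l : l < pn p * 2 -> l./2 < pn p by lia.
have DTb i : i < pn p -> 0 < DT p i /\ DT p i <= prho p.
  by move=> iN; have := DT_eq n0 iN; have := sbud0 n0 i; have := sbud_min p i; have := mul_tau (p := p) iN; lia.
have ho v : mvalid p v -> 0 < mhgt p v.
  case: v => [l r|j r|j l r|j r|i b r|] //=.
  - by case/andP=> l2 _; have [] := DTb l./2 (half_lt _ l2).
  - by rewrite /DS !addn_gt0 orbT.
  - by move=> _; rewrite addn_gt0 dz0.
have nn : 0 < prho p by lia.
split=> //; try lia.
move=> v vv vT; split.
  case: v vv vT => [l r|j r|j l r|j r|i b r|] // vv _ /=.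
  - by case/andP: vv => l2 _; have [] := DTb l./2 (half_lt _ l2); lia.
  - by rewrite /DS; lia.
  - by lia.
  - by case: eqP; lia.
  - by lia.
case: v vv vT => [l r|j r|j l r|j r|i b r|] // vv _ /=; rewrite ?size_cat ?size_mkseq; try lia.
have : size (itms p i.+1) <= 2 * prho p + (pm p).+1 * prho p.
  by rewrite /itms; case: ifP => _; rewrite ?size_cat !size_mkseq; lia.
by case: ifP => _; rewrite ?size_mkseq /=; lia.
Qed.

(** [nver B] is [10 * B ^ 5], whence the exponent [5 * 16 + 1]. The crude bound [X <= 2 ^ X]
    replaces logarithms by multiples of [X], so that the sizes below stay plain polynomials. *)
Lemma nver_pow B X : 10 <= X -> B <= X ^ 16 -> nver B <= 2 ^ (X * 81) /\ B <= 2 ^ (X * 16).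
Proof.
move=> X10 BX; have XX : X <= 2 ^ X by apply: ltnW; apply: ltn_expl.
have pw k : X ^ k <= 2 ^ (X * k) by case: k => [|k]; rewrite ?muln0 // expnM leq_exp2r.
split; last by apply: leq_trans BX (pw 16).
apply: leq_trans (pw 81); apply: (@leq_trans (10 * (B * B * B * B * B))).
  by rewrite /nver; apply/eq_leq; ring.
have E : X ^ 80 = X ^ 16 * X ^ 16 * X ^ 16 * X ^ 16 * X ^ 16 by rewrite -!expnD.
by rewrite (expnS X 80) E; apply: leq_mul => //; do 4! (apply: leq_mul => //).
Qed.

Section Yes.
Variables (p : params) (B X : nat).
Hypothesis gd : good_params p B.
Hypotheses (X10 : 10 <= X) (BX : B <= X ^ 16) (lamX : X * 81 + X * 16 + 2 <= plam p).
Local Notation z := (ord_max : 'I_(nver B * 2).+1).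

Lemma gap_yes : qval (puniv p) (cnf (pn p) (pm p) (plit p)) (pn p) [::] ->
  rr (@gedge p B) (sbud p 0 + plam p + 3) set0 [set z].
Proof.
move=> qv; rewrite -(graph_top gd).
apply: (fun lb => upper_top (gedge_irr gd) (graph_gp gd) (@graph_items p B) (graph_out_inj gd) lb (graph_items_top2 gd) (gd_n gd) qv).
exists (X * 81), (X * 16); split=> // v vv; have [h1 h2] := nver_pow X10 BX.
have [vT|vT] := top_dec v; first by rewrite vT /= expn_gt0.
have [hB sB] := gd_fit gd vv vT; rewrite glenE //; split; last by apply: leq_trans (ltnW hB) h2.
apply: leq_trans (ltnW sB) (leq_trans h2 _).
by rewrite leq_exp2l // leq_mul.
Qed.

End Yes.

Section No.
Variables (p : params) (B smax : nat).
Hypothesis gd : good_params p B.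
Local Notation z := (ord_max : 'I_(nver B * 2).+1).
Hypothesis clause_of : forall i, i < pn p -> exists2 j, j < pm p & forall l, l < pn p * 2 -> plit p j l -> l./2 = i.
Variable R : nat.
Hypothesis smaxR : smax < NE p + pn p * ptau p + ptaus p + pdz p + pn p * pd p + R.
Hypothesis rhoR : smax < prho p.
Hypothesis tauR : R <= ptau p.
Hypothesis omR : pn p * ptau p + R <= pom p.
Hypothesis tausR : NE p + pn p * ptau p + R <= ptaus p.
Hypothesis dzR : NE p + pn p * ptau p + ptaus p + R <= pdz p.
Hypothesis dR : NE p + pn p * ptau p + R <= pd p.

Lemma gap_no Ps : pebbling (standard_move (@gedge p B)) z Ps -> pebbling_space Ps <= smax ->
  qval (puniv p) (cnf (pn p) (pm p) (plit p)) (pn p) [::].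
Proof.
move=> /andP[pt /eqP lt] sp.
apply: (@lower_top p _ (@gedge p B) (glen p B) (git p B) (gch p B) (gpy p B) (gown p (B:=B)) (glo (B:=B)) (ghi (B:=B))
  (graph_gg gd) (@graph_items p B) (graph_items_top gd) (fun t => nth set0 (set0 :: Ps) t) (size Ps) smax).
- by move=> t tt; apply: (pathP _ pt).
- move=> t tt; apply: leq_trans sp; apply: (leq_bigmax_seq (F := fun P : {set _} => #|P|)) => //.
  by apply: mem_nth; rewrite ltnS.
- exact: (gd_n gd).
- exact: rhoR.
- exact: clause_of.
- move=> i iN; apply: leq_trans smaxR _.
  have := DT_eq (gd_n gd) iN; rewrite /sbud => E.
  have H : (pn p - i) * (pd p + plam p + 2) = (pn p - i) * pd p + (pn p - i) * (plam p + 2) by rewrite -mulnDr addnA.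
  have H2 : (pn p - i) * pd p + i.+1 * pd p = pn p * pd p + pd p.
    by rewrite -mulnDl (_ : pn p - i + i.+1 = (pn p).+1) ?mulSn; lia.
  have H3 := mul_tau (p := p) iN.
  by move: E H H2 H3 dR; clear; lia.
- by rewrite /DS; move: smaxR dzR; clear; lia.
- by rewrite mulSn; move: smaxR tauR; clear; lia.
- by move: smaxR omR; clear; lia.
- by move: smaxR tausR; clear; lia.
- by [].
- by rewrite (graph_top gd) (nth_last set0 (set0 :: Ps)) /= lt inE.
Qed.

End No.

Section Reduction.
Variables (n m K : nat) (lit : nat -> nat -> bool) (univ : nat -> bool).
Hypotheses (n_pos : 0 < n) (K_pos : 0 < K).
Hypothesis clause_of : forall i, i < n -> exists2 j, j < m & forall l, l < n * 2 -> lit j l -> l./2 = i.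

Let m_pos : 0 < m.
Proof. by have [j jm _] := clause_of n_pos; lia. Qed.

(* [rlam] covers the overhead of toggling one node reversibly; every later size absorbs the slack that the
   smaller ones leave. *)
Definition rX := n + m + K + 1000.
Definition rlam := 100 * rX.
(** The slack, computed exactly: [rS + K] minus [rNE], [n * rR], [rtaus], [rdz] and [n * rtaus]. The
    terms in [rlam] are the reversible overheads occurring in [sbud] and [upper_top]. *)
Definition rR := 3 * rlam + 11 + n * (rlam + 2) + K.
Definition rom := n * rR + rR.
Definition rNE := n * 2 * m * rom.
Definition rtaus := rNE + n * rR + rR.
Definition rdz := rNE + n * rR + rtaus + rR.
Definition rS := rNE + n * rR + rtaus + rdz + 2 * rlam + 8 + n * (rtaus + rlam + 2) + rlam + 3.
Definition rrho := rS + K.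
Definition rB := (m + 4) * 2 * rrho + n * 2 + m + 3.
Definition rpar := Params n m lit univ rlam rR rom rtaus rdz rtaus rrho.

Let sb0 : sbud rpar 0 + rlam + 3 = rS.
Proof. by rewrite /sbud /NE /= subn0. Qed.

Let X0 : 1000 <= rX. Proof. by rewrite /rX; lia. Qed.
Let nX : n <= rX. Proof. by rewrite /rX; lia. Qed.
Let mX : m + 4 <= rX. Proof. by rewrite /rX; lia. Qed.
Let KX : K <= rX. Proof. by rewrite /rX; lia. Qed.

Lemma pow_step c k : c <= 1000 -> c * rX ^ k <= rX ^ k.+1.
Proof. by move=> c1; rewrite expnS leq_mul // (leq_trans c1). Qed.

Lemma pow_mul a b j k : a <= rX ^ j -> b <= rX ^ k -> a * b <= rX ^ (j + k).
Proof. by move=> ha hb; rewrite expnD leq_mul. Qed.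

Lemma pow_le j k : j <= k -> rX ^ j <= rX ^ k.
Proof. by move=> jk; rewrite leq_pexp2l //; move: X0; lia. Qed.

Lemma rB_bound : rB <= rX ^ 16.
Proof.
have p1 : rX ^ 1 = rX by rewrite expn1.
have p0 : rX ^ 0 = 1 by [].
have st k : 1000 * rX ^ k <= rX ^ k.+1 by apply: pow_step.
have nm b k : b <= rX ^ k -> n * b <= rX ^ k.+1 by move=> h; rewrite expnS leq_mul.
have lam : rlam <= rX ^ 2 by have := st 1; rewrite /rlam p1; lia.
have R : rR <= rX ^ 4.
  have h : rlam + 2 <= 2 * rX ^ 2 by have := st 1; lia.
  have h2 : n * (rlam + 2) <= rX * (2 * rX ^ 2) by rewrite leq_mul.
  by move: h2; rewrite mulnCA -expnS /rR; have := st 0; have := st 1; have := st 2; have := st 3; lia.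
have om : rom <= rX ^ 6 by have := nm _ _ R; rewrite /rom; have := st 4; have := st 5; lia.
have ne : rNE <= rX ^ 9.
  have h : n * 2 * m <= rX ^ 3.
    have h1 : n * 2 * m <= rX * 2 * rX by rewrite leq_mul // ?leq_mul //; move: mX; lia.
    by apply: leq_trans h1 _; rewrite mulnAC mulnn [_ * 2]mulnC; have := st 2; lia.
  by rewrite /rNE; apply: (@pow_mul _ _ 3 6).
have nR := nm _ _ R.
have ta : rtaus <= rX ^ 10 by rewrite /rtaus; have := st 4; have := st 5; have := st 6; have := st 7; have := st 8; have := st 9; lia.
have dz : rdz <= rX ^ 11 by rewrite /rdz; have := st 4; have := st 5; have := st 6; have := st 7; have := st 8; have := st 9; have := st 10; lia.
have h12 : n * (rtaus + rlam + 2) <= rX ^ 12.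
  by apply: nm; have := st 10; have := st 9; have := pow_le (isT : 2 <= 9); have := pow_le (isT : 0 <= 9); lia.
have s : rS <= rX ^ 13.
  rewrite /rS; have := st 12; have := pow_le (isT : 0 <= 12); have := pow_le (isT : 9 <= 12); have := pow_le (isT : 5 <= 12).
  by have := pow_le (isT : 10 <= 12); have := pow_le (isT : 11 <= 12); have := pow_le (isT : 2 <= 12); lia.
have r : rrho <= rX ^ 14 by rewrite /rrho; have := st 13; have := pow_le (isT : 1 <= 13); move: KX; lia.
have h15 : (m + 4) * 2 * rrho <= rX * 2 * rX ^ 14 by rewrite leq_mul // leq_mul.
have E15 : rX * 2 * rX ^ 14 = 2 * rX ^ 15 by rewrite mulnAC -expnS mulnC.
move: h15; rewrite E15 /rB; have := st 15; have := pow_le (isT : 1 <= 15); move: nX mX X0; lia.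
Qed.

Lemma r_good : good_params rpar rB.
Proof.
have R1 : 0 < rR by rewrite /rR addnC ltn_addr.
have nR1 : rR <= n * rR by rewrite leq_pmull.
have dR : rtaus <= n * (rtaus + rlam + 2) by rewrite -addnA; apply: leq_trans (leq_pmull _ n_pos); apply: leq_addr.
move: R1 nR1 dR; rewrite /rpar.
have := erefl rS; rewrite {2}/rS; have := erefl rrho; rewrite {2}/rrho; have := erefl rB; rewrite {2}/rB.
have := erefl rtaus; rewrite {2}/rtaus; have := erefl rom; rewrite {2}/rom; have := erefl rdz; rewrite {2}/rdz.
have := erefl rNE; rewrite {2}/rNE.
move: rB rrho rS rtaus rdz rom rNE rR rlam sb0 => B rho S taus dz om ne R lam _ Ene Edz Eom Eta EB Erho ES R1 nR1 dR.
apply: good_gen => //=; rewrite ?/sbud ?/NE /= -?Ene; lia.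
Qed.

Definition rN := nver rB * 2.
Definition redge : rel 'I_rN.+1 := @gedge rpar rB.
Definition rval := qval univ (cnf n m lit) n [::].

Lemma r_lam : rX * 81 + rX * 16 + 2 <= rlam.
Proof. by rewrite /rlam -mulnDr mulnC; move: X0; move: rX => X; lia. Qed.

Lemma r_yes : rval -> rr redge rS set0 [set ord_max].
Proof.
move=> qv; rewrite -sb0; apply: (gap_yes r_good _ rB_bound r_lam qv).
by apply: leq_trans X0.
Qed.

Lemma r_no Ps : pebbling (standard_move redge) ord_max Ps -> pebbling_space Ps < rS + K -> rval.
Proof.
have KS : (rS + K).-1 < rS + K by rewrite prednK // addn_gt0 K_pos orbT.
move=> pb sp; rewrite /rval; apply: (@gap_no rpar rB (rS + K).-1 r_good clause_of rR _ _ _ _ _ _ _ Ps pb); last first.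
- by rewrite -ltnS prednK // addn_gt0 K_pos orbT.
- by rewrite /NE /= -/rNE.
- by rewrite /NE /= -/rNE.
- by rewrite /NE /= -/rNE.
- by [].
- by [].
- exact: KS.
- apply: leq_trans KS _; rewrite /NE /= -/rNE.
  have : n * (rtaus + rlam + 2) = n * rtaus + n * (rlam + 2) by rewrite -mulnDr addnA.
  rewrite /rS /rR; move: (n * (rtaus + rlam + 2)) (n * rtaus) (n * (rlam + 2)) => a b c; lia.
Qed.

Section Encoded.
Variable move : forall V : finType, rel V -> rel {set V}.
Hypothesis move_rev : forall (V : finType) (e : rel V), subrel (reversible_move e) (@move V e).
Hypothesis move_std : forall (V : finType) (e : rel V), subrel (@move V e) (standard_move e).

Lemma sub_pebbling (m1 m2 : rel {set 'I_rN.+1}) z Ps : subrel m1 m2 -> pebbling m1 z Ps -> pebbling m2 z Ps.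
Proof. by move=> sub /andP[pt l]; rewrite /pebbling l andbT; apply: sub_path pt. Qed.

Lemma encoded_yes : rval -> encodes_with_price move (fun k s => (k%:Z <= s)%R) (encode redge (Posz rS)).
Proof.
move=> qv; have [Ps pb sp] := rr_pebbling (r_yes qv).
have [k pk kP] := pebbling_price (sub_pebbling (@move_rev _ redge) pb).
exists rN.+1, redge, (Posz rS), ord_max, k; split=> //; split=> //.
- exact: graph_acyclic r_good.
- exact: graph_fan_in.
- exact: graph_sink r_good.
- by rewrite lez_nat; apply: leq_trans kP sp.
Qed.

Lemma encoded_no : ~~ rval -> encodes_with_price move (fun k s => (s + K%:Z <= k%:Z)%R) (encode redge (Posz rS)).
Proof.
move=> nq.
have [Ps pb _] := rr_pebbling (forward_pebbling ord_max (gedge_lt r_good)).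
have [k pk _] := pebbling_price (sub_pebbling (@move_rev _ redge) pb).
exists rN.+1, redge, (Posz rS), ord_max, k; split=> //; split=> //.
- exact: graph_acyclic r_good.
- exact: graph_fan_in.
- exact: graph_sink r_good.
- rewrite -PoszD lez_nat leqNgt; apply: contra nq => lt.
  case: pk => -[Qs qb qk] _; apply: (r_no (Ps := Qs)); last by rewrite qk.
  exact: sub_pebbling (@move_std _ redge) qb.
Qed.

End Encoded.
End Reduction.

(** * A stack language compiled to Turing machines *)

Inductive cmd :=
  | Skip | Push of nat & bool | Pop of nat | Seq of cmd & cmd
  | Case of nat & cmd & cmd & cmd | While of nat & cmd.

Definition stacks := nat -> seq bool.

Definition upd (s : stacks) x v : stacks := fun y => if y == x then v else s y.

Section Exec.
Variable ok : pred nat.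

(** Testing [ok] on the height after each push lets one semantics serve for time bounds (with [ok]
    trivial) and for space bounds (with [ok] a ceiling). The step counts are the numbers of
    instructions executed by the compiled code, jumps included. *)
Inductive exec : cmd -> stacks -> nat -> stacks -> Prop :=
  | XSkip s : exec Skip s 0 s
  | XPush x b s : ok (size (s x)).+1 -> exec (Push x b) s 1 (upd s x (b :: s x))
  | XPop x s : exec (Pop x) s 1 (upd s x (behead (s x)))
  | XSeq c1 c2 s1 s2 s3 t1 t2 : exec c1 s1 t1 s2 -> exec c2 s2 t2 s3 -> exec (Seq c1 c2) s1 (t1 + t2) s3
  | XCase x cN cF cT s t s' :
      exec (match s x with [::] => cN | b :: _ => if b then cT else cF end) s t s' -> exec (Case x cN cF cT) s t.+2 s'
  | XWhile0 x c s : s x = [::] -> exec (While x c) s 1 s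
  | XWhileS x c s1 s2 s3 t1 t2 : s1 x <> [::] -> exec c s1 t1 s2 -> exec (While x c) s2 t2 s3 ->
      exec (While x c) s1 (t1 + t2).+2 s3.

End Exec.

Lemma exec_size ok c s t s' : exec ok c s t s' -> forall x, size (s' x) <= size (s x) + t.
Proof.
elim=> {c s t s'} [s|x b s _|x s|c1 c2 s1 s2 s3 t1 t2 _ IH1 _ IH2|x cN cF cT s t s' _ IH|x c s _|x c s1 s2 s3 t1 t2 _ _ IH1 _ IH2] y.
- by rewrite addn0.
- by rewrite /upd; case: eqP => [->|_] /=; lia.
- by rewrite /upd; case: eqP => [->|_] /=; rewrite ?size_behead; lia.
- by have := IH1 y; have := IH2 y; lia.
- by have := IH y; lia.
- by lia.
- by have := IH1 y; have := IH2 y; lia.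
Qed.

Lemma exec_bound ok B c s t s' : exec ok c s t s' -> (forall x, size (s x) + t <= B) -> exec (leq^~ B) c s t s'.
Proof.
elim=> {c s t s'} [s|x b s _|x s|c1 c2 s1 s2 s3 t1 t2 h1 IH1 h2 IH2|x cN cF cT s t s' _ IH|x c s E|x c s1 s2 s3 t1 t2 E h1 IH1 h2 IH2] H.
- exact: XSkip.
- by apply: XPush; have := H x; lia.
- exact: XPop.
- apply: (XSeq (s2 := s2)); first by apply: IH1 => x; have := H x; lia.
  by apply: IH2 => x; have := H x; have := exec_size h1 x; lia.
- by apply: XCase; apply: IH => y; have := H y; lia.
- exact: XWhile0.
- apply: (XWhileS (s2 := s2)) => //; first by apply: IH1 => y; have := H y; lia.
  by apply: IH2 => y; have := H y; have := exec_size h1 y; lia.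
Qed.

Inductive instr := IPush of nat & bool | IPop of nat | IBr of nat & nat & nat & nat.

Fixpoint csize c :=
  match c with
  | Skip => 0 | Push _ _ => 1 | Pop _ => 1 | Seq c1 c2 => csize c1 + csize c2
  | Case _ cN cF cT => (csize cN + (csize cF + (csize cT).+1).+1).+2
  | While _ c => (csize c).+2
  end.

Definition jmp l := IBr 0 l l l.

Fixpoint comp c off : seq instr :=
  match c with
  | Skip => [::]
  | Push x b => [:: IPush x b]
  | Pop x => [:: IPop x]
  | Seq c1 c2 => comp c1 off ++ comp c2 (off + csize c1)
  | Case x cN cF cT =>
      let e := off + csize (Case x cN cF cT) in
      let lF := off.+1 + csize cN + 1 in
      let lT := lF + csize cF + 1 in
      IBr x off.+1 lF lT :: comp cN off.+1 ++ jmp e :: comp cF lF ++ jmp e :: comp cT lT ++ [:: jmp e]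
  | While x c => IBr x (off + csize c).+2 off.+1 off.+1 :: comp c off.+1 ++ [:: jmp off]
  end.

Lemma size_comp c off : size (comp c off) = csize c.
Proof.
elim: c off => //= [c1 IH1 c2 IH2|x cN IHN cF IHF cT IHT|x c IH] off.
- by rewrite size_cat IH1 IH2.
- by rewrite size_cat /= size_cat /= size_cat /= IHN IHF IHT; lia.
- by rewrite size_cat /= IH; lia.
Qed.

Section Flat.
Variables (ok : pred nat) (code : seq instr).

Inductive fstep : nat -> stacks -> nat -> stacks -> Prop :=
  | FPush pc s x b : onth code pc = Some (IPush x b) -> ok (size (s x)).+1 -> fstep pc s pc.+1 (upd s x (b :: s x))
  | FPop pc s x : onth code pc = Some (IPop x) -> fstep pc s pc.+1 (upd s x (behead (s x)))
  | FBr pc s x lN lF lT : onth code pc = Some (IBr x lN lF lT) ->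
      fstep pc s (match s x with [::] => lN | b :: _ => if b then lT else lF end) s.

Inductive fsteps : nat -> nat -> stacks -> nat -> stacks -> Prop :=
  | FNil pc s : fsteps 0 pc s pc s
  | FCons t pc s pc1 s1 pc2 s2 : fstep pc s pc1 s1 -> fsteps t pc1 s1 pc2 s2 -> fsteps t.+1 pc s pc2 s2.

Lemma fsteps_trans t1 t2 pc1 s1 pc2 s2 pc3 s3 :
  fsteps t1 pc1 s1 pc2 s2 -> fsteps t2 pc2 s2 pc3 s3 -> fsteps (t1 + t2) pc1 s1 pc3 s3.
Proof. by elim=> // t pc s pc1' s1' pc2' s2' st _ IH /IH; apply: FCons. Qed.

Lemma fstep1 pc s pc' s' : fstep pc s pc' s' -> fsteps 1 pc s pc' s'.
Proof. by move=> st; apply: FCons st (FNil _ _). Qed.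

Definition code_at off l := exists pre post, code = pre ++ l ++ post /\ size pre = off.

Lemma code_at_cat off l1 l2 : code_at off (l1 ++ l2) -> code_at off l1 /\ code_at (off + size l1) l2.
Proof.
case=> pre [post [E sz]]; split; first by exists pre, (l2 ++ post); rewrite E -catA.
by exists (pre ++ l1), post; rewrite size_cat sz E -!catA.
Qed.

Lemma code_at_cons off i l : code_at off (i :: l) -> onth code off = Some i /\ code_at off.+1 l.
Proof.
rewrite -cat1s => /code_at_cat [[pre [post [E sz]]]]; rewrite addn1; split=> //.
by rewrite E onthE map_cat nth_cat size_map sz ltnn subnn.
Qed.

Lemma fjmp pc l s : onth code pc = Some (jmp l) -> fsteps 1 pc s l s.
Proof. by move=> E; apply: fstep1; have := FBr s E; case: (s 0) => // -[]. Qed.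

Lemma comp_correct c s t s' off : exec ok c s t s' -> code_at off (comp c off) -> fsteps t off s (off + csize c) s'.
Proof.
move=> h; elim: h off => {c s t s'} [s|x b s h|x s|c1 c2 s1 s2 s3 t1 t2 _ IH1 _ IH2|x cN cF cT s t s' _ IH|x c s E|x c s1 s2 s3 t1 t2 E _ IH1 _ IH2] off.
- by rewrite addn0 => _; apply: FNil.
- by case/code_at_cons=> E _; rewrite addn1; apply: fstep1; apply: FPush.
- by case/code_at_cons=> E _; rewrite addn1; apply: fstep1; apply: FPop.
- case/code_at_cat; rewrite size_comp => a1 a2; rewrite /= addnA; apply: fsteps_trans (IH1 _ a1) (IH2 _ a2).
- rewrite /=; case/code_at_cons => E /code_at_cat [aN]; rewrite size_comp => /code_at_cons [eN].
  rewrite -addn1 => /code_at_cat [aF]; rewrite size_comp => /code_at_cons [eF].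
  rewrite -addn1 => /code_at_cat [aT]; rewrite size_comp => /code_at_cons [eT _].
  apply: FCons (FBr s E) _; rewrite -addn1.
  case: (s x) IH => [|[] l] IH; apply: fsteps_trans (IH _ _) _; eassumption || (apply: fjmp; rewrite ?addn1 in eN eF eT *; eassumption).
- case/code_at_cons=> Ei _; have := FBr s Ei; rewrite E /= !addnS => st; exact: fstep1 st.
- move=> ca; case/code_at_cons: (ca) => Ei /code_at_cat [a1]; rewrite size_comp => /code_at_cons [Ej _].
  have := FBr s1 Ei; case Ex : (s1 x) E => [//|b l] _ st.
  apply: (@FCons _ _ _ off.+1 s1); first by case: (b) st.
  rewrite -addnS; apply: fsteps_trans (IH1 _ a1) _; rewrite -add1n; apply: fsteps_trans (fjmp _ Ej) _.
  exact: IH2.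
Qed.

End Flat.

Local Notation thead := Defs.thead.
Local Notation space := Defs.space.

(** * Turing machines executing flat stack code *)

Section Machine.
Variables (nt : nat) (code : seq instr) (acc : pred nat).

Definition instr_ok (i : instr) :=
  match i with IPush x _ => x <= nt | IPop x => x <= nt | IBr x lN lF lT => (x <= nt) && (maxn lN (maxn lF lT) <= size code + 2) end.

Hypothesis code_ok : all instr_ok code.

(** Program counters beyond the code halt, and there is more than one so that acceptance and
    rejection can be separated. The flag marks a push whose head has moved left but whose bit is not
    yet written: a machine writes before it moves, so a push takes two steps. *)
Definition mstate : finType := ('I_(size code + 2).+1 * bool)%type.

Definition mtrans (q : mstate) (hd : {ffun 'I_nt.+1 -> symbol void}) :
    option (mstate * {ffun 'I_nt.+1 -> symbol void * direction}) :=
  match onth code q.1 with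
  | None => None
  | Some (IPush x b) =>
      if q.2 then Some ((inord q.1.+1, false), [ffun i : 'I_nt.+1 => if i == x :> nat then (bit void b, Stay) else (hd i, Stay)])
      else Some ((q.1, true), [ffun i : 'I_nt.+1 => (hd i, if i == x :> nat then MoveL else Stay)])
  | Some (IPop x) => Some ((inord q.1.+1, false),
      [ffun i : 'I_nt.+1 => if (i == x :> nat) && isSome (hd i) then (None, MoveR) else (hd i, Stay)])
  | Some (IBr x lN lF lT) =>
      Some ((inord (match hd (inord x) with None => lN | Some (inl b) => if b then lT else lF | Some (inr a) => lN end), false),
            [ffun i : 'I_nt.+1 => (hd i, Stay)])
  end.

Definition machine : turing_machine :=
  @TuringMachine nt void mstate (ord0, false) (fun q => acc q.1) mtrans.

(** The top of the stack is scanned and the rest lies to its right. [j1] counts cells vacated by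
    pops; a pop turns a symbol into such a cell and a push uses it up again, so [j1 + size s]
    controls the width of the window. An empty stack still scans one blank, hence [j2]. *)
Definition rep B (T : tape void) (s : seq bool) :=
  exists j1 j2, [/\ tleft T = nseq j1 None, thead T :: tright T = map (bit void) s ++ nseq j2 None, j2 <= 1 & j1 + size s <= B].

Definition mrep B (c : config machine) pc (s : stacks) :=
  [/\ (cstate c).1 = pc :> nat, (cstate c).2 = false & forall i : 'I_nt.+1, rep B (ctapes c i) (s i)].

Lemma rep_head B T s : rep B T s -> thead T = match s with [::] => None | b :: _ => bit void b end.
Proof.
case=> j1 [j2 [_ E j21 _]]; move: E; case: s => [|b s] /=; last by case.
by case: j2 j21 => //= j2 _ [].
Qed.

Lemma rep_size B T s : rep B T s -> tape_size T <= B.+1.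
Proof.
case=> j1 [j2 [El Er j21 js]]; rewrite /tape_size El size_nseq.
by have := congr1 size Er; rewrite /= size_cat size_map size_nseq; lia.
Qed.

Lemma tape_eta (A : Type) (T : tape A) : tape_write (thead T) T = T.
Proof. by case: T. Qed.

Lemma rep_push B T s b : rep B T s -> (size s).+1 <= B ->
  rep B (tape_write (bit void b) (tape_move MoveL (tape_write (thead T) T))) (b :: s) /\
  tape_size (tape_move MoveL (tape_write (thead T) T)) <= B.+2.
Proof.
case=> j1 [j2 [El Er j21 js]] sB; rewrite tape_eta; case: T El Er => l h r /= -> Er; split.
  exists j1.-1, j2; split=> //=; first by case: (j1).
    by rewrite Er.
  by lia.
have := congr1 size Er; rewrite /tape_size /= size_behead size_nseq size_cat size_map size_nseq; lia.
Qed.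

Lemma rep_pop B T b s : rep B T (b :: s) -> rep B (tape_move MoveR (tape_write None T)) s.
Proof.
case=> j1 [j2 [El Er j21 js]]; case: T El Er => l h r /= -> [Eh Er].
case: s Er js => [|b' s] Er js; last by exists j1.+1, j2; split=> //=; [rewrite Er|move: js => /=; lia].
exists j1.+1, 1; split=> //=; last by move: js => /=; lia.
by rewrite Er; case: j2 j21 {Er} => [|[|//]].
Qed.

Lemma space_rep B (c : config machine) : (forall i, tape_size (ctapes c i) <= B) -> space c <= nt.+1 * B.
Proof.
move=> H; apply: (@leq_trans (\sum_(i < nt.+1) B)); first by apply: leq_sum => i _; apply: H.
by rewrite sum_nat_const card_ord.
Qed.

Lemma onth_size pc i : onth code pc = Some i -> pc < size code.
Proof. by move=> E; rewrite ltnNge; apply/negP => le; rewrite onth_default in E. Qed.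

Lemma onth_ok pc i : onth code pc = Some i -> instr_ok i.
Proof. by move: code_ok; elim: code pc => [|j l IH] [|pc] //= /andP[aj al]; [case=> <-|apply: IH]. Qed.

Definition next (c : config machine) := odflt c (step c).

Lemma machine_step B pc s pc' s' c : fstep (leq^~ B) code pc s pc' s' -> mrep B c pc s ->
  exists k, [/\ 0 < k <= 2, mrep B (iter k next c) pc' s' &
    forall j, j < k -> space (iter j next c) <= nt.+1 * B.+2 /\ ~~ halted (iter j next c)].
Proof.
move=> st [c1 c2 cR]; have sp : space c <= nt.+1 * B.+2.
  by apply: space_rep => i; apply: leq_trans (rep_size (cR i)) _.
case: st c1 cR => {pc s pc' s'} [pc s x b E sB|pc s x E|pc s x lN lF lT E] c1 cR.
- have pcs := onth_size E.
  set c' := next c.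
  have Ec' : c' = @Config machine ((cstate c).1, true)
      [ffun i : 'I_nt.+1 => tape_move (if i == x :> nat then MoveL else Stay) (tape_write (thead (ctapes c i)) (ctapes c i))].
    rewrite /c' /next /step /= /mtrans c1 E c2 /=; congr Config.
    by apply/ffunP => i; rewrite !ffunE.
  have Ec'' : next c' = @Config machine (inord pc.+1, false)
      [ffun i : 'I_nt.+1 => if i == x :> nat then tape_write (bit void b) (ctapes c' i) else ctapes c' i].
    rewrite /next /step Ec' /= /mtrans /= c1 E /=; congr Config.
    by apply/ffunP => i; rewrite !ffunE; case: eqP => _ //=; rewrite tape_eta.
  exists 2; split=> //.
    rewrite /= -/c' Ec''; split=> //=; first by rewrite inordK //; lia.
    move=> i; rewrite ffunE Ec' ffunE /upd; case: eqP => [Ei|_]; last by rewrite /= tape_eta.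
    by rewrite -Ei; case: (rep_push b (cR i) _) => //; rewrite Ei.
  case=> [|[|//]] _; split=> //=.
  + by rewrite /halted /step /= /mtrans c1 E c2.
  + rewrite -/c' Ec'; apply: space_rep => i; rewrite ffunE; case: eqP => [Ei|_].
      by case: (rep_push b (cR i) _) => //; rewrite Ei.
    by rewrite /= tape_eta; apply: leq_trans (rep_size (cR i)) _.
  + by rewrite -/c' Ec' /halted /step /= /mtrans /= c1 E.
- have pcs := onth_size E; exists 1; split=> //.
    rewrite /= /next /step /= /mtrans c1 E /=; split=> //=; first by rewrite inordK //; lia.
    move=> i; rewrite !ffunE /upd; case: eqP => [Ei|_] /=; last by rewrite tape_eta.
    have := cR i; rewrite Ei; case Es: (s x) => [|b l] ri.
      by rewrite (rep_head ri) /= -(rep_head ri) tape_eta.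
    by rewrite (rep_head ri) /=; apply: rep_pop ri.
  by case=> // _; split=> //; rewrite /halted /step /= /mtrans c1 E.
- have pcs := onth_size E; have := onth_ok E => /= /andP[xn lb]; exists 1; split=> //.
    rewrite /= /next /step /= /mtrans c1 E /=; split=> //=; last first.
      by move=> i; rewrite !ffunE /= tape_eta.
    have Ex : (inord x : 'I_nt.+1) = x :> nat by rewrite inordK.
    by rewrite ffunE (rep_head (cR _)) Ex; case: (s x) => [|[] l] /=; rewrite inordK //; lia.
  by case=> // _; split=> //; rewrite /halted /step /= /mtrans c1 E.
Qed.

Lemma machine_steps B t pc s pc' s' c : fsteps (leq^~ B) code t pc s pc' s' -> mrep B c pc s ->
  exists k, [/\ k <= 2 * t, mrep B (iter k next c) pc' s' & forall j, j <= k -> space (iter j next c) <= nt.+1 * B.+2].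
Proof.
move=> h; elim: h c => {t pc s pc' s'} [pc s|t pc s pc1 s1 pc2 s2 st _ IH] c rc.
  exists 0; split=> // j; rewrite leqn0 => /eqP->; apply: space_rep => i; case: rc => _ _ /(_ i) r.
  by apply: leq_trans (rep_size r) _.
have [k1 [k1b r1 sp1]] := machine_step st rc; have [k2 [k2b r2 sp2]] := IH _ r1.
exists (k2 + k1); split; first lia.
  by rewrite iterD.
move=> j jk; have [jl|jl] := ltnP j k1; first by case: (sp1 j jl).
by rewrite -(subnK jl) iterD; apply: sp2; lia.
Qed.

Lemma run_halted w t : halted (run machine w t) -> forall t', t <= t' -> run machine w t' = run machine w t.
Proof.
move=> h t' tt; rewrite -(subnK tt) /run iterD -/(run machine w t); elim: (t' - t) => //= d ->.
by move: h; rewrite /halted; case: step.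
Qed.

Definition input (w : seq bool) : stacks := fun x => if x == 0 then w else [::].

Lemma mrep_init B w : size w <= B -> mrep B (init machine w) 0 (input w).
Proof.
move=> wB; split=> //= i; rewrite ffunE /input -val_eqE /=; case: (_ == 0).
  case: w wB => [|b w] wB; first by exists 0, 1.
  by exists 0, 0; rewrite /= cats0.
by exists 0, 1.
Qed.

Lemma machine_run B w t pc s : size w <= B -> fsteps (leq^~ B) code t 0 (input w) pc s -> size code <= pc ->
  exists k, [/\ k <= 2 * t, halted (run machine w k), mrep B (run machine w k) pc s &
    forall j, space (run machine w j) <= nt.+1 * B.+2].
Proof.
move=> wB fs pcs; have [k [k2 rk sp]] := machine_steps fs (mrep_init wB).
have hk : halted (run machine w k).
  case: rk => c1 _ _; rewrite /run /halted /step; rewrite -/next /= /mtrans.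
  by rewrite c1 onth_default.
exists k; split=> // j; have [jk|jk] := leqP j k; first exact: sp.
by rewrite (run_halted hk (ltnW jk)); apply: sp.
Qed.

End Machine.

Fixpoint cmax c : nat :=
  match c with
  | Skip => 0 | Push x _ => x | Pop x => x | Seq c1 c2 => maxn (cmax c1) (cmax c2)
  | Case x c1 c2 c3 => maxn x (maxn (cmax c1) (maxn (cmax c2) (cmax c3)))
  | While x c => maxn x (cmax c)
  end.

Definition instr_fits nt N (i : instr) :=
  match i with IPush x _ => x <= nt | IPop x => x <= nt | IBr x lN lF lT => (x <= nt) && (maxn lN (maxn lF lT) <= N) end.

Lemma comp_fits c off nt N : cmax c <= nt -> off + csize c <= N -> all (instr_fits nt N) (comp c off).
Proof.
elim: c off => [|x b|x|c1 IH1 c2 IH2|x cN IHN cF IHF cT IHT|x c IH] off //=; rewrite ?andbT //.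
- by rewrite geq_max all_cat => /andP[h1 h2] oN; rewrite IH1 ?IH2 //; lia.
- move=> h oN; rewrite all_cat /= all_cat /= all_cat /= IHN ?IHF ?IHT //; lia.
- by rewrite geq_max => /andP[h1 h2] oN; rewrite all_cat /= IH //; lia.
Qed.

Lemma instr_fits_ok nt code l : all (instr_fits nt (size code + 2)) l -> all (instr_ok nt code) l.
Proof. by apply: sub_all => -[]. Qed.

Definition mono_poly (c k : nat) : {poly nat} := (c%:P * ('X + 1%:P) ^+ k)%R.

Lemma mono_polyE c k n : (mono_poly c k).[n]%R = c * n.+1 ^ k.
Proof. by rewrite /mono_poly hornerM hornerC horner_exp hornerD hornerX hornerC -[(n + 1)%R]/(n + 1)%N addn1 natrXE. Qed.

Lemma polytime_cmd (f : seq bool -> seq bool) (c : cmd) (a k : nat) :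
  (forall w, exists t s, [/\ t <= a * (size w).+1 ^ k, exec xpredT c (input w) t s & s 0 = f w]) -> polytime_computable f.
Proof.
move=> H; pose nt := cmax c; pose code := comp c 0.
have cok : all (instr_ok nt code) code.
  by apply: instr_fits_ok; apply: comp_fits => //; rewrite /code size_comp; lia.
exists (machine nt code xpredT), (mono_poly (2 * a) k) => w.
have [t [s [tb ex s0]]] := H w; pose B := size w + t.
have exB : exec (leq^~ B) c (input w) t s.
  by apply: exec_bound ex _ => x; rewrite /B /input; case: eqP => _ /=; lia.
have ca : code_at code 0 code by exists [::], [::]; rewrite cats0.
have fs := comp_correct exB ca.
have [||j [j2 hj rj _]] := machine_run xpredT cok (B := B) _ fs; rewrite ?size_comp //; first by rewrite /B; lia.
exists j; split=> //.
  by rewrite mono_polyE -mulnA; apply: leq_trans j2 _; rewrite leq_mul.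
case: rj => _ _ /(_ ord0) [j1 [j2' [_ E _ _]]].
rewrite /output E -s0 /=; elim: (s 0) => [|b l IH] /=; last by rewrite IH.
by case: (j2').
Qed.

(** A final branch on the top of stack [x] leads to one of two halting counters. Only the heights
    are bounded; the number of steps [t] is arbitrary. *)
Lemma pspace_cmd (Q : promise_problem) (c : cmd) (x a k : nat) :
  (forall w, exists B t s, [/\ size w <= B, B <= a * (size w).+1 ^ k, exec (leq^~ B) c (input w) t s &
     (yes_instance Q w -> head false (s x)) /\ (no_instance Q w -> ~~ head false (s x))]) -> PSPACE Q.
Proof.
move=> H; pose nt := maxn x (cmax c); pose N := csize c.
pose code := comp c 0 ++ [:: IBr x N.+1 N.+1 N.+2].
have sc : size code = N.+1 by rewrite size_cat size_comp addn1.
have cok : all (instr_ok nt code) code.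
  apply: instr_fits_ok; rewrite all_cat comp_fits ?leq_maxr //=; last by rewrite sc /N; lia.
  by rewrite sc leq_maxl; lia.
exists (machine nt code (pred1 N.+2)), (mono_poly (nt.+1 * (a + 2)) k) => w.
have [B [t [s [wB Bb ex [yes no]]]]] := H w.
have ca : code_at code 0 (comp c 0) by exists [::], [:: IBr x N.+1 N.+1 N.+2].
have fs := comp_correct ex ca; rewrite add0n in fs.
have E : onth code N = Some (IBr x N.+1 N.+1 N.+2).
  by rewrite onthE map_cat nth_cat size_map size_comp ltnn subnn.
have fs2 := fsteps_trans fs (fstep1 (FBr (leq^~ B) s E)).
set pc := match s x with [::] => _ | _ => _ end in fs2.
have pcN : N < pc by rewrite /pc; case: (s x) => [|[] l].
have [|j [_ hj rj sp]] := machine_run (pred1 N.+2) cok wB fs2; first by rewrite sc.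
have eqpc t' : halted (run (machine nt code (pred1 N.+2)) w t') ->
    tm_accept (cstate (run (machine nt code (pred1 N.+2)) w t')) = head false (s x).
  move=> h; have -> : run (machine nt code (pred1 N.+2)) w t' = run (machine nt code (pred1 N.+2)) w j.
    by have [le|/ltnW le] := leqP t' j; [rewrite (run_halted h le)|rewrite (run_halted hj le)].
  case: rj => /= c1 _ _; rewrite c1 /pc.
  by case: (s x) => [|[] l] /=; rewrite ?eqxx // ltn_eqF.
split.
- by exists j.
- move=> t'; rewrite mono_polyE -mulnA; apply: leq_trans (sp t') _; rewrite leq_mul //.
  rewrite mulnDl; have : 0 < (size w).+1 ^ k by rewrite expn_gt0.
  by move: Bb; move: ((size w).+1 ^ k) => u; move: (a * u) => v; lia.
- by move=> /yes y t' h; rewrite eqpc.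
- by move=> /no y t' h; rewrite eqpc.
Qed.

(** * An arithmetic expression language *)

Definition polyb (f : nat -> nat) := exists c k, forall M, f M <= c * M.+1 ^ k.

Lemma polyb_const c : polyb (fun _ => c).
Proof. by exists c, 0 => M; rewrite muln1. Qed.

Lemma polyb_id : polyb id.
Proof. by exists 1, 1 => M; rewrite mul1n expn1. Qed.

Lemma polyb_add f g : polyb f -> polyb g -> polyb (fun M => f M + g M).
Proof.
move=> [c1 [k1 h1]] [c2 [k2 h2]]; exists (c1 + c2), (k1 + k2) => M; rewrite mulnDl.
apply: leq_add; [apply: leq_trans (h1 M) _|apply: leq_trans (h2 M) _]; rewrite leq_mul // leq_pexp2l //; lia.
Qed.

Lemma polyb_mul f g : polyb f -> polyb g -> polyb (fun M => f M * g M).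
Proof.
move=> [c1 [k1 h1]] [c2 [k2 h2]]; exists (c1 * c2), (k1 + k2) => M.
by rewrite expnD mulnACA leq_mul.
Qed.

Lemma polyb_comp f g : polyb f -> polyb g -> polyb (fun M => f (g M)).
Proof.
move=> [c1 [k1 h1]] [c2 [k2 h2]]; exists (c1 * c2.+1 ^ k1), (k2 * k1) => M.
apply: leq_trans (h1 _) _; rewrite -mulnA leq_mul // expnM -expnMn.
case: k1 {h1} => [|k1]; first by rewrite !expn0.
rewrite leq_exp2r // mulSn; have := h2 M; have : 0 < M.+1 ^ k2 by rewrite expn_gt0.
lia.
Qed.

(** Bounded sums are the only iteration, so values are polynomial in the string lengths and the
    variables. This makes unary arithmetic on stacks affordable. *)
Inductive expr :=
  | EConst of nat | EVar of nat | ESize of bool | ENth of bool & expr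
  | EAdd of expr & expr | EMul of expr & expr | ESub of expr & expr | ESum of nat & expr & expr.

Definition eupd (env : nat -> nat) d i := fun x => if x == d then i else env x.

Fixpoint eval (w a : seq bool) (e : expr) (env : nat -> nat) : nat :=
  match e with
  | EConst c => c
  | EVar i => env i
  | ESize b => size (if b then a else w)
  | ENth b e => nth false (if b then a else w) (eval w a e env)
  | EAdd e1 e2 => eval w a e1 env + eval w a e2 env
  | EMul e1 e2 => eval w a e1 env * eval w a e2 env
  | ESub e1 e2 => eval w a e1 env - eval w a e2 env
  | ESum d e1 e2 => \sum_(i < eval w a e1 env) eval w a e2 (eupd env d i)
  end.

(* Stacks 0 and 1 hold the two input strings; [vr i] holds the variable i and [tv k] the k-th temporary,
   both in unary. *)
Definition tv k := k.*2.+3.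
Definition vr i := i.*2.+2.
Definition ar (b : bool) : nat := b.

Ltac steq := let y := fresh "y" in apply: functional_extensionality => y; rewrite /upd;
  repeat (match goal with |- context [?a == ?b] => case: (a =P b) => ? end); subst; try done; try (exfalso; unfold tv, vr, ar in *; lia).

Ltac updr := rewrite /upd;
  repeat (match goal with |- context [?a == ?b] => case: (a =P b) => ? end); subst; try done; try (exfalso; unfold tv, vr, ar in *; lia).

Fixpoint pushes x n := if n is n'.+1 then Seq (Push x true) (pushes x n') else Skip.
Definition mvt x y := While x (Seq (Pop x) (Push y true)).
Definition clear x := While x (Pop x).
Definition mvbit x y := Case x Skip (Seq (Pop x) (Push y false)) (Seq (Pop x) (Push y true)).
Definition mvb x y := While x (mvbit x y).
Definition mvbc x y z := While x (Seq (mvbit x y) (Push z true)).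
Definition copy x y z := Seq (While x (Seq (Pop x) (Seq (Push y true) (Push z true)))) (mvt z x).

Fixpoint ecomp (e : expr) (k : nat) : cmd :=
  match e with
  | EConst c => pushes (tv k) c
  | EVar i => copy (vr i) (tv k) (tv k.+1)
  | ESize b => Seq (mvb (ar b) (tv k.+1)) (mvbc (tv k.+1) (ar b) (tv k))
  | ENth b e => Seq (ecomp e k.+1) (Seq (While (tv k.+1) (Seq (Pop (tv k.+1)) (mvbit (ar b) (tv k.+2))))
      (Seq (Case (ar b) Skip Skip (Push (tv k) true)) (mvb (tv k.+2) (ar b))))
  | EAdd e1 e2 => Seq (ecomp e1 k) (Seq (ecomp e2 k.+1) (mvt (tv k.+1) (tv k)))
  | EMul e1 e2 => Seq (ecomp e1 k.+1) (Seq (ecomp e2 k.+2)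
      (Seq (While (tv k.+1) (Seq (Pop (tv k.+1)) (copy (tv k.+2) (tv k) (tv k.+3)))) (clear (tv k.+2))))
  | ESub e1 e2 => Seq (ecomp e1 k) (Seq (ecomp e2 k.+1) (While (tv k.+1) (Seq (Pop (tv k.+1)) (Pop (tv k)))))
  | ESum d e1 e2 => Seq (ecomp e1 k.+1) (Seq (mvt (vr d) (tv k.+2))
      (Seq (While (tv k.+1) (Seq (Pop (tv k.+1)) (Seq (ecomp e2 k.+3) (Seq (mvt (tv k.+3) (tv k)) (Push (vr d) true)))))
        (Seq (clear (vr d)) (mvt (tv k.+2) (vr d)))))
  end.

Section Timed.
Local Notation exec := (exec xpredT).

Definition within b c s s' := exists2 t, t <= b & exec c s t s'.

Lemma within_leq b b' c s s' : b <= b' -> within b c s s' -> within b' c s s'.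
Proof. by move=> le [t tb ex]; exists t => //; apply: leq_trans le. Qed.

Lemma w_push x b s : within 1 (Push x b) s (upd s x (b :: s x)).
Proof. by exists 1 => //; apply: XPush. Qed.

Lemma w_pop x s : within 1 (Pop x) s (upd s x (behead (s x))).
Proof. by exists 1 => //; apply: XPop. Qed.

Lemma w_skip s : within 0 Skip s s.
Proof. by exists 0 => //; apply: XSkip. Qed.

Lemma w_seq b1 b2 c1 c2 s1 s2 s3 : within b1 c1 s1 s2 -> within b2 c2 s2 s3 -> within (b1 + b2) (Seq c1 c2) s1 s3.
Proof. by move=> [t1 h1 e1] [t2 h2 e2]; exists (t1 + t2); [apply: leq_add|apply: XSeq e1 e2]. Qed.

Lemma w_case b x cN cF cT s s' : within b (match s x with [::] => cN | c :: _ => if c then cT else cF end) s s' ->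
  within b.+2 (Case x cN cF cT) s s'.
Proof. by move=> [t h e]; exists t.+2 => //; apply: XCase. Qed.

Lemma w_loop b x c n (St : nat -> stacks) s s' : St 0 = s -> St n = s' -> (forall i, i < n -> St i x <> [::]) -> s' x = [::] ->
  (forall i, i < n -> within b c (St i) (St i.+1)) -> within (n * b.+2 + 1) (While x c) s s'.
Proof.
move=> <- <-; elim: n St => [|n IHn] St ne e0 st; first by exists 1 => //; apply: XWhile0.
have ne' i : i < n -> St i.+1 x <> [::] by move=> lt; apply: ne.
have st' i : i < n -> within b c (St i.+1) (St i.+2) by move=> lt; apply: st.
have [t2 h2 e2] := IHn (fun i => St i.+1) ne' e0 st'.
have [t1 h1 e1] := st 0 isT; exists (t1 + t2).+2; first by rewrite mulSn; lia.
by apply: XWhileS e1 e2; apply: ne.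
Qed.

(** A loop on a unary counter; [St i] is the state after [i] rounds, the body starting with the
    counter already popped. *)
Lemma w_for b x c n (St : nat -> stacks) s s' : s = St 0 -> s' = St n -> (forall i, i <= n -> St i x = nseq (n - i) true) ->
  (forall i, i < n -> within b c (upd (St i) x (nseq (n - i.+1) true)) (St i.+1)) ->
  within (n * (b + 3) + 1) (While x (Seq (Pop x) c)) s s'.
Proof.
move=> -> -> Hx st; have -> : b + 3 = (1 + b).+2 by lia.
apply: (w_loop (St := St)) => // [i lt||i lt].
- by rewrite Hx ?(ltnW lt) // -subnSK.
- by rewrite Hx // subnn.
apply: w_seq (w_pop _ _) _; rewrite Hx ?(ltnW lt) // -subnSK //=; exact: st.
Qed.

Lemma w_eq b c s s1 s2 : s1 = s2 -> within b c s s1 -> within b c s s2.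
Proof. by move=> <-. Qed.

Lemma w_mvt x y s n : x <> y -> s x = nseq n true ->
  within (n * 4 + 1) (mvt x y) s (upd (upd s x [::]) y (nseq n true ++ s y)).
Proof.
move=> xy sx; apply: (w_for (b := 1) (St := fun i => upd (upd s x (nseq (n - i) true)) y (nseq i true ++ s y))).
- by rewrite subn0 -sx; steq.
- by rewrite subnn; steq.
- by move=> i _; updr.
move=> i lt; apply: w_eq (w_push _ _ _); steq.
Qed.

Lemma w_clear x s : within (size (s x) * 3 + 1) (clear x) s (upd s x [::]).
Proof.
apply: (w_loop (St := fun i => upd s x (drop i (s x)))).
- by rewrite drop0; steq.
- by rewrite drop_size.
- by move=> i lt; rewrite /upd eqxx => E; have := congr1 size E; rewrite size_drop /= => /eqP; rewrite subn_eq0 leqNgt lt.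
- by rewrite /upd eqxx.
move=> i lt; apply: w_eq (w_pop _ _); steq.
by rewrite (drop_nth false lt).
Qed.

Lemma w_mvbit x y b l s : x <> y -> s x = b :: l -> within 4 (mvbit x y) s (upd (upd s x l) y (b :: s y)).
Proof.
move=> xy sx; apply: w_case; rewrite sx; case: b sx => sx; apply: (w_seq (b1 := 1) (b2 := 1) (w_pop _ _));
  apply: w_eq (w_push _ _ _); rewrite sx /=; steq.
Qed.

Lemma w_mvb x y s : x <> y -> within (size (s x) * 6 + 1) (mvb x y) s (upd (upd s x [::]) y (catrev (s x) (s y))).
Proof.
move=> xy; apply: (w_loop (St := fun i => upd (upd s x (drop i (s x))) y (catrev (take i (s x)) (s y)))).
- by rewrite take0 drop0; steq.
- by rewrite take_size drop_size.
- move=> i lt; rewrite /upd eqxx; case: eqP => // _ E.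
  by have := congr1 size E; rewrite size_drop /= => /eqP; rewrite subn_eq0 leqNgt lt.
- by updr.
move=> i lt; set s1 := upd _ _ _.
have E : s1 x = nth false (s x) i :: drop i.+1 (s x) by rewrite /s1 -drop_nth //; updr.
apply: w_eq (w_mvbit xy E); rewrite /s1 (take_nth false lt) -cats1; steq.
by rewrite !catrevE rev_cat.
Qed.

Lemma w_mvbc x y z s : x <> y -> x <> z -> y <> z ->
  within (size (s x) * 7 + 1) (mvbc x y z) s
    (upd (upd (upd s x [::]) y (catrev (s x) (s y))) z (nseq (size (s x)) true ++ s z)).
Proof.
move=> xy xz yz; apply: (w_loop (St := fun i => upd (upd (upd s x (drop i (s x))) y (catrev (take i (s x)) (s y))) z
  (nseq i true ++ s z))).
- by rewrite take0 drop0; steq.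
- by rewrite take_size drop_size.
- move=> i lt; rewrite /upd eqxx; case: eqP => // _; case: eqP => // _ E.
  by have := congr1 size E; rewrite size_drop /= => /eqP; rewrite subn_eq0 leqNgt lt.
- by updr.
move=> i lt; set s1 := upd _ _ _.
have E : s1 x = nth false (s x) i :: drop i.+1 (s x) by rewrite /s1 -drop_nth //; updr.
apply: (w_seq (b1 := 4) (b2 := 1) (w_mvbit xy E)); apply: w_eq (w_push _ _ _).
rewrite /s1 (take_nth false lt) -cats1; steq.
by rewrite !catrevE rev_cat.
Qed.

Lemma w_copy x y z s n : x <> y -> x <> z -> y <> z -> s x = nseq n true -> s z = [::] ->
  within (n * 9 + 2) (copy x y z) s (upd s y (nseq n true ++ s y)).
Proof.
move=> xy xz yz sx sz; pose s1 := upd (upd (upd s x [::]) y (nseq n true ++ s y)) z (nseq n true).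
have H1 : within (n * 5 + 1) (While x (Seq (Pop x) (Seq (Push y true) (Push z true)))) s s1.
  apply: (w_for (b := 2) (St := fun i => upd (upd (upd s x (nseq (n - i) true)) y (nseq i true ++ s y)) z (nseq i true))).
  - by rewrite subn0 -sx; steq.
  - by rewrite subnn /s1; steq.
  - by move=> i _; updr.
  move=> i lt; apply: (w_seq (b1 := 1) (b2 := 1) (w_push _ _ _)); apply: w_eq (w_push _ _ _); steq.
have E : s1 z = nseq n true by rewrite /s1; updr.
have H2 := w_mvt (nesym xz) E.
apply: within_leq (w_seq H1 (w_eq _ H2)); first by lia.
rewrite /s1; steq; by rewrite cats0.
Qed.

Lemma w_pushes x n s : within n (pushes x n) s (upd s x (nseq n true ++ s x)).
Proof.
elim: n s => [|n IHn] s /=; first by apply: w_eq (w_skip s); steq.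
apply: (w_seq (b1 := 1) (b2 := n) (w_push _ _ _)); apply: w_eq (IHn _); steq.
by elim: n {IHn} => //= n ->.
Qed.

End Timed.

Definition good w a env k (s : stacks) :=
  [/\ s 0 = w, s 1 = a, forall i, s (vr i) = nseq (env i) true & forall j, k <= j -> s (tv j) = [::]].

Lemma w_to b b' c s s1 s2 : within b c s s1 -> b <= b' -> s1 = s2 -> within b' c s s2.
Proof. by move=> H le <-; apply: within_leq H. Qed.

Lemma good_upd w a env k k' t v s : good w a env k s -> k <= k' -> t < k' -> good w a env k' (upd s (tv t) v).
Proof.
case=> h0 h1 hv ht kk tk; split=> [||i|j kj]; last by updr; apply: ht; lia.
- by updr.
- by updr.
- by rewrite -hv; updr.
Qed.

(** One polynomial bounds both value and time. [M] also bounds the variables, so that the body of a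
    sum can be handled at a larger bound that covers its index. *)
Definition ecorrect e f := forall k w a env s M, size w <= M -> size a <= M -> (forall i, env i <= M) ->
  good w a env k s ->
  eval w a e env <= f M /\ within (f M) (ecomp e k) s (upd s (tv k) (nseq (eval w a e env) true)).

Ltac poly := repeat first [apply: polyb_add | apply: polyb_mul | done | apply: polyb_const | apply: polyb_id | apply: (polyb_comp (f := _) (g := fun M => M + _))].

Lemma ecorrect_const c : exists2 f, polyb f & ecorrect (EConst c) f.
Proof.
exists (fun=> c); first exact: polyb_const.
move=> k w a env s M _ _ _ [_ _ _ ht]; split=> //; have := w_pushes (tv k) c s.
by rewrite ht // cats0.
Qed.

Lemma ecorrect_var i : exists2 f, polyb f & ecorrect (EVar i) f.
Proof.
exists (fun M => M * 9 + 2); first by poly.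
move=> k w a env s M _ _ he [_ _ hv ht]; split; first by have := he i; rewrite /=; lia.
have xy : vr i <> tv k by rewrite /vr /tv; lia.
have xz : vr i <> tv k.+1 by rewrite /vr /tv; lia.
have yz : tv k <> tv k.+1 by rewrite /tv; lia.
have := w_copy xy xz yz (hv i) (ht k.+1 (leqnSn k)).
rewrite (ht k) // cats0; apply: within_leq; have := he i; lia.
Qed.

Lemma ecorrect_size b : exists2 f, polyb f & ecorrect (ESize b) f.
Proof.
exists (fun M => M * 13 + 2); first by poly.
move=> k w a env s M hw ha _ [h0 h1 _ ht].
have sb : s (ar b) = if b then a else w by case: (b) => /=; rewrite ?h0 ?h1.
have sM : size (s (ar b)) <= M by rewrite sb; case: (b).
split; first by rewrite /= -sb; lia.
have xy : ar b <> tv k.+1 by rewrite /ar /tv; case: (b) => /=; lia.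
have xz : ar b <> tv k by rewrite /ar /tv; case: (b) => /=; lia.
have yz : tv k.+1 <> tv k by rewrite /tv; lia.
have H1 := w_mvb s xy; set s1 := upd _ _ _ in H1.
have E1 : s1 (tv k.+1) = rev (s (ar b)) by rewrite /s1 ht ?leqnSn // -/(rev _); updr.
have H2 := w_mvbc s1 (nesym xy) yz xz.
apply: within_leq (w_seq H1 (w_eq _ H2)); first by rewrite E1 size_rev; lia.
rewrite E1 size_rev /= -sb catrevE revK /s1; steq.
- by rewrite ht // cats0.
- by rewrite cats0.
- by rewrite ht.
Qed.

Lemma ecorrect_add e1 e2 : (exists2 f, polyb f & ecorrect e1 f) -> (exists2 f, polyb f & ecorrect e2 f) ->
  exists2 f, polyb f & ecorrect (EAdd e1 e2) f.
Proof.
move=> [f1 p1 H1] [f2 p2 H2]; exists (fun M => f1 M + (f2 M + (f2 M * 4 + 1))); first by poly.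
move=> k w a env s M hw ha he g; have [v1 w1] := H1 k w a env s M hw ha he g.
have [v2 w2] := H2 k.+1 w a env (upd s (tv k) (nseq (eval w a e1 env) true)) M hw ha he (good_upd _ g (leqnSn k) (ltnSn k)).
split; first by rewrite /=; lia.
case: g => _ _ _ ht; move: v1 w1 v2 w2; rewrite [eval w a (EAdd _ _) _]/=.
move: (eval w a e1 env) (eval w a e2 env) => n1 n2 v1 w1 v2 w2.
have yz : tv k.+1 <> tv k by rewrite /tv; lia.
set s1 := upd _ _ _ in w2; set s2 := upd _ _ _ in w2.
have E : s2 (tv k.+1) = nseq n2 true by rewrite /s2; updr.
refine (w_seq w1 (w_seq w2 (w_to (w_mvt yz E) _ _))); first by lia.
rewrite /s2 /s1; steq; [by rewrite addnC nseqD | by rewrite ht].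
Qed.

Lemma ecorrect_sub e1 e2 : (exists2 f, polyb f & ecorrect e1 f) -> (exists2 f, polyb f & ecorrect e2 f) ->
  exists2 f, polyb f & ecorrect (ESub e1 e2) f.
Proof.
move=> [f1 p1 H1] [f2 p2 H2]; exists (fun M => f1 M + (f2 M + (f2 M * 4 + 1))); first by poly.
move=> k w a env s M hw ha he g; have [v1 w1] := H1 k w a env s M hw ha he g.
have [v2 w2] := H2 k.+1 w a env (upd s (tv k) (nseq (eval w a e1 env) true)) M hw ha he (good_upd _ g (leqnSn k) (ltnSn k)).
split; first by rewrite /=; lia.
case: g => _ _ _ ht; move: v1 w1 v2 w2; rewrite [eval w a (ESub _ _) _]/=.
move: (eval w a e1 env) (eval w a e2 env) => n1 n2 v1 w1 v2 w2.
have yz : tv k.+1 <> tv k by rewrite /tv; lia.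
refine (w_seq w1 (w_seq w2 _)); apply: (@within_leq (n2 * 4 + 1)); first by lia.
apply: (w_for (b := 1) (n := n2) (St := fun i => upd (upd s (tv k) (nseq (n1 - i) true)) (tv k.+1) (nseq (n2 - i) true))).
- by rewrite !subn0.
- by rewrite subnn; steq; rewrite ht.
- by move=> i _; updr.
move=> i lt; apply: w_eq (w_pop _ _); steq.
by rewrite subnS; case: (n1 - i).
Qed.

Lemma ecorrect_mul e1 e2 : (exists2 f, polyb f & ecorrect e1 f) -> (exists2 f, polyb f & ecorrect e2 f) ->
  exists2 f, polyb f & ecorrect (EMul e1 e2) f.
Proof.
move=> [f1 p1 H1] [f2 p2 H2]; exists (fun M => f1 M + (f2 M + ((f1 M * (f2 M * 9 + 2 + 3) + 1) + (f2 M * 3 + 1)))); first by poly.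
move=> k w a env s M hw ha he g; have g1 : good w a env k.+1 s by case: g => a1 a2 a3 a4; split=> // j kj; apply: a4; lia.
have [v1 w1] := H1 k.+1 w a env s M hw ha he g1.
have [v2 w2] := H2 k.+2 w a env (upd s (tv k.+1) (nseq (eval w a e1 env) true)) M hw ha he (good_upd _ g1 (leqnSn k.+1) (ltnSn k.+1)).
move: v1 w1 v2 w2; rewrite [eval w a (EMul _ _) _]/=.
move: (eval w a e1 env) (eval w a e2 env) => n1 n2 v1 w1 v2 w2.
have nn : n1 * n2 <= f1 M * f2 M by apply: leq_mul.
have n19 : n1 * (n2 * 9 + 2 + 3) <= f1 M * (f2 M * 9 + 2 + 3) by apply: leq_mul; lia.
split; first by lia.
case: g => _ _ _ ht.
have xy : tv k.+2 <> tv k by rewrite /tv; lia.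
have xz : tv k.+2 <> tv k.+3 by rewrite /tv; lia.
have yz : tv k <> tv k.+3 by rewrite /tv; lia.
pose St i := upd (upd (upd s (tv k.+1) (nseq (n1 - i) true)) (tv k.+2) (nseq n2 true)) (tv k) (nseq (i * n2) true).
refine (w_seq w1 (w_seq w2 (w_seq (s2 := St n1) _ _))).
  apply: (within_leq (b := n1 * (n2 * 9 + 2 + 3) + 1)); first by lia.
  apply: (w_for (b := n2 * 9 + 2) (n := n1) (St := St)) => //.
  - by rewrite /St subn0 mul0n; steq; rewrite ht.
  - by move=> i _; rewrite /St; updr.
  move=> i lt; apply: w_eq (w_copy xy xz yz (n := n2) _ _); rewrite /St.
  - by steq; rewrite mulSn nseqD.
  - by updr.
  - by updr; rewrite ht //; lia.
refine (w_to (w_clear _ _) _ _); last by rewrite /St subnn; steq; rewrite ht //; lia.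
have -> : St n1 (tv k.+2) = nseq n2 true by rewrite /St; updr.
by rewrite size_nseq; lia.
Qed.

(** The bits before the position are moved to a temporary stack and back, which restores their
    order. On an exhausted string [mvbit] does nothing, so positions out of range read as
    [false]. *)
Lemma ecorrect_nth b e : (exists2 f, polyb f & ecorrect e f) -> exists2 f, polyb f & ecorrect (ENth b e) f.
Proof.
move=> [f1 p1 H1]; exists (fun M => f1 M + ((f1 M * (4 + 3 + 1) + 1) + (3 + (f1 M * 6 + 1)))); first by poly.
move=> k w a env s M hw ha he g; have g1 : good w a env k.+1 s by case: g => a1 a2 a3 a4; split=> // j kj; apply: a4; lia.
have [v1 w1] := H1 k.+1 w a env s M hw ha he g1.
rewrite [eval w a (ENth _ _) _]/=; case: g => h0 h1 _ ht.
have sb : s (ar b) = if b then a else w by case: (b) => /=; rewrite ?h0 ?h1.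
rewrite -sb; move: v1 w1; move: (eval w a e env) => n v1 w1.
split; first by case: nth; lia.
have xy : ar b <> tv k.+2 by rewrite /ar /tv; case: (b) => /=; lia.
have xz : ar b <> tv k.+1 by rewrite /ar /tv; case: (b) => /=; lia.
have xt : ar b <> tv k by rewrite /ar /tv; case: (b) => /=; lia.
set A := s (ar b).
pose St i := upd (upd (upd s (tv k.+1) (nseq (n - i) true)) (ar b) (drop i A)) (tv k.+2) (rev (take i A)).
pose s2 := upd (St n) (tv k) (nseq (nth false A n) true).
refine (w_seq w1 (w_seq (s2 := St n) _ (w_seq (s2 := s2) _ _))).
- apply: (within_leq (b := n * (4 + 1 + 3) + 1)); first by lia.
  apply: (w_for (b := 4 + 1) (n := n) (St := St)) => //.
  + by rewrite /St subn0 take0 drop0 /A; steq; rewrite ht //; lia.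
  + by move=> i _; rewrite /St; updr.
  move=> i lt; have [iA|iA] := ltnP i (size A).
    have E : upd (St i) (tv k.+1) (nseq (n - i.+1) true) (ar b) = nth false A i :: drop i.+1 A.
      by rewrite -drop_nth // /St; updr.
    refine (w_to (w_mvbit xy E) _ _) => //.
    by rewrite /St (take_nth false iA) rev_rcons; steq.
  have E : upd (St i) (tv k.+1) (nseq (n - i.+1) true) (ar b) = [::] by rewrite /St drop_oversize //; updr.
  have ws : within 2 (mvbit (ar b) (tv k.+2)) (upd (St i) (tv k.+1) (nseq (n - i.+1) true)) (upd (St i) (tv k.+1) (nseq (n - i.+1) true)).
    by apply: (w_case (b := 0)); rewrite E; exact: w_skip.
  refine (w_to ws _ _) => //.
  by rewrite /St !drop_oversize ?(leq_trans iA) // !take_oversize ?(leq_trans iA) //; steq.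
- have Ea : St n (ar b) = drop n A by rewrite /St; updr.
  apply: w_case; rewrite Ea.
  have El : nth false A n = head false (drop n A) by rewrite -nth0 nth_drop addn0.
  have E0 : St n (tv k) = [::] by rewrite /St; updr; rewrite ht.
  have Es : within 1 Skip (St n) (St n) by apply: within_leq (w_skip _).
  rewrite /s2 El; case: (drop n A) => [|[] l] /=.
  + by apply: w_eq Es; steq.
  + by apply: w_eq (w_push _ _ _); rewrite E0.
  + by apply: w_eq Es; steq.
have yx := nesym xy.
refine (w_to (w_mvb s2 yx) _ _).
  have -> : s2 (tv k.+2) = rev (take n A) by rewrite /s2 /St; updr.
  by rewrite size_rev size_take; case: ltnP; lia.
have -> : s2 (tv k.+2) = rev (take n A) by rewrite /s2 /St; updr.
have -> : s2 (ar b) = drop n A by rewrite /s2 /St; updr.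
rewrite catrevE revK cat_take_drop /s2 /St subnn; steq.
- by rewrite ht //; lia.
- by rewrite ht //; lia.
Qed.

Lemma good_sum w a env k d s i n v v2 :
  good w a env k s ->
  good w a (eupd env d i) k.+3 (upd (upd (upd (upd s (tv k.+1) n) (tv k.+2) v2) (tv k) v) (vr d) (nseq i true)).
Proof.
case=> h0 h1 hv ht; split; [by updr|by updr| |].
  by move=> j; rewrite /eupd; have [->|/eqP ne] := eqVneq j d; [updr|rewrite -hv; updr].
by move=> j kj; updr; apply: ht; lia.
Qed.

(** The old value of variable [d] is saved on [tv k.+2]; its stack counts the index up while
    [tv k.+1] counts down, and is restored at the end. *)
Lemma ecorrect_sum d e1 e2 : (exists2 f, polyb f & ecorrect e1 f) -> (exists2 f, polyb f & ecorrect e2 f) ->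
  exists2 f, polyb f & ecorrect (ESum d e1 e2) f.
Proof.
move=> [f1 p1 H1] [f2 p2 H2]; pose f2' M := f2 (M + f1 M).
have p2' : polyb f2' by apply: (polyb_comp p2); poly.
exists (fun M => f1 M + ((M * 4 + 1) + ((f1 M * (f2' M + (f2' M * 4 + 1 + 1) + 3) + 1) + ((f1 M * 3 + 1) + (M * 4 + 1))))); first by poly.
move=> k w a env s M hw ha he g; have g1 : good w a env k.+1 s by case: g => a1 a2 a3 a4; split=> // j kj; apply: a4; lia.
have [v1 w1] := H1 k.+1 w a env s M hw ha he g1.
rewrite [eval w a (ESum _ _ _) _]/=.
move: (eval w a e1 env) v1 w1 => n v1 w1.
pose V i := eval w a e2 (eupd env d i); pose C i := \sum_(j < i) V j.
pose St i := upd (upd (upd (upd s (tv k.+1) (nseq (n - i) true)) (tv k.+2) (nseq (env d) true)) (tv k) (nseq (C i) true)) (vr d) (nseq i true).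
have step2 i x : i < n -> V i <= f2' M /\ within (f2' M) (ecomp e2 k.+3) (upd (St i) (tv k.+1) x) (upd (upd (St i) (tv k.+1) x) (tv k.+3) (nseq (V i) true)).
  move=> lt; have E : upd (St i) (tv k.+1) x = upd (upd (upd (upd s (tv k.+1) x) (tv k.+2) (nseq (env d) true)) (tv k) (nseq (C i) true)) (vr d) (nseq i true).
    by rewrite /St; steq.
  rewrite E; apply: H2; [lia|lia| |exact: good_sum].
  by move=> j; rewrite /eupd; case: eqP => _; [|have := he j]; lia.
have Cb : C n <= n * f2' M.
  rewrite /C; apply: (@leq_trans (\sum_(j < n) f2' M)); last by rewrite sum_nat_const card_ord.
  by apply: leq_sum => j _; have [] := step2 j [::] (ltn_ord j).
have nm : n * f2' M <= f1 M * f2' M by rewrite leq_mul2r v1 orbT.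
have nm2 : n * (f2' M + (f2' M * 4 + 1 + 1) + 3) <= f1 M * (f2' M + (f2' M * 4 + 1 + 1) + 3) by rewrite leq_mul2r v1 orbT.
have V0 : \sum_(i < n) eval w a e2 (eupd env d i) = C n by [].
rewrite V0; split; first by lia.
case: g => h0 h1 hv ht; have hd := he d.
have xd : vr d <> tv k.+2 by rewrite /vr /tv; lia.
have xt : tv k.+3 <> tv k by rewrite /tv; lia.
pose s3 := upd (St n) (vr d) [::].
refine (w_seq w1 (w_seq (s2 := St 0) _ (w_seq (s2 := St n) _ (w_seq (s2 := s3) _ _)))).
- have E : upd s (tv k.+1) (nseq n true) (vr d) = nseq (env d) true by rewrite -hv; updr.
  refine (w_to (w_mvt xd E) _ _); first by lia.
  rewrite /St /C big_ord0 subn0; steq; rewrite ?ht ?cats0 //; lia.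
- apply: (within_leq (b := n * (f2' M + (f2' M * 4 + 1 + 1) + 3) + 1)); first by lia.
  apply: (w_for (b := f2' M + (f2' M * 4 + 1 + 1)) (n := n) (St := St)) => //.
    by move=> i _; rewrite /St; updr.
  move=> i lt; have [vi wi] := step2 i (nseq (n - i.+1) true) lt; apply: (w_seq wi).
  set s4 := upd _ _ _; have E4 : s4 (tv k.+3) = nseq (V i) true by rewrite /s4; updr.
  have w4 := w_mvt xt E4; refine (w_to (w_seq w4 (w_push _ _ _)) _ _); first by lia.
  rewrite /s4 /St; steq; first by rewrite /C big_ord_recr /= addnC nseqD.
  by rewrite ht //; lia.
- apply: within_leq (w_clear _ _); have -> : St n (vr d) = nseq n true by rewrite /St; updr.
  by rewrite size_nseq; lia.
have dx := nesym xd; have E : s3 (tv k.+2) = nseq (env d) true by rewrite /s3 /St; updr.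
refine (w_to (w_mvt dx E) _ _); first by lia.
rewrite /s3 /St subnn; steq.
- by rewrite cats0 -hv.
- by rewrite ht //; lia.
- by rewrite ht //; lia.
Qed.

Lemma ecomp_correct e : exists2 f, polyb f & ecorrect e f.
Proof.
elim: e => [c|i|b|b e IH|e1 IH1 e2 IH2|e1 IH1 e2 IH2|e1 IH1 e2 IH2|d e1 IH1 e2 IH2].
- exact: ecorrect_const.
- exact: ecorrect_var.
- exact: ecorrect_size.
- exact: ecorrect_nth.
- exact: ecorrect_add.
- exact: ecorrect_mul.
- exact: ecorrect_sub.
- exact: ecorrect_sum.
Qed.

Lemma w_caseC n x b l cN cF cT s s' : s x = b :: l -> within n (if b then cT else cF) s s' ->
  within n.+2 (Case x cN cF cT) s s'.
Proof. by move=> E h; apply: w_case; rewrite E. Qed.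

Lemma w_caseN n x cN cF cT s s' : s x = [::] -> within n cN s s' -> within n.+2 (Case x cN cF cT) s s'.
Proof. by move=> E h; apply: w_case; rewrite E. Qed.

Definition env0 (_ : nat) := 0.

(** Every environment is realised by some stacks, so the value bound in [ecorrect] applies without
    reference to a state. *)
Lemma eval_bound e : exists2 f, polyb f & forall w a env M, size w <= M -> size a <= M -> (forall i, env i <= M) ->
  eval w a e env <= f M.
Proof.
have [f pf H] := ecomp_correct e; exists f => // w a env M hw ha he.
pose s : stacks := fun y => if y == 0 then w else if y == 1 then a else if odd y then [::] else nseq (env y.-2./2) true.
have g : good w a env 0 s.
  split=> // [i|j _]; rewrite /s /vr /tv.
    by rewrite /= !negbK odd_double doubleK.
  by rewrite /= !negbK odd_double.
by have [] := H 0 w a env s M hw ha he g.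
Qed.

Definition bits_of w el eb : seq bool :=
  mkseq (fun j => 0 < eval w [::] eb (eupd env0 0 j)) (eval w [::] el env0).

Definition bits_cmd el eb :=
  Seq (ecomp el 1) (Seq (While (tv 1) (Seq (Pop (tv 1)) (Seq (ecomp eb 2)
    (Seq (Case (tv 2) (Push (tv 0) false) (Push (tv 0) true) (Push (tv 0) true)) (Seq (clear (tv 2)) (Push (vr 0) true))))))
    (Seq (clear 0) (mvb (tv 0) 0))).

Lemma bits_cmd_ok el eb : exists2 f, polyb f & forall w, exists2 s,
  within (f (size w)) (bits_cmd el eb) (input w) s & s 0 = bits_of w el eb.
Proof.
have [f1 p1 H1] := ecomp_correct el; have [f2 p2 H2] := ecomp_correct eb.
pose f2' M := f2 (M + f1 M).
have p2' : polyb f2' by apply: (polyb_comp p2); poly.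
exists (fun M => f1 M + (f1 M * (f2' M + (3 + (f2' M * 3 + 1 + 1)) + 3) + 1 + (M * 3 + 1 + (f1 M * 6 + 1)))); first by poly.
move=> w; have g0 : good w [::] env0 1 (input w) by split.
have [v1 w1] := H1 1 w [::] env0 (input w) (size w) (leqnn _) (leq0n _) (fun=> leq0n _) g0.
rewrite /bits_of; move: (eval w [::] el env0) v1 w1 => n v1 w1.
set M := size w in v1 w1 *; pose V j := eval w [::] eb (eupd env0 0 j).
pose St i := upd (upd (upd (input w) (tv 1) (nseq (n - i) true)) (tv 0) (rev (mkseq (fun j => 0 < V j) i))) (vr 0) (nseq i true).
pose s3 := upd (St n) 0 [::].
exists (upd (upd s3 (tv 0) [::]) 0 (catrev (s3 (tv 0)) (s3 0))); last first.
  have -> : s3 (tv 0) = rev (mkseq (fun j => 0 < V j) n) by rewrite /s3 /St; updr.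
  have -> : s3 0 = [::] by rewrite /s3; updr.
  by rewrite {1}/upd eqxx catrevE revK cats0.
refine (w_seq w1 (w_seq (s2 := St n) _ (w_seq (s2 := s3) _ _))).
- have nm : n * (f2' M + (3 + (f2' M * 3 + 1 + 1)) + 3) <= f1 M * (f2' M + (3 + (f2' M * 3 + 1 + 1)) + 3) by rewrite leq_mul2r v1 orbT.
  apply: (within_leq (b := n * (f2' M + (3 + (f2' M * 3 + 1 + 1)) + 3) + 1)); first by lia.
  apply: (w_for (b := f2' M + (3 + (f2' M * 3 + 1 + 1))) (n := n) (St := St)) => //.
  + rewrite /St /input subn0 /mkseq /= /rev /=; by steq.
  move=> i lt; set s1 := upd _ _ _.
  have gi : good w [::] (eupd env0 0 i) 2 s1.
    split; rewrite /s1 /St; [by updr|by updr| |by move=> j kj; updr; rewrite /input; case: eqP => //; rewrite /tv; lia].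
    move=> j; rewrite /eupd; have [->|/eqP ne] := eqVneq j 0; first by updr.
    by updr; rewrite /input; case: eqP => //; rewrite /vr; lia.
  have he j : eupd env0 0 i j <= M + f1 M by rewrite /eupd /env0; case: eqP; lia.
  have [v2 w2] := H2 2 w [::] (eupd env0 0 i) s1 (M + f1 M) (leq_addr _ _) (leq0n _) he gi.
  refine (w_seq w2 _); set s2 := upd _ _ _.
  have E2 : s2 (tv 2) = nseq (V i) true by rewrite /s2; updr.
  pose s4 := upd s2 (tv 0) ((0 < V i) :: s2 (tv 0)).
  have wc : within 3 (Case (tv 2) (Push (tv 0) false) (Push (tv 0) true) (Push (tv 0) true)) s2 s4.
    by apply: (w_case (b := 1)); rewrite E2 /s4; case: (V i) => [|v] /=; exact: w_push.
  refine (w_seq wc (w_to (w_seq (w_clear _ _) (w_push _ _ _)) _ _)).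
    have -> : s4 (tv 2) = nseq (V i) true by rewrite /s4; updr.
    by rewrite size_nseq /f2' -/M; rewrite -/(V i) in v2; lia.
  rewrite /s4 /s2 /s1 /St mkseqS rev_rcons; steq.
- by apply: (w_to (w_clear _ _)) => //; have -> : St n 0 = w by rewrite /St; updr.
- apply: (w_to (w_mvb _ _)) => //.
  have -> : s3 (tv 0) = rev (mkseq (fun j => 0 < V j) n) by rewrite /s3 /St; updr.
  by rewrite size_rev size_mkseq; lia.
Qed.

Lemma polytime_bits el eb : polytime_computable (fun w => bits_of w el eb).
Proof.
have [f [a [k fb]] H] := bits_cmd_ok el eb.
apply: (polytime_cmd (c := bits_cmd el eb) (a := a) (k := k)) => w.
by have [s [t tb ex] s0] := H w; exists t, s; split=> //; apply: leq_trans tb (fb _).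
Qed.

(** * Depth-first evaluation of quantified formulas *)

Section Search.
Variables (en eu el : expr).

(** [tv 2] holds the value of the first child and [tv 3] is nonempty at a universal node. The second
    child is visited only if both agree, and then its value is that of the node; otherwise the first
    value decides. *)
Definition branch :=
  Case (tv 2) Skip
    (Case (tv 3) (Seq (Push 1 true) (Push (tv 1) true)) Skip Skip)
    (Case (tv 3) Skip (Seq (Push 1 true) (Push (tv 1) true)) (Seq (Push 1 true) (Push (tv 1) true))).

Lemma w_branch b V s1 : s1 (tv 2) = [:: b] -> s1 (tv 3) = nseq V true ->
  within 6 branch s1 (if b == (0 < V) then upd (upd s1 1 (true :: s1 1)) (tv 1) (true :: s1 (tv 1)) else s1).
Proof.
move=> E2 E3; have ws : within 2 Skip s1 s1 by apply: within_leq (w_skip _).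
have wp : within 2 (Seq (Push 1 true) (Push (tv 1) true)) s1 (upd (upd s1 1 (true :: s1 1)) (tv 1) (true :: s1 (tv 1))).
  by refine (w_to (w_seq (w_push _ _ _) (w_push _ _ _)) _ _).
apply: (@w_caseC 4 _ _ _ _ _ _ _ _ E2).
by case: b {E2} => /=; case: V E3 => [|V'] E3 /=; [apply: (@w_caseN 2)|apply: (@w_caseC 2 _ true (nseq V' true))|
  apply: (@w_caseN 2)|apply: (@w_caseC 2 _ true (nseq V' true))].
Qed.

(* The stack [tv 0] is nonempty while the search runs, [tv 1] is nonempty when the node whose
   branch is stored on stack 1 (latest choice on top) must still be evaluated; otherwise its
   value is on [tv 2]. *)
Definition search_body :=
  Case (tv 1)
    (Case 1 (Pop (tv 0))
       (Seq (Pop 1) (Seq (ecomp eu 3) (Seq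
          branch
          (clear (tv 3)))))
       (Pop 1))
    Skip
    (Seq (ecomp (ESub en (ESize true)) 3)
      (Case (tv 3)
        (Seq (ecomp el 3) (Seq (Pop (tv 2)) (Seq (Case (tv 3) (Push (tv 2) false) (Push (tv 2) true) (Push (tv 2) true))
           (Seq (clear (tv 3)) (Pop (tv 1))))))
        Skip
        (Seq (Push 1 false) (clear (tv 3))))).

Definition search := Seq (Push (tv 0) true) (Seq (Push (tv 1) true) (While (tv 0) search_body)).

Definition sst w a r d v : stacks := fun y =>
  if y == 0 then w else if y == 1 then a else if y == tv 0 then r else if y == tv 1 then d else
  if y == tv 2 then v else [::].

Variables (univ : seq bool -> pred nat) (leaf : seq bool -> pred (seq bool)) (nv : seq bool -> nat).
Hypothesis enE : forall w a, eval w a en env0 = nv w.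
Hypothesis euE : forall w a, (0 < eval w a eu env0) = univ w (size a).
Hypothesis elE : forall w a, size a = nv w -> (0 < eval w (rev a) el env0) = leaf w a.

Lemma good_sst w a r d v : good w a env0 3 (sst w a r d v).
Proof.
split=> // [i|j j3]; rewrite /sst.
  by updr.
by updr.
Qed.

Lemma search_steps : exists2 f, polyb f & forall w a v, size a <= nv w -> size v <= 1 ->
  let St a' d v' := sst w a' [:: true] d v' in
  [/\ size a < nv w -> within (f (size w)) search_body (St a [:: true] v) (St (false :: a) [:: true] v),
      size a = nv w -> within (f (size w)) search_body (St a [:: true] v) (St a [::] [:: leaf w (rev a)]),
      forall b, within (f (size w)) search_body (St (false :: a) [::] [:: b])
        (if b == univ w (size a) then St (true :: a) [:: true] [:: b] else St a [::] [:: b]),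
      forall b, within (f (size w)) search_body (St (true :: a) [::] [:: b]) (St a [::] [:: b]) &
      within (f (size w)) search_body (sst w [::] [:: true] [::] v) (sst w [::] [::] [::] v)].
Proof.
have [f0 p0 H0] := eval_bound en; have [f1 p1 H1] := ecomp_correct (ESub en (ESize true)).
have [f2 p2 H2] := ecomp_correct el; have [f3 p3 H3] := ecomp_correct eu.
pose F (f : nat -> nat) (M : nat) : nat := f (M + f0 M).
have q1 : polyb (F f1) by apply: (polyb_comp p1); poly.
have q2 : polyb (F f2) by apply: (polyb_comp p2); poly.
have q3 : polyb (F f3) by apply: (polyb_comp p3); poly.
exists (fun M => 20 + 4 * F f1 M + 4 * F f2 M + 4 * F f3 M); first by poly.
move=> w a v sa sv; set M := size w.
have nM : nv w <= f0 M by rewrite -(enE w [::]); apply: H0.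
have sM (a' : seq bool) : size a' <= nv w -> size a' <= M + f0 M by move=> s'; apply: leq_trans s' (leq_trans nM (leq_addl _ _)).
rewrite -/M in nM.
have {H1} H1 a' r d v' : size a' <= nv w -> nv w - size a' <= F f1 M /\ within (F f1 M) (ecomp (ESub en (ESize true)) 3)
  (sst w a' r d v') (upd (sst w a' r d v') (tv 3) (nseq (nv w - size a') true)).
  move=> s'; have [x y] := H1 3 w a' env0 _ (M + f0 M) (leq_addr _ _) (sM _ s') (fun=> leq0n _) (good_sst w a' r d v').
  by move: x y; rewrite [eval _ _ (ESub _ _) _]/= enE.
have {H2} H2 a' r d v' : size a' <= nv w -> eval w a' el env0 <= F f2 M /\ within (F f2 M) (ecomp el 3)
  (sst w a' r d v') (upd (sst w a' r d v') (tv 3) (nseq (eval w a' el env0) true)).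
  by move=> s'; have [x y] := H2 3 w a' env0 _ (M + f0 M) (leq_addr _ _) (sM _ s') (fun=> leq0n _) (good_sst w a' r d v').
have {H3} H3 a' r d v' : size a' <= nv w -> eval w a' eu env0 <= F f3 M /\ within (F f3 M) (ecomp eu 3)
  (sst w a' r d v') (upd (sst w a' r d v') (tv 3) (nseq (eval w a' eu env0) true)).
  by move=> s'; have [x y] := H3 3 w a' env0 _ (M + f0 M) (leq_addr _ _) (sM _ s') (fun=> leq0n _) (good_sst w a' r d v').
move=> St; split.
- move=> lt; apply: (within_leq (b := (F f1 M + (1 + (F f1 M * 3 + 1)).+2).+2)); first by lia.
  apply: (w_caseC (b := true) (l := [::])) => //.
  have [x y] := H1 a [:: true] [:: true] v sa; refine (w_seq y _).
  apply: (w_caseC (b := true) (l := nseq (nv w - (size a).+1) true)); first by rewrite /upd eqxx -(subnSK lt).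
  refine (w_seq (w_push _ _ _) (w_to (w_clear _ _) _ _)).
    by rewrite [X in size X](_ : _ = nseq (nv w - size a) true) ?size_nseq; [lia|updr].
  by rewrite /St /sst; steq.
- move=> sE; apply: (within_leq (b := (F f1 M + (F f2 M + (1 + (3 + (F f2 M * 3 + 1 + 1)))).+2).+2)); first by lia.
  apply: (w_caseC (b := true) (l := [::])) => //.
  have [x y] := H1 a [:: true] [:: true] v sa; refine (w_seq y _).
  apply: w_caseN; first by rewrite /upd eqxx sE subnn.
  rewrite sE subnn [nseq 0 true]/=.
  have -> : upd (sst w a [:: true] [:: true] v) (tv 3) [::] = sst w a [:: true] [:: true] v by rewrite /sst; steq.
  have [x2 y2] := H2 a [:: true] [:: true] v sa; refine (w_seq y2 (w_seq (w_pop _ _) _)).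
  set s2 := upd _ _ _; have Es : s2 (tv 3) = nseq (eval w a el env0) true by rewrite /s2; updr.
  have wc : within 3 (Case (tv 3) (Push (tv 2) false) (Push (tv 2) true) (Push (tv 2) true)) s2
      (upd s2 (tv 2) ((0 < eval w a el env0) :: s2 (tv 2))).
    by apply: (w_case (b := 1)); rewrite Es; case: (eval w a el env0) => [|v'] /=; exact: w_push.
  refine (w_seq wc (w_to (w_seq (w_clear _ _) (w_pop _ _)) _ _)).
    by have -> : upd s2 (tv 2) ((0 < eval w a el env0) :: s2 (tv 2)) (tv 3) = nseq (eval w a el env0) true;
       [updr|rewrite size_nseq; lia].
  have -> : (0 < eval w a el env0) = leaf w (rev a) by rewrite -elE ?revK // size_rev.
  have s20 : s2 (tv 2) = [::] by rewrite /s2 /upd /sst /=; case: (v) sv => [|? []].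
  rewrite s20 /s2 /St /sst; steq.
- move=> b; apply: (within_leq (b := (1 + (F f3 M + (6 + (F f3 M * 3 + 1)))).+2.+2)); first by lia.
  apply: w_caseN => //; apply: (w_caseC (b := false) (l := a)) => //.
  refine (w_seq (w_pop _ _) _).
  have -> : upd (St (false :: a) [::] [:: b]) 1 (behead (St (false :: a) [::] [:: b] 1)) = sst w a [:: true] [::] [:: b].
    by rewrite /St /sst; steq.
  have [x y] := H3 a [:: true] [::] [:: b] sa; refine (w_seq y _).
  have U := euE w a; set V := eval _ _ _ _ in U x y *.
  set s1 := upd _ _ _; pose s2 := if b == (0 < V) then upd (upd s1 1 (true :: s1 1)) (tv 1) (true :: s1 (tv 1)) else s1.
  have E2 : s1 (tv 2) = [:: b] by rewrite /s1; updr.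
  have E3 : s1 (tv 3) = nseq V true by rewrite /s1; updr.
  have wc := w_branch E2 E3; rewrite -/s2 in wc.
  refine (w_seq wc (w_to (w_clear _ _) _ _)).
    have -> : s2 (tv 3) = nseq V true by rewrite /s2 /s1; case: (_ == _); updr.
    by rewrite size_nseq; lia.
  by rewrite -U /s2 /s1 /St; case: (_ == _); rewrite /sst; steq.
- move=> b; apply: (within_leq (b := 5)); first by lia.
  apply: w_caseN => //; apply: (w_caseC (b := true) (l := a)) => //.
  by refine (w_to (w_pop _ _) _ _) => //; rewrite /St /sst; steq.
- apply: (within_leq (b := 5)); first by lia.
  apply: w_caseN => //; apply: w_caseN => //.
  by refine (w_to (w_pop _ _) _ _) => //; rewrite /sst; steq.
Qed.

Lemma pspace_qval (Q : promise_problem) :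
  (forall w, yes_instance Q w -> qval (univ w) (leaf w) (nv w) [::]) ->
  (forall w, no_instance Q w -> ~~ qval (univ w) (leaf w) (nv w) [::]) -> PSPACE Q.
Proof.
move=> yes no; have [f pf H] := search_steps; have [f0 p0 H0] := eval_bound en.
have [a [k Hb]] : polyb (fun M => M + f0 M + 3 + f M) by poly.
apply: (pspace_cmd (c := search) (x := tv 2) (a := a) (k := k)) => w.
pose B := size w + f0 (size w) + 3 + f (size w); pose ok := leq^~ B.
have nM : nv w <= f0 (size w) by rewrite -(enE w [::]); apply: H0.
pose q := qval (univ w) (leaf w).
(* Any completion of the loop from [s'] extends to one from [s]. The relation composes without
   counting steps, whose number may be exponential. *)
pose R s s' := forall s'' t, exec ok (While (tv 0) search_body) s' t s'' -> exists t', exec ok (While (tv 0) search_body) s t' s''.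
have Rt s1 s2 s3 : R s1 s2 -> R s2 s3 -> R s1 s3 by move=> h1 h2 s t /h2 [t' /h1].
have R1 a' d v s' : size a' <= nv w -> size d <= 1 -> size v <= 1 ->
    within (f (size w)) search_body (sst w a' [:: true] d v) s' -> R (sst w a' [:: true] d v) s'.
  move=> ha hd hv [t tb ex] s'' t2 ex2; exists (t + t2).+2; apply: XWhileS ex2 => //.
  apply: exec_bound ex _ => y; rewrite /B; apply: leq_add => //; rewrite /sst; move: (f0 _) nM => F nM.
  case: ifP => _; first by rewrite -addnA leq_addr.
  case: ifP => _; first by apply: leq_trans (leq_trans ha nM) _; rewrite addnAC leq_addl.
  have h1 : 0 < size w + F + 3 by rewrite addn3.
  case: ifP => _; first exact: h1.
  case: ifP => _; first exact: leq_trans hd h1.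
  by case: ifP => _; first exact: leq_trans hv h1.
(* Evaluating a subtree of depth [j] restores the path on stack 1 and leaves the value on [tv 2]. *)
have D j a' v : size a' + j = nv w -> size v <= 1 ->
    R (sst w a' [:: true] [:: true] v) (sst w a' [:: true] [::] [:: q j (rev a')]).
  elim: j a' v => [|j IH] a' v sj sv.
    have [|_ /(_ _) h _ _ _] := H w a' v _ sv; first by lia.
    by apply: R1 => //; [lia|apply: h; lia].
  have sa : size a' <= nv w by lia.
  have [h1 _ h3 h4 _] := H w a' v sa sv.
  apply: (@Rt _ _ _ (R1 _ _ _ _ _ _ _ (h1 _)) _) => //; first by lia.
  have sF : size (false :: a') + j = nv w by rewrite /=; lia.
  have sT : size (true :: a') + j = nv w by rewrite /=; lia.
  apply: (@Rt _ _ _ (IH _ _ sF sv) _); set q0 := q j _.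
  have lF : size (false :: a') <= nv w by rewrite /=; lia.
  apply: (@Rt _ _ _ (R1 _ _ _ _ lF _ _ (h3 q0)) _) => //.
  have E : q j.+1 (rev a') = if univ w (size a') then q0 && q j (rev (true :: a')) else q0 || q j (rev (true :: a')).
    by rewrite /q0 /q /= size_rev !rev_cons.
  have up : R (sst w (true :: a') [:: true] [:: true] [:: q0]) (sst w a' [:: true] [::] [:: q j (rev (true :: a'))]).
    by apply: (@Rt _ _ _ (IH _ _ sT _) _) => //; apply: R1 => //; exact: h4.
  rewrite E; case: (q0) (univ w _) up => -[] //= up; by move=> s t ex; exists t.
pose s0 := sst w [::] [:: true] [:: true] [::].
pose s1 := sst w [::] [::] [::] [:: q (nv w) [::]].
have [t ex] : exists t, exec ok (While (tv 0) search_body) s0 t s1.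
  have [_ _ _ _ h5] := H w [::] [:: q (nv w) [::]] (leq0n _) (leqnn _).
  have st := R1 [::] [::] [:: q (nv w) [::]] _ (leq0n _) (leq0n _) (leqnn _) h5.
  have [t1 e1] : exists t, exec ok (While (tv 0) search_body) (sst w [::] [:: true] [::] [:: q (nv w) [::]]) t s1.
    by apply: (st s1 1); apply: XWhile0.
  exact: (D (nv w) [::] [::] (add0n _) (leq0n _) s1 t1 e1).
exists B; eexists; exists s1; split.
- by rewrite /B; lia.
- exact: Hb.
- apply: XSeq; first by apply: XPush; rewrite /B /input /=; lia.
  apply: XSeq; first by apply: XPush; rewrite /B /input /upd /=; lia.
  have -> : upd (upd (input w) (tv 0) (true :: input w (tv 0))) (tv 1) (true :: upd (input w) (tv 0) (true :: input w (tv 0)) (tv 1)) = s0.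
    by rewrite /s0 /sst /input; steq.
  exact: ex.
by split=> [/yes|/no].
Qed.

End Search.

(** * Definable functions *)

(* [cd] variables are in scope; [cw], [ca] and [cv] give the two strings and the values of the variables. *)
Record dctx := Ctx { cx : Type; cw : cx -> seq bool; ca : cx -> seq bool; cv : cx -> nat -> nat; cd : nat }.

Definition ext (C : dctx) : dctx :=
  @Ctx (cx C * nat) (fun p => cw p.1) (fun p => ca p.1) (fun p => eupd (cv p.1) (cd C) p.2) (cd C).+1.

Fixpoint closed (P : pred nat) (e : expr) : bool :=
  match e with
  | EVar i => P i
  | EConst _ | ESize _ => true
  | ENth _ e => closed P e
  | EAdd e1 e2 | EMul e1 e2 | ESub e1 e2 => closed P e1 && closed P e2
  | ESum d e1 e2 => closed P e1 && closed [predU1 d & P] e2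
  end.

Lemma closed_sub (P P' : pred nat) e : subpred P P' -> closed P e -> closed P' e.
Proof.
elim: e P P' => /= [c|i|b|b e IH|e1 IH1 e2 IH2|e1 IH1 e2 IH2|e1 IH1 e2 IH2|d e1 IH1 e2 IH2] P P' sP //.
- exact: sP.
- exact: IH.
- by case/andP=> /IH1-> // /IH2->.
- by case/andP=> /IH1-> // /IH2->.
- by case/andP=> /IH1-> // /IH2->.
- case/andP=> /IH1-> //=; apply: IH2 => i /orP[i1|/sP i2]; apply/orP; by [left|right].
Qed.

Lemma eval_closed P e w a env env' : closed P e -> (forall i, P i -> env i = env' i) -> eval w a e env = eval w a e env'.
Proof.
elim: e P env env' => /= [c|i|b|b e IH|e1 IH1 e2 IH2|e1 IH1 e2 IH2|e1 IH1 e2 IH2|d e1 IH1 e2 IH2] P env env' //.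
- by move=> Pi h; apply: h.
- by move=> c h; rewrite (IH _ _ _ c h).
- by case/andP=> c1 c2 h; rewrite (IH1 _ _ _ c1 h) (IH2 _ _ _ c2 h).
- by case/andP=> c1 c2 h; rewrite (IH1 _ _ _ c1 h) (IH2 _ _ _ c2 h).
- by case/andP=> c1 c2 h; rewrite (IH1 _ _ _ c1 h) (IH2 _ _ _ c2 h).
- case/andP=> c1 c2 h; rewrite (IH1 _ _ _ c1 h); apply: eq_bigr => i _; apply: (IH2 _ _ _ c2) => j.
  by rewrite /eupd => /orP[/eqP->|Pj]; [rewrite eqxx|case: eqP => // _; apply: h].
Qed.

(** Definability is a property of Rocq functions, so proofs follow the shape of [f] and never
    mention expressions. Closedness is what makes weakening to [ext C] sound. *)
Definition Def (C : dctx) (f : cx C -> nat) : Prop :=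
  exists2 e, closed (fun i => i < cd C) e & forall x, eval (cw x) (ca x) e (cv x) = f x.
Definition DefB (C : dctx) (b : cx C -> bool) : Prop := Def (fun x => b x : nat).

Section Closure.
Variable C : dctx.
Implicit Types f g : cx C -> nat.

Lemma Def_ext f g : f =1 g -> Def f -> Def g.
Proof. by move=> fg [e ce ee]; exists e => // x; rewrite ee. Qed.

Lemma DefB_ext (f g : cx C -> bool) : f =1 g -> DefB f -> DefB g.
Proof. by move=> fg; apply: Def_ext => x; rewrite fg. Qed.

Lemma Def_const c : Def (fun _ : cx C => c).
Proof. by exists (EConst c). Qed.

Lemma Def_wsize : Def (fun x : cx C => size (cw x)).
Proof. by exists (ESize false). Qed.

Lemma Def_asize : Def (fun x : cx C => size (ca x)).
Proof. by exists (ESize true). Qed.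

Lemma DefB_wnth f : Def f -> DefB (fun x : cx C => nth false (cw x) (f x)).
Proof. by case=> e ce ee; exists (ENth false e) => // x /=; rewrite ee. Qed.

Lemma DefB_anth f : Def f -> DefB (fun x : cx C => nth false (ca x) (f x)).
Proof. by case=> e ce ee; exists (ENth true e) => // x /=; rewrite ee. Qed.

Lemma Def_add f g : Def f -> Def g -> Def (fun x => f x + g x).
Proof. by case=> e ce ee [e' ce' ee']; exists (EAdd e e') => [|x] /=; rewrite ?ce ?ce' ?ee ?ee'. Qed.

Lemma Def_mul f g : Def f -> Def g -> Def (fun x => f x * g x).
Proof. by case=> e ce ee [e' ce' ee']; exists (EMul e e') => [|x] /=; rewrite ?ce ?ce' ?ee ?ee'. Qed.

Lemma Def_sub f g : Def f -> Def g -> Def (fun x => f x - g x).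
Proof. by case=> e ce ee [e' ce' ee']; exists (ESub e e') => [|x] /=; rewrite ?ce ?ce' ?ee ?ee'. Qed.

Lemma Def_weak f : Def f -> Def (C := ext C) (fun p => f p.1).
Proof.
case=> e ce ee; exists e; first by apply: closed_sub ce => i /=; exact: leqW.
move=> [x i] /=; rewrite -ee; apply: (eval_closed _ _ ce) => j jd; rewrite /eupd; case: eqP => // E.
by rewrite E ltnn in jd.
Qed.

Lemma Def_bound : Def (C := ext C) (fun p => p.2).
Proof. by exists (EVar (cd C)) => //= x; rewrite /eupd eqxx. Qed.

Lemma Def_sum f (G : cx C -> nat -> nat) : Def f -> Def (C := ext C) (fun p => G p.1 p.2) -> Def (fun x => \sum_(i < f x) G x i).
Proof.
case=> e ce ee [e' ce' ee']; exists (ESum (cd C) e e').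
  by rewrite /= ce; apply: closed_sub ce' => i /=; rewrite ltnS leq_eqVlt.
by move=> x /=; rewrite ee; apply: eq_bigr => i _; rewrite -(ee' (x, nat_of_ord i)).
Qed.

Lemma DefB_neg (b : cx C -> bool) : DefB b -> DefB (fun x => ~~ b x).
Proof. by move=> h; apply: (Def_ext (f := fun x => 1 - b x)); [move=> x; case: (b x)|apply: Def_sub h; apply: Def_const]. Qed.

Lemma DefB_and (b c : cx C -> bool) : DefB b -> DefB c -> DefB (fun x => b x && c x).
Proof. by move=> h h'; apply: (Def_ext (f := fun x => b x * c x)); [move=> x; case: (b x) (c x) => -[]|apply: Def_mul]. Qed.

Lemma DefB_or (b c : cx C -> bool) : DefB b -> DefB c -> DefB (fun x => b x || c x).
Proof.
move=> h h'; apply: (DefB_ext (f := fun x => ~~ (~~ b x && ~~ c x))); first by move=> x; case: (b x) (c x) => -[].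
by apply: DefB_neg; apply: DefB_and; apply: DefB_neg.
Qed.

Lemma DefB_imp (b c : cx C -> bool) : DefB b -> DefB c -> DefB (fun x => b x ==> c x).
Proof.
move=> h h'; apply: (DefB_ext (f := fun x => ~~ b x || c x)); first by move=> x; case: (b x) (c x).
by apply: DefB_or => //; apply: DefB_neg.
Qed.

Lemma DefB_const b : DefB (fun _ : cx C => b).
Proof. exact: Def_const. Qed.

Lemma DefB_leq f g : Def f -> Def g -> DefB (fun x => f x <= g x).
Proof.
move=> h h'; apply: (Def_ext (f := fun x => 1 - (f x - g x))).
  by move=> x; rewrite /leq; case: (f x - g x).
by apply: Def_sub (Def_const 1) _; apply: Def_sub.
Qed.

Lemma Def_S f : Def f -> Def (fun x => (f x).+1).
Proof. by move=> h; apply: (Def_ext (f := fun x => f x + 1)); [move=> x; rewrite addn1|apply: Def_add h (Def_const 1)]. Qed.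

Lemma Def_P f : Def f -> Def (fun x => (f x).-1).
Proof. by move=> h; apply: (Def_ext (f := fun x => f x - 1)); [move=> x; rewrite subn1|apply: Def_sub h (Def_const 1)]. Qed.

Lemma DefB_eq f g : Def f -> Def g -> DefB (fun x => f x == g x).
Proof.
move=> h h'; apply: (DefB_ext (f := fun x => (f x <= g x) && (g x <= f x))).
  by move=> x; rewrite eqn_leq.
by apply: DefB_and; apply: DefB_leq.
Qed.

Lemma DefB_eqb (b c : cx C -> bool) : DefB b -> DefB c -> DefB (fun x => b x == c x).
Proof.
move=> h h'; apply: (DefB_ext (f := fun x => (b x : nat) == (c x : nat))); last exact: DefB_eq.
by move=> x; case: (b x) (c x) => -[].
Qed.

Lemma Def_if (b : cx C -> bool) f g : DefB b -> Def f -> Def g -> Def (fun x => if b x then f x else g x).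
Proof.
move=> hb hf hg; apply: (Def_ext (f := fun x => b x * f x + (~~ b x) * g x)).
  by move=> x; case: (b x); rewrite /= ?mul1n ?mul0n ?addn0.
apply: Def_add; apply: Def_mul => //; exact: DefB_neg.
Qed.

Lemma DefB_if (b c d : cx C -> bool) : DefB b -> DefB c -> DefB d -> DefB (fun x => if b x then c x else d x).
Proof.
move=> hb hf hg; apply: (Def_ext (f := fun x => if b x then c x : nat else d x)); first by move=> x; case: (b x).
exact: Def_if.
Qed.

Lemma DefB_pos f : Def f -> DefB (fun x => 0 < f x).
Proof. by move=> h; apply: DefB_leq => //; apply: Def_const. Qed.

Lemma DefB_has f (G : cx C -> nat -> bool) : Def f -> DefB (C := ext C) (fun p => G p.1 p.2) ->
  DefB (fun x => has (G x) (iota 0 (f x))).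
Proof.
move=> hf hG; apply: (DefB_ext (f := fun x => 0 < \sum_(i < f x) G x i)); last first.
  exact: DefB_pos (Def_sum (G := fun x i => G x i : nat) hf hG).
move=> x; apply/idP/idP.
  rewrite lt0n; apply: contraR => nh; rewrite sum_nat_eq0; apply/forallP => i /=.
  rewrite eqb0; apply: contra nh => Gi; apply/hasP; exists (nat_of_ord i) => //.
  by rewrite mem_iota add0n ltn_ord.
case/hasP => i; rewrite mem_iota add0n /= => lt Gi.
by rewrite (bigD1 (Ordinal lt)) //= Gi.
Qed.

End Closure.

Lemma DefB_all C f (G : cx C -> nat -> bool) : Def f -> DefB (C := ext C) (fun p => G p.1 p.2) ->
  DefB (fun x => all (G x) (iota 0 (f x))).
Proof.
move=> hf hG; apply: (DefB_ext (f := fun x => ~~ has (fun i => ~~ G x i) (iota 0 (f x)))).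
  by move=> x; rewrite -all_predC; apply: eq_all => i /=; rewrite negbK.
have hN : DefB (C := ext C) (fun p => ~~ G p.1 p.2) by exact: DefB_neg.
by apply: DefB_neg; exact: (DefB_has (G := fun x i => ~~ G x i) hf hN).
Qed.


Lemma divn_count m d : m %/ d = if 0 < d then \sum_(i < m) (i.+1 * d <= m) else 0.
Proof.
case: posnP => [->|d0]; first by rewrite divn0.
rewrite (eq_bigr (fun i : 'I_m => (i < m %/ d) : nat)); last by move=> i _; rewrite leq_divRL.
have le : m %/ d <= m by apply: leq_div.
rewrite -{1}(card_ord (m %/ d)) -sum1_card big_mkcond /=.
rewrite (big_ord_widen m (fun=> 1) le) /= big_mkcond; apply: eq_bigr => i _.
by case: ifP.
Qed.

Section Closure2.
Variable C : dctx.
Implicit Types f g : cx C -> nat.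

Lemma Def_div f g : Def f -> Def g -> Def (fun x => f x %/ g x).
Proof.
move=> hf hg; apply: (Def_ext (f := fun x => if 0 < g x then \sum_(i < f x) (i.+1 * g x <= f x) else 0)).
  by move=> x; rewrite -divn_count.
apply: Def_if; [exact: DefB_pos| |exact: Def_const].
apply: (Def_sum (G := fun x i => (i.+1 * g x <= f x : nat))) => //.
apply: (DefB_leq (C := ext C) (f := fun p => p.2.+1 * g p.1) (g := fun p => f p.1)); last exact: Def_weak.
by apply: Def_mul; [apply: Def_S; apply: Def_bound|apply: Def_weak].
Qed.

Lemma Def_mod f g : Def f -> Def g -> Def (fun x => f x %% g x).
Proof.
move=> hf hg; apply: (Def_ext (f := fun x => f x - f x %/ g x * g x)).
  by move=> x; rewrite {1}(divn_eq (f x) (g x)) addKn.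
by apply: Def_sub => //; apply: Def_mul => //; apply: Def_div.
Qed.

Lemma DefB_odd f : Def f -> DefB (fun x => odd (f x)).
Proof.
move=> h; apply: (Def_ext (f := fun x => f x %% 2)); first by move=> x; rewrite modn2.
exact: Def_mod h (Def_const _ _).
Qed.

Lemma Def_half f : Def f -> Def (fun x => (f x)./2).
Proof.
move=> h; apply: (Def_ext (f := fun x => f x %/ 2)); first by move=> x; rewrite divn2.
exact: Def_div h (Def_const _ _).
Qed.

Lemma Def_double f : Def f -> Def (fun x => (f x).*2).
Proof.
move=> h; apply: (Def_ext (f := fun x => f x + f x)); first by move=> x; rewrite addnn.
exact: Def_add.
Qed.

Lemma Def_exp f k : Def f -> Def (fun x => f x ^ k).
Proof.
move=> h; elim: k => [|k IH]; first exact: Def_const.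
by apply: (Def_ext (f := fun x => f x * f x ^ k)); [move=> x; rewrite expnS|apply: Def_mul].
Qed.


(** [F] is arbitrary: this brings the finite data of a Turing machine into the language. *)
Lemma Def_table (f : cx C -> nat) (F : nat -> nat) N : Def f -> Def (fun x => if f x < N then F (f x) else 0).
Proof.
move=> h; elim: N => [|N IH]; first exact: Def_const.
apply: (Def_ext (f := fun x => if f x == N then F N else if f x < N then F (f x) else 0)).
  by move=> x; rewrite ltnS (leq_eqVlt (f x) N); case: eqP => [->|].
by apply: Def_if => //; [apply: DefB_eq => //; apply: Def_const|apply: Def_const].
Qed.

End Closure2.

Definition wdef0 (F : seq bool -> nat) := forall C, Def (fun x : cx C => F (cw x)).
Definition wdef1 (F : seq bool -> nat -> nat) := forall C u, Def u -> Def (fun x : cx C => F (cw x) (u x)).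
Definition wdef2 (F : seq bool -> nat -> nat -> nat) :=
  forall C u v, Def u -> Def v -> Def (fun x : cx C => F (cw x) (u x) (v x)).
Definition wdefB1 (F : seq bool -> nat -> bool) := wdef1 (fun w u => F w u : nat).
Definition wdefB2 (F : seq bool -> nat -> nat -> bool) := wdef2 (fun w u v => F w u v : nat).

(** Redefined where needed to supply definability results for local functions to [ds]. *)
Ltac dhook := fail.
Ltac ds1 := lazymatch goal with
  | |- DefB (fun x => ~~ @?b x) => apply: DefB_neg
  | |- DefB (fun x => @?b x && @?c x) => apply: DefB_and
  | |- DefB (fun x => @?b x || @?c x) => apply: DefB_or
  | |- DefB (fun x => @?b x ==> @?c x) => apply: DefB_imp
  | |- DefB (fun x => leq (@?b x) (@?c x)) => apply: DefB_leq
  | |- DefB (fun x => odd (@?b x)) => apply: DefB_odd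
  | |- DefB (fun x => @eq_op _ (@?b x) (@?c x)) => apply: DefB_eq
  | |- DefB (fun x => has (fun i => @?G x i) (iota 0 (@?f x))) => apply: DefB_has
  | |- DefB (fun x => all (fun i => @?G x i) (iota 0 (@?f x))) => apply: DefB_all
  | |- DefB (fun x => nth false (cw (@?y x)) (@?c x)) => apply: DefB_wnth
  | |- DefB (fun x => nth false (ca (@?y x)) (@?c x)) => apply: DefB_anth
  | |- Def (fun x => nat_of_bool (@?b x)) => change (DefB b); cbv beta
  | |- Def (fun x => S (@?f x)) => first [apply: Def_const | apply: Def_S]
  | |- Def (fun x => predn (@?f x)) => apply: Def_P
  | |- Def (fun x => addn (@?f x) (@?g x)) => apply: Def_add
  | |- Def (fun x => muln (@?f x) (@?g x)) => apply: Def_mul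
  | |- Def (fun x => subn (@?f x) (@?g x)) => apply: Def_sub
  | |- Def (fun x => divn (@?f x) (@?g x)) => apply: Def_div
  | |- Def (fun x => modn (@?f x) (@?g x)) => apply: Def_mod
  | |- Def (fun x => expn (@?f x) ?k) => apply: Def_exp
  | |- Def (fun x => half (@?f x)) => apply: Def_half
  | |- Def (fun x => double (@?f x)) => apply: Def_double
  | |- Def (fun x => size (cw (@?y x))) => apply: Def_wsize
  | |- Def (fun x => size (ca (@?y x))) => apply: Def_asize
  | |- Def (fun x => bigop _ _ _) => apply: Def_sum
  | |- Def (fun x => ?c) => apply: Def_const
  | |- DefB (fun x => ?c) => apply: DefB_const
  end.
Ltac dw := lazymatch goal with
  | |- @Def (ext _) _ => first [apply: Def_bound | apply: Def_weak]
  | |- @DefB (ext _) _ => apply: Def_weak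
  end.
Ltac ds := repeat first [assumption | dhook | ds1 | dw | apply: DefB_if | apply: Def_if].

(** * Definability of nodes, item lists and edges *)

Section Nodes.
Variable C : dctx.

Definition mk t a b r : mnode :=
  match t with 0 => SS a r | 1 => TT a r | 2 => EE a b r | 3 => ZZ a r | 4 => NN a b r | _ => Top end.

(** Nodes are not numbers, so they enter through a type tag and three coordinates. *)
Definition DefN (v : cx C -> mnode) := exists t a b r,
  [/\ Def t, Def a, Def b & Def r] /\ forall x, v x = mk (t x) (a x) (b x) (r x).

Lemma DefN_ext v v' : v =1 v' -> DefN v -> DefN v'.
Proof. by move=> vv [t [a [b [r [D E]]]]]; exists t, a, b, r; split=> // x; rewrite -vv. Qed.

Lemma DefN_mk t a b r : Def t -> Def a -> Def b -> Def r -> DefN (fun x => mk (t x) (a x) (b x) (r x)).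
Proof. by move=> *; exists t, a, b, r. Qed.

Lemma DefN_SS a r : Def a -> Def r -> DefN (fun x => SS (a x) (r x)).
Proof. by move=> ha hr; apply: (DefN_mk (Def_const C 0) ha ha hr). Qed.
Lemma DefN_TT a r : Def a -> Def r -> DefN (fun x => TT (a x) (r x)).
Proof. by move=> ha hr; apply: (DefN_mk (Def_const C 1) ha ha hr). Qed.
Lemma DefN_ZZ a r : Def a -> Def r -> DefN (fun x => ZZ (a x) (r x)).
Proof. by move=> ha hr; apply: (DefN_mk (Def_const C 3) ha ha hr). Qed.
Lemma DefN_EE a b r : Def a -> Def b -> Def r -> DefN (fun x => EE (a x) (b x) (r x)).
Proof. by move=> ha hb hr; apply: (DefN_mk (Def_const C 2) ha hb hr). Qed.
Lemma DefN_NN a b r : Def a -> Def b -> Def r -> DefN (fun x => NN (a x) (b x) (r x)).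
Proof. by move=> ha hb hr; apply: (DefN_mk (Def_const C 4) ha hb hr). Qed.
Lemma DefN_Top : DefN (fun x => Top).
Proof. by have h := Def_const C 5; apply: (DefN_mk h h h h). Qed.

Lemma DefN_if (c : cx C -> bool) v v' : DefB c -> DefN v -> DefN v' -> DefN (fun x => if c x then v x else v' x).
Proof.
move=> hc [t [a [b [r [[? ? ? ?] E]]]]] [t' [a' [b' [r' [[? ? ? ?] E']]]]].
exists (fun x => if c x then t x else t' x), (fun x => if c x then a x else a' x),
  (fun x => if c x then b x else b' x), (fun x => if c x then r x else r' x).
by split; [split; apply: Def_if|move=> x; rewrite E E'; case: (c x)].
Qed.

Lemma mnode_case (T : Type) (P : (cx C -> T) -> Prop) (h : cx C -> mnode -> T) v :
  (forall f g, f =1 g -> P f -> P g) ->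
  (forall c f g, DefB c -> P f -> P g -> P (fun x => if c x then f x else g x)) ->
  (forall a r, Def a -> Def r -> P (fun x => h x (SS (a x) (r x)))) ->
  (forall a r, Def a -> Def r -> P (fun x => h x (TT (a x) (r x)))) ->
  (forall a b r, Def a -> Def b -> Def r -> P (fun x => h x (EE (a x) (b x) (r x)))) ->
  (forall a r, Def a -> Def r -> P (fun x => h x (ZZ (a x) (r x)))) ->
  (forall a b r, Def a -> Def b -> Def r -> P (fun x => h x (NN (a x) (b x) (r x)))) ->
  P (fun x => h x Top) -> DefN v -> P (fun x => h x (v x)).
Proof.
move=> Pext Pif h0 h1 h2 h3 h4 h5 [t [a [b [r [[dt da db dr] E]]]]].
apply: (Pext (fun x => if t x == 0 then h x (SS (a x) (r x)) else if t x == 1 then h x (TT (a x) (r x)) else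
  if t x == 2 then h x (EE (a x) (b x) (r x)) else if t x == 3 then h x (ZZ (a x) (r x)) else
  if t x == 4 then h x (NN (a x) (b x) (r x)) else h x Top)).
  by move=> x; rewrite E; case: (t x) => [|[|[|[|[|k]]]]].
by do 5 (apply: (Pif); [by ds|by auto|]).
Qed.

Lemma Def_case (h : cx C -> mnode -> nat) v :
  (forall a r, Def a -> Def r -> Def (fun x => h x (SS (a x) (r x)))) ->
  (forall a r, Def a -> Def r -> Def (fun x => h x (TT (a x) (r x)))) ->
  (forall a b r, Def a -> Def b -> Def r -> Def (fun x => h x (EE (a x) (b x) (r x)))) ->
  (forall a r, Def a -> Def r -> Def (fun x => h x (ZZ (a x) (r x)))) ->
  (forall a b r, Def a -> Def b -> Def r -> Def (fun x => h x (NN (a x) (b x) (r x)))) ->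
  Def (fun x => h x Top) -> DefN v -> Def (fun x => h x (v x)).
Proof.
by apply: (mnode_case (P := fun f => Def f)); [exact: Def_ext|move=> c f g; exact: Def_if].
Qed.

Definition DefL (l : cx C -> seq mnode) :=
  Def (fun x => size (l x)) /\ forall i, Def i -> DefN (fun x => nth Top (l x) (i x)).

Lemma DefL_ext l l' : l =1 l' -> DefL l -> DefL l'.
Proof.
move=> ll [ds dn]; split; first by apply: Def_ext ds => x; rewrite ll.
by move=> i di; apply: DefN_ext (dn i di) => x; rewrite ll.
Qed.

Lemma DefL_if (c : cx C -> bool) l l' : DefB c -> DefL l -> DefL l' -> DefL (fun x => if c x then l x else l' x).
Proof.
move=> hc [s n] [s' n']; split.
  by apply: Def_ext (Def_if hc s s') => x; case: (c x).
by move=> i di; apply: DefN_ext (DefN_if hc (n i di) (n' i di)) => x; case: (c x).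
Qed.

Lemma DefL_nil : DefL (fun=> [::]).
Proof.
split; first exact: Def_const.
by move=> i di; apply: DefN_ext DefN_Top => x; rewrite nth_nil.
Qed.

Lemma DefL_cat l l' : DefL l -> DefL l' -> DefL (fun x => l x ++ l' x).
Proof.
move=> [s n] [s' n']; split.
  by apply: Def_ext (Def_add s s') => x; rewrite size_cat.
move=> i di; have dc : DefB (fun x => i x < size (l x)) by ds.
by apply: DefN_ext (DefN_if dc (n i di) (n' _ (Def_sub di s))) => x; rewrite nth_cat.
Qed.

Lemma DefL_mkseq (f : cx C -> nat -> mnode) k : Def k -> (forall i, Def i -> DefN (fun x => f x (i x))) ->
  DefL (fun x => mkseq (f x) (k x)).
Proof.
move=> dk df; split; first by apply: Def_ext dk => x; rewrite size_mkseq.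
move=> i di; have dc : DefB (fun x => i x < k x) by ds.
apply: DefN_ext (DefN_if dc (df i di) DefN_Top) => x.
by case: ltnP => h; [rewrite nth_mkseq|rewrite nth_default ?size_mkseq].
Qed.

End Nodes.

Section EdgeDef.
Variables (p : seq bool -> params) (B : seq bool -> nat).
Hypotheses (dB : wdef0 B) (dn : wdef0 (fun w => pn (p w))) (dm : wdef0 (fun w => pm (p w)))
  (dl : wdefB2 (fun w => plit (p w))) (du : wdefB1 (fun w => puniv (p w)))
  (dlam : wdef0 (fun w => plam (p w))) (dtau : wdef0 (fun w => ptau (p w))) (dom : wdef0 (fun w => pom (p w)))
  (dtaus : wdef0 (fun w => ptaus (p w))) (ddz : wdef0 (fun w => pdz (p w))) (dd : wdef0 (fun w => pd (p w)))
  (drho : wdef0 (fun w => prho (p w))).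

Ltac dhook ::= first [apply: dB|apply: dn|apply: dm|apply: dl|apply: du|apply: dlam|apply: dtau|apply: dom
  |apply: dtaus|apply: ddz|apply: dd|apply: drho].

Let dNE : wdef0 (fun w => NE (p w)).
Proof. by move=> C; rewrite /NE; ds. Qed.

Let dsb : wdef1 (fun w => sbud (p w)).
Proof. by move=> C u hu; rewrite /sbud; ds; apply: dNE. Qed.

Variable C : dctx.

Lemma DefL_itm v : DefN v -> DefL (fun x : cx C => itm (p (cw x)) (v x)).
Proof.
have e : forall i, Def i -> DefN (fun x : cx C => enode (p (cw x)) (i x)).
  by move=> i di; rewrite /enode; apply: DefN_EE; ds.
have z : forall i, Def i -> DefN (fun x : cx C => znode (p (cw x)) (i x)).
  by move=> i di; rewrite /znode; apply: DefN_ZZ; ds.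
apply: (mnode_case (P := @DefL C) (h := fun x => itm (p (cw x)))).
- exact: DefL_ext.
- exact: DefL_if.
- by move=> a r ha hr; apply: DefL_nil.
- by move=> a r ha hr; apply: DefL_nil.
- move=> a b r ha hb hr; apply: DefL_cat; apply: DefL_mkseq => [|i di]; try by ds.
    by apply: DefN_TT.
  by apply: DefN_SS => //; rewrite /star; ds; apply: dl.
- move=> a r ha hr; apply: DefL_cat; apply: DefL_mkseq => [|i di]; [apply: dNE|exact: e|by ds|exact: DefN_SS].
- move=> a b r ha hb hr; apply: DefL_cat.
    apply: DefL_if; first by ds.
      by apply: DefL_cat; apply: DefL_mkseq => [|i di]; try (by ds); apply: DefN_NN => //; ds.
    by apply: DefL_mkseq => [|i di]; [ds|exact: z].
  apply: DefL_if; [exact: du| |exact: DefL_nil].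
  by apply: DefL_mkseq => [|i di]; [ds|apply: DefN_TT; ds].
- exact: DefL_nil.
Qed.

Lemma Def_mhgt v : DefN v -> Def (fun x : cx C => mhgt (p (cw x)) (v x)).
Proof.
apply: (Def_case (h := fun x => mhgt (p (cw x)))) => /=.
- by move=> a r ha hr; rewrite /DS; ds.
- by move=> a r ha hr; rewrite /DT; ds; first [apply: dsb; ds|apply: dNE].
- by move=> *; ds.
- by move=> a r ha hr; ds.
- by move=> *; ds.
- by ds.
Qed.

Lemma Def_mc v : DefN v -> Def (fun x : cx C => mc (p (cw x)) (B (cw x)) (v x)).
Proof.
by apply: (Def_case (h := fun x => mc (p (cw x)) (B (cw x)))) => /= *; rewrite /pack; ds.
Qed.

Lemma DefB_mvalid v : DefN v -> DefB (fun x : cx C => mvalid (p (cw x)) (v x)).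
Proof. by apply: (Def_case (h := fun x v => mvalid (p (cw x)) v : nat)) => /= *; ds. Qed.

Lemma DefN_dec u : Def u -> DefN (fun x : cx C => dec (p (cw x)) (B (cw x)) (u x)).
Proof.
move=> hu; pose t x := u x %/ B (cw x) %/ B (cw x) %/ B (cw x).
pose a x := u x %/ B (cw x) %/ B (cw x) %% B (cw x).
exists (fun x => if t x < 4 then t x else 4), (fun x => if t x < 4 then a x else pn (p (cw x)) - a x),
  (fun x => u x %/ B (cw x) %% B (cw x)), (fun x => u x %% B (cw x)); split.
  by split; rewrite /t /a; ds.
by move=> x; rewrite /dec -/(t x) -/(a x); case: (t x) => [|[|[|[|k]]]].
Qed.

Ltac dhook ::= first [exact: Def_mc|exact: DefB_mvalid|exact: Def_mhgt|apply: dB|apply: dn|apply: dm|apply: dl|apply: du|apply: dlam|apply: dtau|apply: dom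
  |apply: dtaus|apply: ddz|apply: dd|apply: drho].

Let dsz v : DefN v -> Def (fun x : cx C => size (itm (p (cw x)) (v x))).
Proof. by case/DefL_itm. Qed.

Lemma Def_pyc v s c : DefN v -> Def s -> Def c -> Def (fun x : cx C => pyc (p (cw x)) (B (cw x)) (v x) (s x) (c x)).
Proof. by move=> hv hs hc; rewrite /pyc /chc; ds; try (exact: Def_mc); exact: dsz. Qed.

Lemma Def_outc v : DefN v -> Def (fun x : cx C => outc (p (cw x)) (B (cw x)) (v x)).
Proof. by move=> hv; rewrite /outc; apply: Def_pyc => //; ds; exact: Def_mhgt. Qed.

Lemma DefB_vok u : Def u -> DefB (fun x : cx C => vok (p (cw x)) (B (cw x)) (u x)).
Proof.
move=> hu; have hv : DefN (fun x : cx C => dec (p (cw x)) (B (cw x)) (uv (B (cw x)) (u x))).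
  by apply: DefN_dec; rewrite /uv; ds.
have h1 := dsz hv; have h2 := Def_mc hv; have h3 := DefB_mvalid hv; have h4 := Def_mhgt hv.
have h5 : Def (fun x : cx C => uv (B (cw x)) (u x)) by rewrite /uv; ds.
rewrite /vok /ux /uy /uk; cbv zeta.
apply: DefB_and; first by apply: DefB_eq.
by apply: DefB_and => //; ds.
Qed.

Lemma Def_tgt u : Def u -> Def (fun x : cx C => tgt (p (cw x)) (B (cw x)) (u x)).
Proof.
move=> hu; have hv : DefN (fun x : cx C => dec (p (cw x)) (B (cw x)) (uv (B (cw x)) (u x))).
  by apply: DefN_dec; rewrite /uv; ds.
rewrite /tgt /marked /isout; apply: Def_if => //; last exact: Def_const.
apply: DefB_or; first by apply: DefB_neg; exact: DefB_vok.
apply: DefB_and; first by apply: DefB_eq => //; exact: Def_outc.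
apply: (Def_case (h := fun x v => nat_of_bool (if v is SS _ _ then true else if v is NN 0 _ _ then true else false))) hv;
  try by move=> *; exact: Def_const.
move=> i b r hi _ _; apply: (DefB_ext (f := fun x => i x == 0)); first by move=> x; case: (i x).
by ds.
Qed.

Lemma DefB_edge u v : Def u -> Def v -> DefB (fun x : cx C => edge (p (cw x)) (B (cw x)) (u x) (v x)).
Proof.
move=> hu hv; have hd : DefN (fun x : cx C => dec (p (cw x)) (B (cw x)) (uv (B (cw x)) (v x))).
  by apply: DefN_dec; rewrite /uv; ds.
have hi : Def (fun x : cx C => (uy (B (cw x)) (v x)).-1) by rewrite /uy; ds.
have hn : DefN (fun x : cx C => nth Top (itm (p (cw x)) (dec (p (cw x)) (B (cw x)) (uv (B (cw x)) (v x)))) (uy (B (cw x)) (v x)).-1).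
  by have [_] := DefL_itm hd; apply.
have hx : Def (fun x : cx C => ux (B (cw x)) (v x)) by rewrite /ux; ds.
have hy : Def (fun x : cx C => uy (B (cw x)) (v x)) by rewrite /uy; ds.
have hk : Def (fun x : cx C => uk (B (cw x)) (v x)) by rewrite /uk; ds.
have hN : Def (fun x : cx C => nver (B (cw x))) by rewrite /nver; ds.
rewrite /edge; cbv zeta; apply: DefB_if; first by ds.
  apply: DefB_and; first exact: DefB_vok.
  apply: DefB_if; first by ds.
    apply: DefB_and; first by ds.
    by apply: DefB_or; apply: DefB_eq => //; [ds|exact: Def_outc].
  by apply: DefB_or; apply: DefB_eq => //; apply: Def_pyc => //; ds.
apply: DefB_and; first by ds.
by apply: DefB_or; apply: DefB_eq => //; [ds|apply: Def_tgt; ds].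
Qed.

End EdgeDef.

(** * Powers of two, logarithms and binary digits by bounded search *)

Definition pow2 q := (0 < q) && all (fun d => (1 < d) && (q %% d == 0) ==> ~~ odd d) (iota 0 q.+1).

Lemma pow2P q : reflect (exists i, q = 2 ^ i) (pow2 q).
Proof.
apply: (iffP andP) => [[q0 /allP H]|[i ->]].
  have pq : 2.-nat q.
    rewrite /pnat q0; apply/allP => d; rewrite mem_primes => /and3P[pd _ dq].
    have : d \in iota 0 q.+1 by rewrite mem_iota /= add0n ltnS; apply: dvdn_leq.
    move/H; rewrite prime_gt1 // -/(d %| q) dq /= => nd.
    by rewrite inE; case/even_prime: pd nd => [->|->].
  by have [i ->] := p_natP pq; exists i.
split; first by rewrite expn_gt0.
apply/allP => d _; apply/implyP => /andP[d1]; rewrite -/(d %| 2 ^ i) => /(dvdn_pfactor _ _ (isT : prime 2)) [j _ dj].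
by move: d1; rewrite dj; case: j {dj} => // j _; rewrite expnS mul2n odd_double.
Qed.

(** The binary logarithm rounded up, for [0 < q]. Counting powers below [q] stays within polynomial
    values, whereas a variable exponent would not. *)
Definition nlog q := \sum_(d < q) pow2 d.

Lemma nlog_exp i : nlog (2 ^ i) = i.
Proof.
have up : forall N, 0 < N -> nlog N = up_log 2 N.
  elim=> // -[|N] IHN _; first by rewrite /nlog big_ord_recr big_ord0 up_log1.
  have -> : nlog N.+2 = nlog N.+1 + pow2 N.+1 by rewrite /nlog big_ord_recr.
  rewrite IHN //.
  have le := up_logP N.+1 (isT : 1 < 2).
  have [|np] := boolP (pow2 N.+1).
    case/pow2P => j Ej; rewrite Ej up_expnK // addn1; symmetry; apply: up_log_eq => //.
    by rewrite ltnSn /= expnS; have := expn_gt0 2 j; lia.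
  have : N.+1 != 2 ^ up_log 2 N.+1 by apply: contra np => /eqP E; apply/pow2P; eexists; exact: E.
  move=> ne; have lt : N.+2 <= 2 ^ up_log 2 N.+1 by rewrite ltn_neqAle ne le.
  rewrite addn0; apply/eqP; rewrite eqn_leq leq_up_log //= .
  by apply: up_log_min.
by rewrite up ?expn_gt0 // up_expnK.
Qed.

Lemma trunc_log_nlog s : 0 < s -> (nlog s.+1).-1 = trunc_log 2 s.
Proof.
move=> s0; have /andP[h1 h2] := trunc_log_bounds (isT : 1 < 2) s0; set k := trunc_log 2 s in h1 h2 *.
suff -> : nlog s.+1 = k.+1 by [].
apply/eqP; rewrite eqn_leq -{1}(nlog_exp k.+1) -{2}(nlog_exp k).
have mono a b : a <= b -> nlog a <= nlog b.
  move=> ab; rewrite /nlog (big_ord_widen b (fun d => pow2 d : nat) ab) big_mkcond; apply: leq_sum => i _; by case: ifP.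
rewrite mono //=; apply: leq_trans (mono (2 ^ k).+1 s.+1 h1).
rewrite /nlog big_ord_recr /= -/(nlog (2 ^ k)) nlog_exp.
have -> : pow2 (2 ^ k) by apply/pow2P; exists k.
by rewrite addn1.
Qed.

(** A set bit forces [2 ^ i <= s], so the power is found among the numbers up to [s] and recognised
    by its logarithm. *)
Lemma odd_shift s i : odd (s %/ 2 ^ i) = has (fun q => [&& pow2 q, nlog q == i & odd (s %/ q)]) (iota 0 s.+1).
Proof.
apply/idP/hasP => [h|[q _ /and3P[/pow2P[j ->]]]]; last by rewrite nlog_exp => /eqP->.
exists (2 ^ i); last by apply/and3P; split=> //; [apply/pow2P; exists i|rewrite nlog_exp].
by rewrite mem_iota /= add0n ltnS leqNgt; apply/negP => lt; move: h; rewrite divn_small.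
Qed.

Section LogDef.
Variable C : dctx.

Lemma DefB_pow2 (u : cx C -> nat) : Def u -> DefB (fun x => pow2 (u x)).
Proof. by move=> hu; rewrite /pow2; ds. Qed.

End LogDef.

Lemma Def_nlog C (u : cx C -> nat) : Def u -> Def (fun x => nlog (u x)).
Proof.
move=> hu; apply: (Def_sum (G := fun _ d => pow2 d : nat)) => //.
exact: (DefB_pow2 (Def_bound _)).
Qed.

Lemma DefB_odd_shift C (s i : cx C -> nat) : Def s -> Def i -> DefB (fun x => odd (s x %/ 2 ^ i x)).
Proof.
move=> hs hi; apply: (DefB_ext (f := fun x => has (fun q => [&& pow2 q, nlog q == i x & odd (s x %/ q)]) (iota 0 (s x).+1))).
  by move=> x; rewrite -odd_shift.
apply: DefB_has; first by ds.
apply: DefB_and; first exact: (DefB_pow2 (Def_bound _)).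
apply: DefB_and; last by ds.
by apply: DefB_eq; [exact: (Def_nlog (Def_bound _))|ds].
Qed.

Definition DefBL C (l : cx C -> seq bool) := Def (fun x => size (l x)) /\ forall i, Def i -> DefB (fun x => nth false (l x) (i x)).

Section BoolLists.
Variable C : dctx.

Lemma DefBL_ext (l l' : cx C -> seq bool) : l =1 l' -> DefBL l -> DefBL l'.
Proof.
move=> ll [ds dn]; split; first by apply: Def_ext ds => x; rewrite ll.
by move=> i di; apply: DefB_ext (dn i di) => x; rewrite ll.
Qed.

Lemma DefBL_cat (l l' : cx C -> seq bool) : DefBL l -> DefBL l' -> DefBL (fun x => l x ++ l' x).
Proof.
move=> [s n] [s' n']; split.
  by apply: Def_ext (Def_add s s') => x; rewrite size_cat.
move=> i di; have dc : DefB (fun x => i x < size (l x)) by ds.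
by apply: DefB_ext (DefB_if dc (n i di) (n' _ (Def_sub di s))) => x; rewrite nth_cat.
Qed.

Lemma DefBL_mkseq (f : cx C -> nat -> bool) k : Def k -> (forall i, Def i -> DefB (fun x => f x (i x))) ->
  DefBL (fun x => mkseq (f x) (k x)).
Proof.
move=> dk df; split; first by apply: Def_ext dk => x; rewrite size_mkseq.
move=> i di; have dc : DefB (fun x => i x < k x) by ds.
apply: DefB_ext (DefB_if dc (df i di) (DefB_const C false)) => x.
by case: ltnP => h; [rewrite nth_mkseq|rewrite nth_default ?size_mkseq].
Qed.

End BoolLists.

Lemma allpairs_mkseq N (f : nat -> nat -> bool) :
  [seq f (u : 'I_N) (v : 'I_N) | u <- enum 'I_N, v <- enum 'I_N] = mkseq (fun k => f (k %/ N) (k %% N)) (N * N).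
Proof.
have -> : [seq f (u : 'I_N) (v : 'I_N) | u <- enum 'I_N, v <- enum 'I_N] = [seq f u v | u <- iota 0 N, v <- iota 0 N].
  by rewrite -!val_enum_ord allpairs_mapl allpairs_mapr.
have H a : [seq f u v | u <- iota 0 a, v <- iota 0 N] = mkseq (fun k => f (k %/ N) (k %% N)) (a * N).
  elim: a => [|a IHa]; first by [].
  rewrite -[in LHS]addn1 iotaD allpairs_cat IHa mulSn [N + a * N]addnC /mkseq iotaD map_cat; congr (_ ++ _).
  rewrite [iota (0 + a) 1]/= allpairs1l !add0n -[in RHS](addn0 (a * N)) iotaDl -map_comp.
  apply/eq_in_map => k; rewrite mem_iota add0n /= => kN.
  by rewrite pair_div // pair_mod.
exact: H.
Qed.

Definition ctx0 : dctx := @Ctx (seq bool) id (fun=> [::]) (fun=> env0) 0.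

Lemma polytime_def (f : seq bool -> seq bool) : (forall C, DefBL (fun x : cx C => f (cw x))) -> polytime_computable f.
Proof.
move=> H; have [[el _ El] _] := H ctx0; have [_ /(_ _ (Def_bound ctx0)) [eb _ Eb]] := H (ext ctx0).
have [M [p Mp]] := polytime_bits el eb; exists M, p => w.
suff -> : f w = bits_of w el eb by apply: Mp.
rewrite /bits_of; have /= -> := El w.
rewrite -[LHS](mkseq_nth false); apply: eq_mkseq => j.
by have /= -> := Eb (w, j); case: nth.
Qed.

(** * The instance is computed in polynomial time *)

Section Reduction.
Variables (K : nat) (nn mm : seq bool -> nat) (lt : seq bool -> nat -> nat -> bool) (un : seq bool -> nat -> bool).
Hypotheses (K0 : 0 < K) (dn : wdef0 nn) (dm : wdef0 mm) (dl : wdefB2 lt) (du : wdefB1 un).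

Ltac dhook ::= first [apply: dn|apply: dm|apply: dl|apply: du].

Let dX : wdef0 (fun w => rX (nn w) (mm w) K). Proof. by move=> C; rewrite /rX; ds. Qed.
Let dlam : wdef0 (fun w => rlam (nn w) (mm w) K).
Proof. by move=> C; rewrite /rlam; apply: Def_mul; [exact: Def_const|exact: dX]. Qed.
Ltac dhook ::= first [apply: dlam|apply: dn|apply: dm|apply: dl|apply: du].
Let dR : wdef0 (fun w => rR (nn w) (mm w) K). Proof. by move=> C; rewrite /rR; ds. Qed.
Ltac dhook ::= first [apply: dR|apply: dlam|apply: dn|apply: dm|apply: dl|apply: du].
Let dom : wdef0 (fun w => rom (nn w) (mm w) K). Proof. by move=> C; rewrite /rom; ds. Qed.
Ltac dhook ::= first [apply: dom|apply: dR|apply: dlam|apply: dn|apply: dm|apply: dl|apply: du].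
Let dNE : wdef0 (fun w => rNE (nn w) (mm w) K). Proof. by move=> C; rewrite /rNE; ds. Qed.
Ltac dhook ::= first [apply: dNE|apply: dR|apply: dlam|apply: dn|apply: dm|apply: dl|apply: du].
Let dtaus : wdef0 (fun w => rtaus (nn w) (mm w) K). Proof. by move=> C; rewrite /rtaus; ds. Qed.
Ltac dhook ::= first [apply: dtaus|apply: dNE|apply: dR|apply: dlam|apply: dn|apply: dm|apply: dl|apply: du].
Let ddz : wdef0 (fun w => rdz (nn w) (mm w) K). Proof. by move=> C; rewrite /rdz; ds. Qed.
Ltac dhook ::= first [apply: ddz|apply: dtaus|apply: dNE|apply: dR|apply: dlam|apply: dn|apply: dm|apply: dl|apply: du].
Let dS : wdef0 (fun w => rS (nn w) (mm w) K). Proof. by move=> C; rewrite /rS; ds. Qed.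
Ltac dhook ::= first [apply: dS|apply: dn|apply: dm|apply: dl|apply: du].
Let drho : wdef0 (fun w => rrho (nn w) (mm w) K). Proof. by move=> C; rewrite /rrho; ds. Qed.
Ltac dhook ::= first [apply: drho|apply: dn|apply: dm|apply: dl|apply: du].
Let dB : wdef0 (fun w => rB (nn w) (mm w) K). Proof. by move=> C; rewrite /rB; ds. Qed.
Ltac dhook ::= first [apply: dB|apply: dn|apply: dm|apply: dl|apply: du].
Let dN : wdef0 (fun w => rN (nn w) (mm w) K). Proof. by move=> C; rewrite /rN /nver; ds. Qed.

Definition instance_of w := encode (redge (n := nn w) (m := mm w) (K := K) (lt w) (un w)) (Posz (rS (nn w) (mm w) K)).

Lemma polytime_instance_of : polytime_computable instance_of.
Proof.
apply: polytime_def => C.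
pose N w := (rN (nn w) (mm w) K).+1; pose S w := rS (nn w) (mm w) K.
pose E w k := edge (rpar (nn w) (mm w) K (lt w) (un w)) (rB (nn w) (mm w) K) (k %/ N w) (k %% N w).
have dN' : Def (fun x : cx C => N (cw x)) by apply: Def_S; apply: dN.
have dS' : Def (fun x : cx C => S (cw x)) by apply: dS.
apply: (DefBL_ext (l := fun x : cx C => mkseq (fun=> true) (N (cw x)) ++ (mkseq (fun=> false) 1 ++ (mkseq (E (cw x)) (N (cw x) * N (cw x)) ++
   (mkseq (fun=> false) 1 ++ mkseq (fun i => odd (S (cw x) %/ 2 ^ i)) (nlog (S (cw x)).+1).-1.+1))))).
  move=> x; rewrite /instance_of /encode trunc_log_nlog; last by rewrite /S /rS; lia.
  congr (_ ++ _); first by rewrite -[RHS](mkseq_nth true) size_nseq; apply: eq_mkseq => i; rewrite nth_nseq; case: ifP.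
  congr (_ :: _); congr (_ ++ _).
  rewrite /E -(allpairs_mkseq _ (edge (rpar (nn (cw x)) (mm (cw x)) K (lt (cw x)) (un (cw x))) (rB (nn (cw x)) (mm (cw x)) K))).
  by [].
apply: DefBL_cat; first by apply: DefBL_mkseq => [//|i _]; apply: DefB_const.
apply: DefBL_cat; first by apply: DefBL_mkseq => [|i _]; [apply: Def_const|apply: DefB_const].
apply: DefBL_cat.
  apply: DefBL_mkseq => [|i di]; first exact: Def_mul.
  rewrite /E; apply: (DefB_edge (p := fun w => rpar (nn w) (mm w) K (lt w) (un w)) (B := fun w => rB (nn w) (mm w) K)) => //=.
  - exact: Def_div.
  - exact: Def_mod.
apply: DefBL_cat; first by apply: DefBL_mkseq => [|i _]; [apply: Def_const|apply: DefB_const].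
apply: DefBL_mkseq => [|i di]; last exact: DefB_odd_shift.
by apply: Def_S; apply: Def_P; apply: Def_nlog; apply: Def_S.
Qed.

Variable Q : promise_problem.
Hypotheses (n_pos : forall w, 0 < nn w)
  (clauses : forall w i, i < nn w -> exists2 j, j < mm w & forall l, l < nn w * 2 -> lt w j l -> l./2 = i)
  (yesQ : forall w, yes_instance Q w -> qval (un w) (cnf (nn w) (mm w) (lt w)) (nn w) [::])
  (noQ : forall w, no_instance Q w -> ~~ qval (un w) (cnf (nn w) (mm w) (lt w)) (nn w) [::]).

Lemma reducible_to_pebbling (move : forall V : finType, rel V -> rel {set V}) :
  (forall V e, subrel (@reversible_move V e) (move V e)) -> (forall V e, subrel (move V e) (@standard_move V e)) ->
  karp_reducible Q (gap_pebbling_price move K).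
Proof.
move=> mrev mstd; exists instance_of; split; first exact: polytime_instance_of.
- move=> w /yesQ v; exact: (encoded_yes (n_pos w) K0 (clauses (w := w)) mrev v).
- move=> w /noQ v; exact: (encoded_no (n_pos w) K0 (clauses (w := w)) mrev mstd v).
Qed.

End Reduction.

(** * Savitch's recursion as a quantified formula *)

Lemma qval_add univ leaf a b A : qval univ leaf (a + b) A = qval univ (qval univ leaf b) a A.
Proof. by elim: a A => //= a IH A; rewrite !IH. Qed.

Lemma qval_ex univ leaf n A : (forall i, i < n -> ~~ univ (size A + i)) ->
  (qval univ leaf n A <-> exists V, size V = n /\ leaf (A ++ V)).
Proof.
elim: n A => [|n IHn] A ex /=.
  by split=> [lA|[V [/size0nil -> ]]]; [exists [::]; rewrite cats0|rewrite cats0].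
have := ex 0 isT; rewrite addn0 => /negPf ->.
have IHb b : qval univ leaf n (rcons A b) <-> exists V, size V = n /\ leaf (rcons A b ++ V).
  by apply: IHn => i lt; rewrite size_rcons addSnnS; apply: ex.
split=> [/orP[/IHb[V [sV lV]]|/IHb[V [sV lV]]]|[[|b V] [//= [sV] lV]]].
- by exists (false :: V); rewrite /= sV -cat_rcons.
- by exists (true :: V); rewrite /= sV -cat_rcons.
have h : qval univ leaf n (rcons A b) by apply/IHb; exists V; rewrite cat_rcons.
by case: b h {lV} => ->; rewrite ?orbT.
Qed.

Section Savitch.
Variables (N K : nat) (univ : nat -> bool) (leaf : seq bool -> bool).

(** [None] stands for the original start on the left and for the original goal on the right. Their
    meaning is left to [G], so the same recursion serves a fixed goal and an acceptance
    condition. *)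
Fixpoint reach (G : option (seq bool) -> option (seq bool) -> Prop) r X Y : Prop :=
  if r is r'.+1 then exists C, [/\ size C = N, reach G r' X (Some C) & reach G r' (Some C) Y] else G X Y.

Definition chunk R (A : seq bool) := take N (drop (R * N.+1) A).

(* the two end points of the interval selected by the first [R] rounds *)
Fixpoint ends R (A : seq bool) : option (seq bool) * option (seq bool) :=
  if R is R'.+1 then
    if nth false A (R' * N.+1 + N) then (Some (chunk R' A), (ends R' A).2) else ((ends R' A).1, Some (chunk R' A))
  else (None, None).

Lemma ends_cat R A B : size A = R * N.+1 -> ends R (A ++ B) = ends R (A ++ [::]).
Proof.
move=> sA; have H S : S <= R -> ends S (A ++ B) = ends S A.
  elim: S => //= S IH lt; rewrite IH ?(ltnW lt) //.
  have le : S * N.+1 + N.+1 <= size A by rewrite sA addnC -mulSn leq_mul2r lt orbT.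
  rewrite nth_cat /chunk drop_cat.
  have -> : S * N.+1 + N < size A by lia.
  have lt2 : S * N.+1 < size A by lia.
  rewrite lt2 takel_cat // size_drop; lia.
by rewrite cats0 H.
Qed.

Lemma ends_round R A C b : size A = R * N.+1 -> size C = N ->
  ends R.+1 (A ++ rcons C b) = if b then (Some C, (ends R A).2) else ((ends R A).1, Some C).
Proof.
move=> sA sC; rewrite [LHS]/= (ends_cat _ sA) cats0 nth_cat sA ltnNge leq_addr /= addKn nth_rcons sC ltnn eqxx.
have -> // : chunk R (A ++ rcons C b) = C.
by rewrite /chunk drop_size_cat // -cats1 take_size_cat.
Qed.

Hypothesis univE : forall i, i < K * N.+1 -> univ i = (i %% N.+1 == N).
Variable G : option (seq bool) -> option (seq bool) -> Prop.
Hypothesis leafE : forall A, size A = K * N.+1 -> (leaf A <-> G (ends K A).1 (ends K A).2).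

Lemma qval_savitch r R A : R + r = K -> size A = R * N.+1 ->
  (qval univ leaf (r * N.+1) A <-> reach G r (ends R A).1 (ends R A).2).
Proof.
elim: r R A => [|r IHr] R A; first by rewrite addn0 => -> sA; apply: leafE.
rewrite addnS => RK sA; have -> : r.+1 * N.+1 = N + (1 + r * N.+1) by rewrite mulSn; lia.
have RrK : R * N.+1 + N < K * N.+1.
  by apply: (@leq_trans (R.+1 * N.+1)); [rewrite mulSn; lia|rewrite leq_mul2r; lia].
have ex i : i < N -> ~~ univ (size A + i).
  by move=> iN; rewrite sA univE ?modnMDl ?modn_small; lia.
rewrite qval_add; apply: (iff_trans (qval_ex _ ex)).
have H C : size C = N -> (qval univ leaf (1 + r * N.+1) (A ++ C) <-> reach G r (ends R A).1 (Some C) /\ reach G r (Some C) (ends R A).2).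
  move=> sC; rewrite [qval _ _ _ _]/= size_cat sC sA univE // modnMDl modn_small // eqxx.
  have IH b : qval univ leaf (r * N.+1) (A ++ rcons C b) <->
      reach G r (if b then (Some C, (ends R A).2) else ((ends R A).1, Some C)).1 (if b then (Some C, (ends R A).2) else ((ends R A).1, Some C)).2.
    by rewrite -(ends_round b sA sC); apply: IHr => //; rewrite size_cat size_rcons sC sA mulSn; lia.
  rewrite !rcons_cat; split=> [/andP[/(IH false) ? /(IH true) ?]|[h1 h2]] //.
  by apply/andP; split; [apply/(IH false)|apply/(IH true)].
split=> [[C [sC /(H _ sC) [h1 h2]]]|[C [sC h1 h2]]]; exists C => //.
by split=> //; apply/(H _ sC).
Qed.

End Savitch.

(** * Hardness: local encoding of computations *)

Lemma nat_hornerMXaddC (q : {poly nat}) c x : ((q * 'X + c%:P).[x])%R = (q.[x])%R * x + c.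
Proof. by rewrite hornerMXaddC. Qed.

Lemma Def_poly C (q : {poly nat}) (u : cx C -> nat) : Def u -> Def (fun x => q.[u x]%R).
Proof.
move=> du; elim/poly_ind: q => [|q c IH].
  by apply: (Def_ext (f := fun=> 0)); [move=> x; rewrite horner0|apply: Def_const].
apply: (Def_ext (f := fun x => q.[u x]%R * u x + c)); first by move=> x; rewrite nat_hornerMXaddC.
by apply: Def_add; [apply: Def_mul|apply: Def_const].
Qed.

Section Tableau.
Variable M : turing_machine.
Local Notation sym := (option (bool + tm_work M)).
Local Notation k := (tm_tapes M).+1.

Definition cell (T : tape (tm_work M)) R j : sym :=
  if j < R then nth None (tleft T) (R - j.+1) else if j == R then Defs.thead T else nth None (tright T) (j - R.+1).

(** The old place of the cell that is at [j] after the move, with directions coded by [dirc]. The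
    result [W] is a place outside the window, which is blank. *)
Definition source (d : nat) W j := if d == 1 then (if j == 0 then W else j.-1) else if d == 2 then j.+1 else j.

Definition dirc d := match d with Stay => 0 | MoveL => 1 | MoveR => 2 end.

Lemma cell_next T R j a d : 0 < R -> size (tleft T) <= R -> size (tright T) <= R -> j < R.*2.+1 ->
  cell (tape_move d (tape_write a T)) R j =
    let s := source (dirc d) R.*2.+1 j in if s == R then a else if R.*2.+1 <= s then None else cell T R s.
Proof.
case: T => l h r R0 /= hl hr jW; rewrite /cell /source; case: d => /=.
- case: j jW => [|j] jW /=.
    rewrite R0 subn1 ?leqnn; have -> : (R.*2.+1 == R) = false by lia.
    by rewrite nth_behead prednK // nth_default.
  case: (ltngtP j R) => [lt|gt|->].
  + have -> : (R.*2.+1 <= j) = false by lia.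
    have [lt'|ge] := ltnP j.+1 R.
      by rewrite nth_behead; congr nth; lia.
    have -> : j.+1 == R by lia.
    have -> : R - j.+1 = 0 by lia.
    by case: (l).
  + have -> : (R.*2.+1 <= j) = false by lia.
    have -> : (j.+1 < R) = false by lia.
    have -> : (j.+1 == R) = false by lia.
    by have -> : j.+1 - R.+1 = (j - R.+1).+1 by lia.
  + have -> : (R.+1 < R) = false by lia.
    have -> : (R.+1 == R) = false by lia.
    by rewrite subnn.
- case: (ltngtP j R) => [lt|gt|->].
  + have -> : (R.*2.+1 <= j.+1) = false by lia.
    case: (ltngtP j.+1 R) => [lt'|gt'|E].
    * by have -> : R - j.+1 = (R - j.+2).+1 by lia.
    * by lia.
    * by rewrite E subnn.
  + have -> : (j.+1 < R) = false by lia.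
    have -> : (j.+1 == R) = false by lia.
    rewrite nth_behead; have [le|lt] := leqP R.*2.+1 j.+1; first by rewrite nth_default //; apply: leq_trans hr _; lia.
    by congr nth; lia.
  + have -> : (R.+1 == R) = false by lia.
    have -> : (R.+1 < R) = false by lia.
    have -> : (R.*2.+1 <= R.+1) = false by lia.
    by rewrite subnn -nth0.
- have -> : (R.*2.+1 <= j) = false by lia.
  by case: (ltngtP j R).
Qed.

Definition SN := #|{: sym}|.
Definition QN := #|tm_state M|.
Definition sc (a : sym) : nat := enum_rank a.
Definition qc (q : tm_state M) : nat := enum_rank q.

(** With tapes recentred at the heads, the state and the scanned symbols determine how every other
    bit is moved or replaced. *)
Definition control := (tm_state M * {ffun 'I_k -> sym})%type.
Definition KN := #|{: control}|.
Definition kap a : control := nth (tm_start M, [ffun=> None]) (enum {: control}) a.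
Definition kidx (x : control) : nat := enum_rank x.

Lemma kidxK x : kap (kidx x) = x.
Proof. by rewrite /kap /kidx nth_enum_rank. Qed.

Definition act a := tm_trans (kap a).1 (kap a).2.
Definition khalt a := ~~ isSome (act a).
Definition kq a := qc (kap a).1.
Definition kh a t := sc ((kap a).2 (inord t)).
Definition kns a := if act a is Some (q, _) then qc q else 0.
Definition kdir a t := if act a is Some (_, f) then dirc (f (inord t)).2 else 0.
Definition kwr a t := if act a is Some (_, f) then sc (f (inord t)).1 else 0.
Definition kacc q := nth false [seq tm_accept q | q <- enum (tm_state M)] q.

Variable R : nat.
Hypothesis R0 : 0 < R.
Local Notation W := R.*2.+1.

(* Bit [pos t j s]: the cell of tape [t] at offset [j - R] from the head holds the symbol [s]. The bits from
   [tb] on hold the state. Recentring the tapes at the heads makes the transition local. *)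
Definition tb := k * W * SN.
Definition tN := tb + QN.
Definition pos t j s := (t * W + j) * SN + s.

Definition bitv (c : config M) p :=
  if p < tb then p %% SN == sc (cell (ctapes c (inord (p %/ SN %/ W))) R (p %/ SN %% W)) else p - tb == qc (cstate c).
Definition enc c := mkseq (bitv c) tN.

Lemma sc_lt a : sc a < SN. Proof. exact: ltn_ord. Qed.
Lemma qc_lt q : qc q < QN. Proof. exact: ltn_ord. Qed.

Lemma pos_lt t j s : t < k -> j < W -> s < SN -> pos t j s < tb.
Proof. by move=> tk jW sS; apply: pair_bound => //; apply: pair_bound. Qed.

Lemma posE t j s : j < W -> s < SN -> [/\ pos t j s %% SN = s, pos t j s %/ SN %% W = j & pos t j s %/ SN %/ W = t].
Proof. by move=> jW sS; rewrite /pos pair_mod // pair_div // pair_mod // pair_div. Qed.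

Lemma bitv_tape c t j s : t < k -> j < W -> s < SN -> bitv c (pos t j s) = (s == sc (cell (ctapes c (inord t)) R j)).
Proof. by move=> tk jW sS; rewrite /bitv pos_lt //; have [-> -> ->] := posE t jW sS. Qed.

Lemma bitv_state c q : bitv c (tb + q) = (q == qc (cstate c)).
Proof. by rewrite /bitv ltnNge leq_addr addKn. Qed.

Lemma nth_enc c p : p < tN -> nth false (enc c) p = bitv c p.
Proof. by move=> lt; rewrite nth_mkseq. Qed.

Definition matches a (X : seq bool) :=
  nth false X (tb + kq a) && all (fun t => nth false X (pos t R (kh a t))) (iota 0 k).

(** Results 0 and 1 are constant bits; [q.+2] means a copy of the old bit [q]. A halting control
    copies everything. *)
Definition target a p :=
  if khalt a then p.+2 else if tb <= p then (p - tb == kns a : nat) else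
  let t := p %/ SN %/ W in let s := p %% SN in let src := source (kdir a t) W (p %/ SN %% W) in
  if src == R then (s == kwr a t : nat) else if W <= src then (s == sc None : nat) else (pos t src s).+2.

Definition tval a (X : seq bool) p :=
  if target a p < 2 then target a p == 1 else nth false X (target a p - 2).

(** On the encoding of a configuration exactly one control matches, so there the relation is the
    graph of the next-step function. It is a conjunction of local clauses on all strings. *)
Definition trel (X Y : seq bool) :=
  forall a, a < KN -> matches a X -> forall p, p < tN -> nth false Y p = tval a X p.

Definition ctl (c : config M) : control := (cstate c, [ffun i => (Defs.thead (ctapes c i) : sym)]).
Definition nextc (c : config M) := odflt c (step c).
Definition fits (c : config M) := forall i, size (tleft (ctapes c i)) <= R /\ size (tright (ctapes c i)) <= R.

Lemma cell_head T : cell T R R = Defs.thead T.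
Proof. by rewrite /cell ltnn eqxx. Qed.

Lemma matches_enc c a : a < KN -> matches a (enc c) = (a == kidx (ctl c)).
Proof.
move=> aK; have RW : R < W by lia.
have E : kidx (kap a) = a.
  by rewrite /kidx /kap -[a]/(nat_of_ord (Ordinal aK)) -enum_val_nth enum_valK.
have -> : (a == kidx (ctl c)) = (kap a == ctl c).
  by apply/eqP/eqP => [->|<-]; rewrite ?kidxK ?E.
rewrite /matches nth_enc; last by rewrite ltn_add2l qc_lt.
rewrite bitv_state /kq.
have -> : (qc (kap a).1 == qc (cstate c)) = ((kap a).1 == cstate c).
  by rewrite /qc val_eqE (inj_eq enum_rank_inj).
rewrite -[RHS]/(((kap a).1 == (ctl c).1) && ((kap a).2 == (ctl c).2)); congr (_ && _).
have H t : t < k -> nth false (enc c) (pos t R (kh a t)) = ((kap a).2 (inord t) == Defs.thead (ctapes c (inord t))).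
  move=> tk; have lt := pos_lt tk RW (sc_lt ((kap a).2 (inord t))).
  rewrite nth_enc; last by apply: leq_trans lt (leq_addr _ _).
  by rewrite bitv_tape ?sc_lt // cell_head /kh /sc val_eqE (inj_eq enum_rank_inj).
apply/allP/eqP => [h|h t].
  apply/ffunP => i; rewrite ffunE; apply/eqP.
  by have := h i; rewrite mem_iota /= ltn_ord H // inord_val => /(_ isT).
by rewrite mem_iota /= => tk; rewrite H // h ffunE.
Qed.

Lemma bitv_next c p : fits c -> p < tN -> bitv (nextc c) p = tval (kidx (ctl c)) (enc c) p.
Proof.
move=> fc pN; rewrite /tval /target /khalt /kns /kdir /kwr /act kidxK.
have st : step c = match tm_trans (ctl c).1 (ctl c).2 with
    | None => None
    | Some (q, f) => Some (Config q [ffun i => tape_move (f i).2 (tape_write (f i).1 (ctapes c i))]) end by [].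
rewrite /nextc st; case: (tm_trans _ _) => [[q f]|] /=; last by rewrite nth_enc // !subSS subn0.
case: (leqP tb p) => [le|lt].
  by rewrite /bitv ltnNge le /=; case: (_ == qc q).
have SN0 : 0 < SN by move: lt; rewrite /tb; case: (SN) => //; rewrite muln0.
have jW : p %/ SN %% W < W by rewrite ltn_mod.
have sS : p %% SN < SN by rewrite ltn_mod.
have tk : p %/ SN %/ W < k.
  by rewrite ltn_divLR // ltn_divLR // -/tb.
have pE : p = pos (p %/ SN %/ W) (p %/ SN %% W) (p %% SN) by rewrite /pos -divn_eq -divn_eq.
rewrite {1}pE bitv_tape //= ffunE; have [fl fr] := fc (inord (p %/ SN %/ W)).
rewrite cell_next //=; set src := source _ _ _; case: (src =P R) => [_|_]; first by case: (_ == _).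
case: (leqP W src) => [_|srcW]; first by case: (_ == _).
rewrite /= subn2 /= nth_enc ?bitv_tape //.
by apply: leq_trans (pos_lt tk srcW sS) (leq_addr _ _).
Qed.

Lemma trel_enc c Y : fits c -> size Y = tN -> (trel (enc c) Y <-> Y = enc (nextc c)).
Proof.
move=> fc sY; have kK : kidx (ctl c) < KN by exact: ltn_ord.
split=> [H|-> a aK].
  apply: (@eq_from_nth _ false) => [|p]; first by rewrite size_mkseq.
  rewrite sY => pN; rewrite nth_enc // (bitv_next fc pN); apply: H => //.
  by rewrite matches_enc.
by rewrite matches_enc // => /eqP-> p pN; rewrite nth_enc // bitv_next.
Qed.

Definition taccept (X : seq bool) := has (fun q => kacc q && nth false X (tb + q)) (iota 0 QN).

Lemma taccept_enc c : taccept (enc c) = tm_accept (cstate c).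
Proof.
have E : kacc (qc (cstate c)) = tm_accept (cstate c).
  by rewrite /kacc (nth_map (tm_start M)) ?nth_enum_rank // -cardE qc_lt.
have H q : q < QN -> nth false (enc c) (tb + q) = (q == qc (cstate c)).
  by move=> qN; rewrite nth_enc ?bitv_state // ltn_add2l.
apply/hasP/idP => [[q]|ac].
  by rewrite mem_iota /= => qN; rewrite H // => /andP[aq /eqP eq]; rewrite -E -eq.
by exists (qc (cstate c)); rewrite ?mem_iota /= ?qc_lt // H ?qc_lt // eqxx E ac.
Qed.

Definition init_bit w p :=
  if p < tb then
    p %% SN == (if (p %/ SN %/ W == 0) && (R <= p %/ SN %% W) && (p %/ SN %% W - R < size w) then
      (if nth false w (p %/ SN %% W - R) then sc (bit _ true) else sc (bit _ false)) else sc None)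
  else p - tb == qc (tm_start M).

Lemma init_bitE w p : p < tN -> bitv (init M w) p = init_bit w p.
Proof.
move=> pN; rewrite /bitv /init_bit /=; case: ltnP => // lt; rewrite ffunE; congr (_ == _).
have SN0 : 0 < SN by move: lt; rewrite /tb; case: (SN) => //; rewrite muln0.
have tk : p %/ SN %/ W < k.
  by rewrite ltn_divLR // ltn_divLR // -/tb.
have -> : (inord (p %/ SN %/ W) == ord0 :> 'I_k) = (p %/ SN %/ W == 0) by rewrite -val_eqE /= inordK.
move: (p %/ SN %% W) => j; case: eqP => _ /=; last first.
  by rewrite /cell /= !nth_nil; case: ifP => // _; case: ifP.
rewrite /cell /=; case: (ltngtP j R) => [lt'|gt|->] /=.
- by rewrite nth_nil.
- rewrite nth_behead; have -> : (j - R.+1).+1 = j - R by lia.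
  case: ltnP => h; last by rewrite nth_default // size_map.
  by rewrite (nth_map false) //; case: nth.
by rewrite subnn; case: (w) => [|[] w'].
Qed.

End Tableau.

(** * The matrix of the formula *)

Section Sat.
Variables (n : nat) (A : seq bool).

Definition sat (P : nat -> bool) := has (fun l => P l && (nth false A l./2 == odd l)) (iota 0 n.*2).

Lemma sat_or P Q : sat (fun l => P l || Q l) = sat P || sat Q.
Proof.
rewrite /sat -has_predU; apply: eq_has => l /=; by rewrite andb_orl.
Qed.

Lemma sat_eq i (b : bool) : i < n -> sat (fun l => l == i.*2 + b) = (nth false A i == b).
Proof.
move=> iN; have E : (i.*2 + b)./2 = i by rewrite addnC half_bit_double.
have O : odd (i.*2 + b) = b by rewrite oddD odd_double oddb.
apply/hasP/idP => [[l _ /andP[/eqP -> ]]|h]; first by rewrite E O.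
exists (i.*2 + b); last by rewrite eqxx E O.
by rewrite mem_iota add0n /=; case: (b); lia.
Qed.

Lemma sat_has P k : sat (fun l => has (fun t => P t l) (iota 0 k)) = has (fun t => sat (P t)) (iota 0 k).
Proof.
apply/hasP/hasP => [[l ln /andP[/hasP[t tk Pt] h]]|[t tk /hasP[l ln /andP[Pt h]]]].
  by exists t => //; apply/hasP; exists l => //; rewrite Pt.
by exists l => //; rewrite h andbT; apply/hasP; exists t.
Qed.

Lemma sat_and (c : bool) P : sat (fun l => c && P l) = c && sat P.
Proof. by case: c => //; rewrite /sat /= has_pred0. Qed.

Lemma sat_true : 0 < n -> sat (fun=> true).
Proof.
move=> n0; apply/hasP; exists (nat_of_bool (nth false A 0)).
  by rewrite mem_iota add0n /=; case: nth; lia.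
by case E: (nth false A 0); rewrite /= E.
Qed.

Lemma sat_const c : 0 < n -> sat (fun=> c) = c.
Proof. by move=> n0; case: c; [exact: sat_true|rewrite /sat has_pred0]. Qed.

End Sat.

Section Formula.
Variables (M : turing_machine) (pol : {poly nat}).
Local Notation k := (tm_tapes M).+1.

Definition fR (w : seq bool) : nat := (pol.[size w]%R).+1.
Definition fN w := tN M (fR w).
(** [fN] rounds, enough for [2 ^ fN] steps. After them come two existential blocks with copies of
    the ends of the selected step, so that the transition clauses refer to fixed positions and not
    to the round that last set an end. *)
Definition fL w := fN w * (fN w).+1.
Definition fn w := fL w + fN w + fN w.
Definition bv w r := r * (fN w).+1 + fN w.
Definition fun' w i := (i < fL w) && (i %% (fN w).+1 == fN w).
Definition fD w := KN M + fn w + 1.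
Definition fm w := 6 * fD w * fD w * 2.

(** For a matching control [a] the clause excludes that bit [p] is [~~ b] after the step while the
    transition prescribes [b]; the two values of [b] together force equality. A prescribed constant
    [~~ b] makes all literals belong to the clause. *)
Definition lit_tr w a p (b : bool) l :=
  let X := fL w in let Y := fL w + fN w in let t := target M (fR w) a p in
  [|| l == (X + (tb M (fR w) + kq M a)).*2 + false,
      has (fun t => l == (X + pos M (fR w) t (fR w) (kh M a t)).*2 + false) (iota 0 k),
      l == (Y + p).*2 + b
    | if t < 2 then (t == 1) == ~~ b else l == (X + (t - 2)).*2 + ~~ b].

(** If round [a] is the last whose choice bit is [~~ e], then it has set the end [e] (left for
    [false], right for [true]), and the two values of [b] force bit [p] of the copy to equal bit [p]
    of the midpoint of that round. *)
Definition lit_link w (e : bool) a p (b : bool) l :=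
  [|| l == (bv w a).*2 + e, has (fun r => (a < r) && (l == (bv w r).*2 + ~~ e)) (iota 0 (fN w)),
      l == (fL w + e * fN w + p).*2 + b | l == (a * (fN w).+1 + p).*2 + ~~ b].

Definition lit_init w p l :=
  has (fun r => l == (bv w r).*2 + true) (iota 0 (fN w)) || (l == (fL w + p).*2 + init_bit M (fR w) w p).

Definition lit_acc w l :=
  has (fun r => l == (bv w r).*2 + false) (iota 0 (fN w)) ||
  has (fun q => kacc M q && (l == (fL w + fN w + (tb M (fR w) + q)).*2 + true)) (iota 0 (QN M)).

(* 0: tautologies, since every variable must own a clause; 1: local transitions; 2 and 3: the copies of the
   two ends of the interval agree with the last round of the right polarity; 4: initial configuration;
   5: acceptance. An index out of range stands for the clause of all literals. *)
Definition lit_ty w ty a p b l :=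
  if ty == 0 then if a < fn w then l./2 == a else true
  else if ty == 1 then if (a < KN M) && (p < fN w) then lit_tr w a p b l else true
  else if ty == 2 then if (a < fN w) && (p < fN w) then lit_link w false a p b l else true
  else if ty == 3 then if (a < fN w) && (p < fN w) then lit_link w true a p b l else true
  else if ty == 4 then if p < fN w then lit_init w p l else true
  else lit_acc w l.

Definition flit w j l :=
  lit_ty w (j %/ 2 %/ fD w %/ fD w) (j %/ 2 %/ fD w %% fD w) (j %/ 2 %% fD w) (odd j) l.

Lemma fN_pos w : 0 < fN w.
Proof.
have : 0 < QN M by apply/card_gt0P; exists (tm_start M).
by rewrite /fN /tN; lia.
Qed.

Lemma fn_pos w : 0 < fn w.
Proof. by have := fN_pos w; rewrite /fn; lia. Qed.

Lemma cnfE w A : cnf (fn w) (fm w) (flit w) A <->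
  forall ty a p b, ty < 6 -> a < fD w -> p < fD w -> sat (fn w) A (lit_ty w ty a p b).
Proof.
have D0 : 0 < fD w by rewrite /fD addn1.
split=> [/allP H ty a p b ty6 aD pD|H].
  pose j := ((ty * fD w + a) * fD w + p) * 2 + b.
  have b2 : b < 2 by case: (b).
  have jm : j < fm w by do 3 (apply: pair_bound => //).
  have := H j; rewrite mem_iota add0n /= => /(_ jm).
  have E : j %/ 2 = (ty * fD w + a) * fD w + p by rewrite /j pair_div //; case: (b).
  have O : odd j = b by rewrite /j oddD oddM /= andbF oddb.
  by rewrite /flit E O !pair_div // !pair_mod.
apply/allP => j; rewrite mem_iota add0n /= => jm.
apply: H; rewrite ?ltn_mod //.
rewrite !ltn_divLR // ; move: jm; rewrite /fm; lia.
Qed.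

Lemma formula_clauses w i : i < fn w -> exists2 j, j < fm w & forall l, l < fn w * 2 -> flit w j l -> l./2 = i.
Proof.
move=> iN; have iD : i < fD w by rewrite /fD; lia.
exists (((0 * fD w + i) * fD w + 0) * 2 + 0); first by apply: pair_bound => //; apply: pair_bound; [lia|apply: pair_bound].
move=> l ln; rewrite /flit pair_div // pair_div; last by lia.
rewrite pair_div // pair_mod // /lit_ty /= iN => /eqP //.
Qed.

Section Def.
Ltac dhook ::= fail.

Let dR : wdef0 fR.
Proof. by move=> C; rewrite /fR; apply: Def_S; apply: Def_poly; ds. Qed.

Ltac dhook ::= lazymatch goal with | |- Def (fun x => fR _) => apply: dR end.

Let dtb : wdef0 (fun w => tb M (fR w)).
Proof. by move=> C; rewrite /tb; ds. Qed.

Ltac dhook ::= lazymatch goal with | |- Def (fun x => fR _) => apply: dR | |- Def (fun x => tb M _) => apply: dtb end.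

Let dN : wdef0 fN.
Proof. by move=> C; rewrite /fN /tN; ds. Qed.

Ltac dhook ::= lazymatch goal with | |- Def (fun x => fR _) => apply: dR | |- Def (fun x => tb M _) => apply: dtb | |- Def (fun x => fN _) => apply: dN end.

Let dL : wdef0 fL.
Proof. by move=> C; rewrite /fL; ds. Qed.

Ltac dhook ::= lazymatch goal with | |- Def (fun x => fR _) => apply: dR | |- Def (fun x => tb M _) => apply: dtb | |- Def (fun x => fN _) => apply: dN | |- Def (fun x => fL _) => apply: dL end.

Lemma wdef_fn : wdef0 fn.
Proof. by move=> C; rewrite /fn; ds. Qed.

Let dD : wdef0 fD.
Proof. by move=> C; rewrite /fD; ds; apply: wdef_fn. Qed.

Ltac dhook ::= lazymatch goal with | |- Def (fun x => fR _) => apply: dR | |- Def (fun x => tb M _) => apply: dtb | |- Def (fun x => fN _) => apply: dN | |- Def (fun x => fL _) => apply: dL | |- Def (fun x => fD _) => apply: dD | |- Def (fun x => fn _) => apply: wdef_fn end.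

Lemma wdef_fm : wdef0 fm.
Proof. by move=> C; rewrite /fm; ds. Qed.

Lemma wdef_fun : wdefB1 fun'.
Proof. by move=> C u hu; rewrite /fun'; ds. Qed.

Let dbv C (u : cx C -> nat) : Def u -> Def (fun x => bv (cw x) (u x)).
Proof. by move=> hu; rewrite /bv; ds. Qed.

(** The machine data are functions on finite sets read through [nth] and [inord], whose defaults
    make them constant from some point on; a table with one further case covers them. *)
Let dtab (F : nat -> nat) b C (u : cx C -> nat) : (forall i, b <= i -> F i = F b) -> Def u -> Def (fun x => F (u x)).
Proof.
move=> Fb hu; apply: (Def_ext (f := fun x => if u x < b then (if u x < b then F (u x) else 0) else F b)).
  by move=> x; case: ltnP => // /Fb.
by apply: Def_if; [ds|exact: (Def_table F b hu)|apply: Def_const].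
Qed.

Let dtab2 (F : nat -> nat -> nat) b c C (u v : cx C -> nat) : (forall i j, b <= i -> F i j = F b j) ->
  (forall i j, c <= j -> F i j = F i c) -> Def u -> Def v -> Def (fun x => F (u x) (v x)).
Proof.
move=> Fb Fc hu hv.
have T j : Def (fun x => F (u x) j) by apply: (dtab (F := F^~ j) (b := b)) => // i; apply: Fb.
have T2 d : Def (fun x => if v x < d then F (u x) (v x) else 0).
  elim: d => [|d IH]; first exact: Def_const.
  apply: (Def_ext (f := fun x => if v x == d then F (u x) d else if v x < d then F (u x) (v x) else 0)).
    by move=> x; rewrite ltnS (leq_eqVlt (v x) d); case: eqP => [->|].
  by apply: Def_if => //; ds.
apply: (Def_ext (f := fun x => if v x < c then (if v x < c then F (u x) (v x) else 0) else F (u x) c)).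
  by move=> x; case: ltnP => // /Fc.
by apply: Def_if => //; ds.
Qed.

Let kap_big i : KN M <= i -> kap M i = kap M (KN M).
Proof. by move=> h; rewrite /kap !nth_default // -cardE. Qed.

Let inord_big i : k <= i -> inord i = inord k :> 'I_k.
Proof.
by move=> h; rewrite /inord /insubd !insubF //; apply/negbTE; rewrite -leqNgt.
Qed.

Let dkq C (u : cx C -> nat) : Def u -> Def (fun x => kq M (u x)).
Proof. by apply: dtab (KN M) _ _ _ => i h; rewrite /kq kap_big. Qed.

Let dhalt C (u : cx C -> nat) : Def u -> DefB (fun x => khalt M (u x)).
Proof. by apply: (dtab (F := fun a => khalt M a : nat) (b := KN M)) => i h; rewrite /khalt /act kap_big. Qed.

Let dns C (u : cx C -> nat) : Def u -> Def (fun x => kns M (u x)).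
Proof. by apply: (dtab (b := KN M)) => i h; rewrite /kns /act kap_big. Qed.

Let dacc C (u : cx C -> nat) : Def u -> DefB (fun x => kacc M (u x)).
Proof.
apply: (dtab (F := fun a => kacc M a : nat) (b := QN M)) => i h.
by rewrite /kacc !nth_default // size_map -cardE.
Qed.

Let dkh C (u v : cx C -> nat) : Def u -> Def v -> Def (fun x => kh M (u x) (v x)).
Proof.
apply: (dtab2 (b := KN M) (c := k)) => i j h; rewrite /kh; first by rewrite kap_big.
by rewrite inord_big.
Qed.

Let ddir C (u v : cx C -> nat) : Def u -> Def v -> Def (fun x => kdir M (u x) (v x)).
Proof.
apply: (dtab2 (b := KN M) (c := k)) => i j h; rewrite /kdir /act; first by rewrite kap_big.
by case: tm_trans => // -[q f]; rewrite inord_big.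
Qed.

Let dwr C (u v : cx C -> nat) : Def u -> Def v -> Def (fun x => kwr M (u x) (v x)).
Proof.
apply: (dtab2 (b := KN M) (c := k)) => i j h; rewrite /kwr /act; first by rewrite kap_big.
by case: tm_trans => // -[q f]; rewrite inord_big.
Qed.

Let dtarget C (u v : cx C -> nat) : Def u -> Def v -> Def (fun x => target M (fR (cw x)) (u x) (v x)).
Proof.
move=> hu hv; rewrite /target; cbv zeta.
have ht : Def (fun x => v x %/ SN M %/ (fR (cw x)).*2.+1) by ds.
have hd := ddir hu ht; have hw := dwr hu ht.
have hs : Def (fun x => source (kdir M (u x) (v x %/ SN M %/ (fR (cw x)).*2.+1)) (fR (cw x)).*2.+1 (v x %/ SN M %% (fR (cw x)).*2.+1)).
  by rewrite /source; apply: Def_if; [ds| |]; ds.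
apply: Def_if; [exact: dhalt|by ds|].
apply: Def_if; [by ds| |].
  by apply: DefB_eq; [ds|apply: dns].
apply: Def_if; [by ds| |].
  by apply: DefB_eq; [ds|].
apply: Def_if; [by ds| |]; first by ds.
by rewrite /pos; ds.
Qed.

Let dpos C (u v t : cx C -> nat) : Def u -> Def v -> Def t -> Def (fun x => pos M (fR (cw x)) (u x) (v x) (t x)).
Proof. by move=> *; rewrite /pos; ds. Qed.

Let dinit C (v : cx C -> nat) : Def v -> DefB (fun x => init_bit M (fR (cw x)) (cw x) (v x)).
Proof. by move=> hv; rewrite /init_bit; ds. Qed.

Ltac dhook ::= lazymatch goal with
  | |- Def (fun x => fR _) => apply: dR | |- Def (fun x => tb M _) => apply: dtb | |- Def (fun x => fN _) => apply: dN
  | |- Def (fun x => fL _) => apply: dL | |- Def (fun x => fD _) => apply: dD | |- Def (fun x => fn _) => apply: wdef_fn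
  | |- Def (fun x => pos _ _ _ _ _) => apply: dpos | |- Def (fun x => kq _ _) => apply: dkq | |- Def (fun x => kh _ _ _) => apply: dkh
  | |- Def (fun x => target _ _ _ _) => apply: dtarget | |- DefB (fun x => kacc _ _) => apply: dacc
  | |- DefB (fun x => init_bit _ _ _ _) => apply: dinit | |- Def (fun x => bv _ _) => apply: dbv end.

Let dlit_tr C (a p b l : cx C -> nat) : Def a -> Def p -> Def b -> Def l ->
  DefB (fun x => lit_tr (cw x) (a x) (p x) (odd (b x)) (l x)).
Proof.
move=> ha hp hb hl; rewrite /lit_tr; cbv zeta.
apply: DefB_or; first by ds.
apply: DefB_or.
  apply: DefB_has; first by ds.
  by ds.
apply: DefB_or; first by ds.
by apply: DefB_if; [ds|apply: DefB_eqb; ds|ds].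
Qed.

Let dlit_link e C (a p b l : cx C -> nat) : Def a -> Def p -> Def b -> Def l ->
  DefB (fun x => lit_link (cw x) e (a x) (p x) (odd (b x)) (l x)).
Proof.
move=> ha hp hb hl; rewrite /lit_link; by ds.
Qed.

Let dlit_ty C (ty a p b l : cx C -> nat) : Def ty -> Def a -> Def p -> Def b -> Def l ->
  DefB (fun x => lit_ty (cw x) (ty x) (a x) (p x) (odd (b x)) (l x)).
Proof.
move=> hty ha hp hb hl.
have hi : DefB (fun x => lit_init (cw x) (p x) (l x)).
  by rewrite /lit_init; ds.
have hac : DefB (fun x => lit_acc (cw x) (l x)).
  by rewrite /lit_acc; ds.
have h1 := dlit_tr ha hp hb hl; have h3 := dlit_link false ha hp hb hl; have h4 := dlit_link true ha hp hb hl.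
rewrite /lit_ty; do 5 (apply: DefB_if; [by ds|by (apply: DefB_if; [ds|ds|ds])|]).
exact: hac.
Qed.

Lemma wdef_lit : wdefB2 flit.
Proof. by move=> C j l hj hl; rewrite /flit; apply: dlit_ty => //; ds. Qed.

End Def.

End Formula.

(** * The formula expresses acceptance *)

Section Correct.
Variables (M : turing_machine) (pol : {poly nat}) (w : seq bool).
Local Notation k := (tm_tapes M).+1.
Local Notation R := (fR pol w).
Local Notation N := (fN M pol w).
Local Notation L := (fL M pol w).

Let c i := run M w i.
Hypothesis space_le : forall t, Defs.space (run M w t) <= pol.[size w]%R.
Hypothesis halts : exists t, halted (run M w t).

Let R0 : 0 < R. Proof. by []. Qed.

Let cS i : c i.+1 = nextc (c i). Proof. by []. Qed.

Lemma run_fits i : fits R (c i).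
Proof.
move=> j; have : tape_size (ctapes (c i) j) <= Defs.space (c i).
  by rewrite /Defs.space (bigD1 j) //= leq_addr.
move/leq_trans => /(_ _ (space_le i)); rewrite /tape_size /fR => h; split; apply: leq_trans (leqW (ltnW h)).
  by rewrite leq_addr.
by rewrite leq_addl.
Qed.

Lemma enc_next i j : enc R (c i) = enc R (c j) -> enc R (c i.+1) = enc R (c j.+1).
Proof.
move=> E; have s1 : size (enc R (c i.+1)) = tN M R by rewrite size_mkseq.
apply/(trel_enc R0 (run_fits j) s1); rewrite -E; exact/(trel_enc R0 (run_fits i) s1).
Qed.

Lemma enc_halted i j : enc R (c i) = enc R (c j) -> halted (c i) = halted (c j).
Proof.
move=> E; have kK (x : control M) : kidx x < KN M by exact: (ltn_ord (enum_rank x)).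
have E2 : ctl (c i) = ctl (c j).
  have : matches M R (kidx (ctl (c i))) (enc R (c i)) by rewrite matches_enc.
  by rewrite E matches_enc // => /eqP /(congr1 (@kap M)); rewrite !kidxK.
have st x : isSome (step x) = isSome (tm_trans (ctl x).1 (ctl x).2) :> bool.
  by rewrite /step /ctl /=; case: tm_trans => [[q f]|].
by rewrite /halted !st E2.
Qed.

Lemma halted_stays i j : i <= j -> halted (c i) -> halted (c j).
Proof.
move=> /subnK <-; elim: (j - i) => // d IH h; rewrite addSn cS /nextc.
by have := IH h; rewrite {1}/halted; case: (step _) => //= _; exact: IH.
Qed.

(** Encodings forget absolute head positions, but an encoding determines the next one and whether
    the machine has halted. Among times 0 to [2 ^ N] two encodings coincide, after which they repeat
    periodically; so the encoding at a halting time already occurs up to [2 ^ N]. *)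
Lemma halted_exp : halted (c (2 ^ N)).
Proof.
have [i [j [ij jN E]]] : exists i j, [/\ i < j, j <= 2 ^ N & enc R (c i) = enc R (c j)].
  have sz i : size (enc R (c i)) == N by rewrite size_mkseq.
  pose f (i : 'I_(2 ^ N).+1) : N.-tuple bool := Tuple (sz i).
  have : ~~ injectiveb f.
    apply/negP => /injectiveP inj; have := leq_card f inj.
    by rewrite card_ord card_tuple card_bool ltnn.
  case/injectivePn => x [y ne /(congr1 val) /= E].
  have := ne; rewrite -val_eqE neq_ltn => /orP[lt|lt].
    by exists x, y; split=> //; rewrite -ltnS.
  by exists y, x; split=> //; rewrite -ltnS.
have per d : enc R (c (i + d)) = enc R (c (j + d)).
  by elim: d => [|d IH]; rewrite ?addn0 // !addnS; apply: enc_next.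
have [t ht] := halts.
have [t' t'N Et] : exists2 t', t' <= 2 ^ N & enc R (c t) = enc R (c t').
  elim/ltn_ind: t {ht} => t IH; have [le|lt] := leqP t (2 ^ N); first by exists t.
  have [|t' t'N Et] := IH (i + (t - j)); first by lia.
  by exists t' => //; rewrite -Et per; congr (enc _ (c _)); lia.
by apply: halted_stays t'N _; rewrite -(enc_halted Et).
Qed.

Section Leaf.
Variables (A X Y : seq bool).
Hypotheses (sA : size A = L) (sX : size X = N) (sY : size Y = N).
Let B := A ++ X ++ Y.
Local Notation n := (fn M pol w).
Local Notation bit r := (nth false A (bv M pol w r)).

Let nA i : i < L -> nth false B i = nth false A i.
Proof. by move=> lt; rewrite nth_cat sA lt. Qed.
Let nX p : p < N -> nth false B (L + p) = nth false X p.
Proof. by move=> lt; rewrite nth_cat sA ltnNge leq_addr /= addKn nth_cat sX lt. Qed.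
Let nY p : nth false B (L + N + p) = nth false Y p.
Proof. by rewrite -addnA nth_cat sA ltnNge leq_addr /= addKn nth_cat sX ltnNge leq_addr /= addKn. Qed.

Let bvL r : r < N -> bv M pol w r < L.
Proof. by move=> rN; apply: pair_bound. Qed.
Let posL r p : r < N -> p < N -> r * N.+1 + p < L.
Proof. by move=> rN pN; apply: pair_bound => //; apply: leqW. Qed.
Let Ln i : i < L -> i < n. Proof. by rewrite /fn; lia. Qed.
Let Xn p : p < N -> L + p < n. Proof. by rewrite /fn; lia. Qed.
Let Yn p : p < N -> L + N + p < n. Proof. by rewrite /fn; lia. Qed.

Lemma target_lt a p : p < N -> 1 < target M R a p -> target M R a p - 2 < N.
Proof.
move=> pN; rewrite /target; case: ifP => _; first by rewrite subn2.
case: ifP => [_|/negbT]; first by case: (_ == _).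
rewrite -ltnNge => lt; have SN0 : 0 < SN M by move: lt; rewrite /tb; case: (SN M) => //; rewrite muln0.
have tk : p %/ SN M %/ R.*2.+1 < k.
  by rewrite ltn_divLR // ltn_divLR // -/(tb M R).
cbv zeta; case: ifP => _; first by case: (_ == _).
case: ifP => [_|/negbT]; first by case: (_ == _).
rewrite -ltnNge subn2 /= => src _; apply: leq_trans (leq_addr _ _).
by apply: pos_lt => //; rewrite ltn_mod.
Qed.

Lemma has_iota_eq (f g : nat -> bool) m : (forall i, i < m -> f i = g i) -> has f (iota 0 m) = has g (iota 0 m).
Proof. by move=> H; apply: eq_in_has => i; rewrite mem_iota => /H. Qed.

Lemma sat_tr a p (b : bool) : a < KN M -> p < N ->
  sat n B (lit_tr M pol w a p b) = [|| ~~ matches M R a X, nth false Y p == b | tval M R a X p == ~~ b].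
Proof.
move=> aK pN; rewrite /lit_tr; cbv zeta; set t := target _ _ _ _.
have n0 := fn_pos M pol w.
have qN : tb M R + kq M a < N by rewrite ltn_add2l qc_lt.
rewrite sat_or sat_or sat_or sat_has !sat_eq ?Xn ?Yn // nX // nY.
have -> : has (fun t0 => sat n B (fun l => l == (L + pos M R t0 R (kh M a t0)).*2 + false)) (iota 0 k) =
    ~~ all (fun t => nth false X (pos M R t R (kh M a t))) (iota 0 k).
  rewrite -has_predC; apply: has_iota_eq => i ik; cbv beta.
  have lt : pos M R i R (kh M a i) < N.
    by apply: leq_trans (leq_addr _ _); apply: pos_lt => //; [lia|exact: sc_lt].
  by rewrite sat_eq ?Xn // nX // eqbF_neg.
rewrite /matches negb_and -!orbA; congr [|| _, _, _ | _]; first by rewrite eqbF_neg.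
rewrite /tval -/t; case: (ltnP t 2) => t2; cbv iota; first by rewrite sat_const.
have lt := target_lt pN t2; rewrite -/t in lt; by rewrite sat_eq ?Xn // nX.
Qed.

Lemma sat_link (e : bool) a p (b : bool) : a < N -> p < N ->
  sat n B (lit_link M pol w e a p b) = [|| bit a == e, has (fun r => (a < r) && (bit r == ~~ e)) (iota 0 N),
    nth false (if e then Y else X) p == b | nth false A (a * N.+1 + p) == ~~ b].
Proof.
move=> aN pN; have h1 := Ln (bvL aN); have h3 := Ln (posL aN pN).
have h2 : L + e * N + p < n.
  by case: (e); rewrite [nat_of_bool _]/= ?mul1n ?mul0n ?addn0; [apply: Yn|apply: Xn].
rewrite /lit_link !sat_or sat_has !sat_eq //.
rewrite (nA (bvL aN)) (nA (posL aN pN)); congr [|| _, _, _ | _]; last first.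
  by case: (e); rewrite [nat_of_bool _]/= ?mul1n ?mul0n ?addn0; [rewrite nY|rewrite nX].
apply: has_iota_eq => r rN; by rewrite sat_and sat_eq ?Ln ?bvL // nA ?bvL.
Qed.

Lemma sat_init p : p < N ->
  sat n B (lit_init M pol w p) = has (fun r => bit r) (iota 0 N) || (nth false X p == init_bit M R w p).
Proof.
move=> pN; rewrite /lit_init sat_or sat_has sat_eq ?Xn // nX //; congr (_ || _).
by apply: has_iota_eq => r rN; rewrite sat_eq ?Ln ?bvL // nA ?bvL // eqb_id.
Qed.

Lemma sat_acc : sat n B (lit_acc M pol w) = has (fun r => ~~ bit r) (iota 0 N) || taccept M R Y.
Proof.
rewrite /lit_acc sat_or !sat_has /taccept; congr (_ || _); apply: has_iota_eq => r rN.
  by rewrite sat_eq ?Ln ?bvL // nA ?bvL // eqbF_neg.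
by rewrite sat_and sat_eq ?Yn ?ltn_add2l // nY eqb_id.
Qed.

Definition linked e Z := forall a, a < N -> bit a = ~~ e -> (forall r, a < r -> r < N -> bit r = e) ->
  forall p, p < N -> nth false Z p = nth false A (a * N.+1 + p).

Lemma cnf_leaf : cnf n (fm M pol w) (flit M pol w) B <->
  [/\ linked false X, linked true Y, (forall r, r < N -> ~~ bit r) -> X = enc R (c 0),
      (forall r, r < N -> bit r) -> taccept M R Y & trel M R X Y].
Proof.
have n0 := fn_pos M pol w.
have ND a : a < N -> a < fD M pol w by rewrite /fD /fn; lia.
have KD a : a < KN M -> a < fD M pol w by rewrite /fD; lia.
have N0 := fN_pos M pol w.
apply: iff_trans (cnfE M pol w B) _; split=> [H|[HX HY Hi Ha Hr] ty a p b ty6 aD pD].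
  have lk e : linked e (if e then Y else X).
    move=> a aN ba later p pN; pose b := nth false A (a * N.+1 + p).
    have := H (2 + e) a p b; rewrite (_ : lit_ty _ _ _ _ _ _ _ = lit_link M pol w e a p b); last first.
      by apply: functional_extensionality => l; rewrite /lit_ty aN pN; case: (e).
    rewrite sat_link // => /(_ _ (ND a aN) (ND p pN)).
    rewrite ba -/b; have -> : has (fun r => (a < r) && (bit r == ~~ e)) (iota 0 N) = false.
      apply/hasP => -[r]; rewrite mem_iota add0n /= => rN /andP[ar]; rewrite later //.
      by case: (e).
    have -> : (~~ e == e) = false by case: (e).
    have -> : (b == ~~ b) = false by case: (b).
    by rewrite orbF /= => h; apply/eqP; apply: h; case: (e).
  split; [exact: (lk false)|exact: (lk true)| | |].
  - move=> b0; apply: (@eq_from_nth _ false) => [|p]; rewrite ?size_mkseq // sX => pN.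
    rewrite nth_enc // init_bitE //.
    have := H 4 p p true isT (ND p pN) (ND p pN).
    rewrite (_ : lit_ty _ _ _ _ _ _ _ = lit_init M pol w p); last first.
      by apply: functional_extensionality => l; rewrite /lit_ty pN.
    rewrite sat_init // => /orP[|/eqP //].
    by case/hasP => r; rewrite mem_iota add0n /= => rN; rewrite (negPf (b0 r rN)).
  - move=> b1; have := H 5 0 0 true isT; rewrite -[lit_ty _ _ _ _ _ _ _]/(lit_acc M pol w) sat_acc.
    have D0 : 0 < fD M pol w by rewrite /fD addn1.
    move=> /(_ D0 D0) /orP[|//].
    by case/hasP => r; rewrite mem_iota add0n /= => rN; rewrite b1.
  - move=> a aK ma p pN; pose b := ~~ tval M R a X p.
    have := H 1 a p b isT (KD a aK) (ND p pN).
    rewrite (_ : lit_ty _ _ _ _ _ _ _ = lit_tr M pol w a p b); last first.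
      by apply: functional_extensionality => l; rewrite /lit_ty aK pN.
    have := H 1 a p (~~ b) isT (KD a aK) (ND p pN).
    rewrite (_ : lit_ty _ _ _ _ _ _ _ = lit_tr M pol w a p (~~ b)); last first.
      by apply: functional_extensionality => l; rewrite /lit_ty aK pN.
    rewrite !sat_tr // ma /b; case: tval; case: nth => //.
have T : sat n B (fun=> true) by apply: sat_true.
have lk e : linked e (if e then Y else X) by case: e.
have LK e : (a < N) && (p < N) -> sat n B (lit_link M pol w e a p b).
  case/andP=> aN pN; rewrite sat_link //.
  case: eqP => // /eqP ba; case: hasP => // nh /=.
  have -> : nth false (if e then Y else X) p = nth false A (a * N.+1 + p).
    apply: (lk e a aN) => // [|r ar rN]; first by case: (e) (bit a) ba => -[].
    apply/eqP; apply: contraT => ne; case: nh; exists r; first by rewrite mem_iota.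
    by rewrite ar; case: (e) (bit r) ne => -[].
  by case: nth; case: (b).
case: ty ty6 => [|[|[|[|[|[|//]]]]]] _.
- rewrite (_ : lit_ty _ _ _ _ _ _ _ = fun l => if a < n then l./2 == a else true); last by [].
  case: ltnP => an //; apply/hasP; exists (a.*2 + nth false B a); first by rewrite mem_iota add0n /=; case: nth; lia.
  by rewrite addnC half_bit_double eqxx oddD odd_double addbF oddb eqxx.
- rewrite (_ : lit_ty _ _ _ _ _ _ _ = fun l => if (a < KN M) && (p < N) then lit_tr M pol w a p b l else true); last by [].
  case: andP => [[aK pN]|_] //; rewrite sat_tr //.
  case ma : matches => //=; rewrite (Hr a aK ma p pN).
  by case: tval; case: (b).
- rewrite (_ : lit_ty _ _ _ _ _ _ _ = fun l => if (a < N) && (p < N) then lit_link M pol w false a p b l else true); last by [].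
  by case E: (_ && _) => //; apply: LK.
- rewrite (_ : lit_ty _ _ _ _ _ _ _ = fun l => if (a < N) && (p < N) then lit_link M pol w true a p b l else true); last by [].
  by case E: (_ && _) => //; apply: LK.
- rewrite (_ : lit_ty _ _ _ _ _ _ _ = fun l => if p < N then lit_init M pol w p l else true); last by [].
  case: ltnP => pN //; rewrite sat_init //; case: hasP => //= nh.
  rewrite Hi ?nth_enc ?init_bitE // => r rN; apply/negP => br; apply: nh; exists r => //; by rewrite mem_iota.
- rewrite -[lit_ty _ _ _ _ _ _ _]/(lit_acc M pol w) sat_acc; case: hasP => //= nh; apply: Ha => r rN.
  by apply: contraT => br; case: nh; exists r => //; rewrite mem_iota.
Qed.

End Leaf.
End Correct.

Definition sel (e : bool) (E : option (seq bool) * option (seq bool)) := if e then E.2 else E.1.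

(** Each end comes from the last round that replaced it, which is the form in which [lit_link] can
    state it. *)
Lemma ends_last N A e R :
  (sel e (ends N R A) = None /\ forall r, r < R -> nth false A (r * N.+1 + N) = e) \/
  (exists a, [/\ a < R, nth false A (a * N.+1 + N) = ~~ e, forall r, a < r -> r < R -> nth false A (r * N.+1 + N) = e &
     sel e (ends N R A) = Some (chunk N a A)]).
Proof.
elim: R => [|R IH]; first by left; split=> //; case: e.
case E: (nth false A (R * N.+1 + N) == e); last first.
  right; exists R; split=> //; first by case: nth E; case: (e).
    by move=> r r1 r2; lia.
  by rewrite /= ; case: nth E; case: (e).
move/eqP in E; have -> : sel e (ends N R.+1 A) = sel e (ends N R A) by rewrite /= E; case: (e).
case: IH => [[E1 H]|[a [aR ba later E1]]]; [left|right; exists a]; split=> //; try lia.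
- by move=> r; rewrite ltnS leq_eqVlt => /orP[/eqP->|/H].
- by move=> r ar; rewrite ltnS leq_eqVlt => /orP[/eqP->|/(later _ ar)].
Qed.

Lemma size_chunk N R r A : size A = R * N.+1 -> r < R -> size (chunk N r A) = N.
Proof.
move=> sA rR; rewrite size_take size_drop sA -mulnBl; have : 0 < R - r by rewrite subn_gt0.
by case: (R - r) => // d _; rewrite mulSn; case: ltnP => //; lia.
Qed.

Lemma nth_chunk N r A p : p < N -> nth false (chunk N r A) p = nth false A (r * N.+1 + p).
Proof. by move=> pN; rewrite nth_take // nth_drop. Qed.

Section Accept.
Variables (M : turing_machine) (pol : {poly nat}) (w : seq bool).
Local Notation R := (fR pol w).
Local Notation N := (fN M pol w).
Local Notation L := (fL M pol w).
Local Notation n := (fn M pol w).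

Let c i := run M w i.
Hypothesis space_le : forall t, Defs.space (run M w t) <= pol.[size w]%R.
Hypothesis halts : exists t, halted (run M w t).

Definition gleaf (oX oY : option (seq bool)) := exists X Y,
  [/\ size X = N, size Y = N, (if oX is Some x then X = x else X = enc R (c 0)),
      (if oY is Some y then Y = y else taccept M R Y) & trel M R X Y].

Lemma linkedP A e Z : size A = L -> size Z = N ->
  linked M pol w A e Z <-> (forall x, sel e (ends N N A) = Some x -> Z = x).
Proof.
move=> sA sZ; split=> [lk x|H a aN ba later p pN].
  case: (ends_last N A e N) => [[-> //]|[a [aN ba later ->]] [<-]].
  apply: (@eq_from_nth _ false) => [|p]; first by rewrite sZ (size_chunk sA).
  by rewrite sZ => pN; rewrite nth_chunk //; apply: lk.
case: (ends_last N A e N) => [[_ all]|[a' [aN' ba' later' E]]].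
  by have := all a aN; rewrite -/(bv M pol w a) ba; case: (e).
rewrite (H _ E) nth_chunk //; congr (nth _ _ (_ * _ + _)).
case: (ltngtP a a') => // lt.
  by have := later a' lt aN'; rewrite /bv ba'; case: (e).
by have := later' a lt aN; rewrite -/(bv M pol w a) ba; case: (e).
Qed.

Lemma ends_none A e : sel e (ends N N A) = None <-> (forall r, r < N -> nth false A (bv M pol w r) = e).
Proof.
case: (ends_last N A e N) => [[E H]|[a [aN ba later E]]]; split=> // [|H]; first by rewrite E.
by have := H a aN; rewrite /bv ba; case: (e).
Qed.

Lemma gleafP A : size A = N * N.+1 ->
  (qval (fun' M pol w) (cnf n (fm M pol w) (flit M pol w)) (N + N) A <-> gleaf (ends N N A).1 (ends N N A).2).
Proof.
move=> sA; have ex i : i < N + N -> ~~ fun' M pol w (size A + i).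
  by move=> _; rewrite /fun' sA /fL ltnNge leq_addr.
apply: (iff_trans (qval_ex _ ex)).
have main X Y : size X = N -> size Y = N -> (cnf n (fm M pol w) (flit M pol w) (A ++ X ++ Y) <->
    [/\ if (ends N N A).1 is Some x then X = x else X = enc R (c 0),
      (if (ends N N A).2 is Some y then Y = y else taccept M R Y) & trel M R X Y]).
  move=> sX sY; apply: (iff_trans (cnf_leaf sA sX sY)).
  have [l1 l1'] := linkedP false sA sX; have [l2 l2'] := linkedP true sA sY.
  have [n1 n1'] := ends_none A false; have [n2 n2'] := ends_none A true.
  rewrite /sel in l1 l1' l2 l2' n1 n1' n2 n2'.
  split=> [[/l1 h1 /l2 h2 h3 h4 h5]|[h1 h2 h5]].
    split=> //.
      case E: (ends N N A).1 => [x|]; first exact: h1.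
      by apply: h3 => r rN; rewrite n1.
    case E: (ends N N A).2 => [y|]; first exact: h2.
    by apply: h4; apply: n2.
  split=> //.
  - by apply: l1' => x E; rewrite E in h1.
  - by apply: l2' => x E; rewrite E in h2.
  - by move=> H; rewrite n1' in h1 => // r rN; apply/negbTE/H.
  - by move=> H; rewrite n2' in h2.
split=> [[V [sV lV]]|[X [Y [sX sY h1 h2 h3]]]].
  exists (take N V), (drop N V); have s1 : size (take N V) = N by rewrite size_takel // sV leq_addr.
  have s2 : size (drop N V) = N by rewrite size_drop sV addKn.
  by have [] := (main _ _ s1 s2).1; rewrite ?cat_take_drop.
exists (X ++ Y); split; first by rewrite size_cat sX sY.
by apply/main.
Qed.

(** From an encoding the successor is forced, so all midpoints on a path from the initial
    configuration are encodings of the run, although they are quantified over arbitrary strings. *)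
Lemma reach_run r oX oY i : (oX = None /\ i = 0) \/ oX = Some (enc R (c i)) -> (forall y, oY = Some y -> size y = N) ->
  (reach N gleaf r oX oY <-> (if oY is Some y then y = enc R (c (i + 2 ^ r)) else tm_accept (cstate (c (i + 2 ^ r))))).
Proof.
have sE j : size (enc R (c j)) = N by rewrite size_mkseq.
have R0 : 0 < R by [].
have fits j : fits R (c j) by apply: run_fits.
elim: r i oX oY => [|r IHr] i oX oY sX sY.
  rewrite addn1 /=; have tr Y : size Y = N -> (trel M R (enc R (c i)) Y <-> Y = enc R (c i.+1)).
    by move=> s; apply: trel_enc.
  have X0 X : (if oX is Some x then X = x else X = enc R (c 0)) <-> X = enc R (c i).
    by case: sX => [[-> ->]|->].
  split=> [[X [Y [sX' sY' /X0 -> h2 /(tr _ sY') E]]]|h].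
    by case: oY h2 sY => [y <-|]; rewrite E // taccept_enc.
  exists (enc R (c i)), (enc R (c i.+1)); split; rewrite ?sE //; first exact/X0.
    by case: oY sY h => [y|] _ //; rewrite taccept_enc.
  exact/(tr _ (sE _)).
have E2 : 2 ^ r.+1 = 2 ^ r + 2 ^ r by rewrite expnS mul2n addnn.
have hs (C y : seq bool) : size C = N -> Some C = Some y -> size y = N by move=> sC [<-].
rewrite /= E2 addnA; split=> [[C [sC h1 h2]]|h].
  have hC : C = enc R (c (i + 2 ^ r)) := (IHr i oX (Some C) sX (fun y => hs C y sC)).1 h1.
  have sC' : (Some C = None /\ i + 2 ^ r = 0) \/ Some C = Some (enc R (c (i + 2 ^ r))) by right; rewrite hC.
  exact: (IHr (i + 2 ^ r) (Some C) oY sC' sY).1 h2.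
exists (enc R (c (i + 2 ^ r))); split; rewrite ?sE //.
  exact: (IHr i oX (Some _) sX (fun y => hs _ y (sE _))).2 erefl.
exact: (IHr (i + 2 ^ r) (Some _) oY (or_intror erefl) sY).2 h.
Qed.

Lemma formula_accept : qval (fun' M pol w) (cnf n (fm M pol w) (flit M pol w)) n [::] <->
  tm_accept (cstate (run M w (2 ^ N))).
Proof.
have E : n = N * N.+1 + (N + N) by rewrite /fn /fL addnA.
have univE i : i < N * N.+1 -> fun' M pol w i = (i %% N.+1 == N) by rewrite /fun' /fL => ->.
rewrite [X in qval _ _ X [::]]E qval_add; have S := qval_savitch (R := 0) (A := [::]) univE gleafP (add0n N) erefl.
apply: (iff_trans S); have Rn := @reach_run N None None 0 (or_introl (conj erefl erefl)).
by rewrite add0n in Rn; apply: Rn.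
Qed.

End Accept.

Theorem pebbling_hard K (move : forall V : finType, rel V -> rel {set V}) : 0 < K ->
  (forall V e, subrel (@reversible_move V e) (move V e)) -> (forall V e, subrel (move V e) (@standard_move V e)) ->
  PSPACE_hard (gap_pebbling_price move K).
Proof.
move=> K0 mrev mstd Q [M [p H]].
apply: (reducible_to_pebbling (nn := fn M p) (mm := fm M p) (lt := flit M p) (un := fun' M p)) => //.
- exact: wdef_fn.
- exact: wdef_fm.
- exact: wdef_lit.
- exact: wdef_fun.
- by move=> w; apply: fn_pos.
- by move=> w i; apply: formula_clauses.
- by move=> w yw; have [ht sp yes _] := H w; apply/(formula_accept sp); apply: yes => //; exact: halted_exp.
- move=> w nw; have [ht sp _ no] := H w; apply/negP => /(formula_accept sp); apply/negP; apply: no => //.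
  exact: halted_exp.
Qed.

(** * Membership *)

Definition ctx1 : dctx := @Ctx (seq bool * seq bool) fst snd (fun=> env0) 0.

(** The search keeps the assignment with the latest choice on top, whence the position
    [nv w - i.+1]. The guard [i < nv w] reproduces the default of [nth false] out of range. *)
Lemma pspace_def (Q : promise_problem) (nv : seq bool -> nat) (univ : seq bool -> pred nat)
    (L : seq bool -> (nat -> bool) -> bool) :
  (forall C, Def (fun x : cx C => nv (cw x))) ->
  (forall C, DefB (fun x : cx C => univ (cw x) (size (ca x)))) ->
  (forall C, DefB (fun x : cx C => L (cw x) (fun i => (i < nv (cw x)) && nth false (ca x) (nv (cw x) - i.+1)))) ->
  (forall w, yes_instance Q w -> qval (univ w) (fun A => L w (nth false A)) (nv w) [::]) ->
  (forall w, no_instance Q w -> ~~ qval (univ w) (fun A => L w (nth false A)) (nv w) [::]) -> PSPACE Q.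
Proof.
move=> dn du dl; have [en _ enE] := dn ctx1; have [eu _ euE] := du ctx1; have [el _ elE] := dl ctx1.
apply: (pspace_qval (en := en) (eu := eu) (el := el)) => [w a|w a|w a sa].
- exact: (enE (w, a)).
- by have /= -> := euE (w, a); rewrite lt0b.
have /= -> := elE (w, rev a); rewrite lt0b; congr (L w _).
apply: functional_extensionality => i; case: ltnP => h /=; last by rewrite nth_default ?sa.
rewrite nth_rev ?sa; last by lia.
by congr nth; lia.
Qed.

Lemma nlog_mono a b : a <= b -> nlog a <= nlog b.
Proof.
by move=> ab; rewrite /nlog (big_ord_widen b (fun d => pow2 d : nat) ab) big_mkcond; apply: leq_sum => i _; case: ifP.
Qed.

Lemma nlog_leq q i : (nlog q.+1 <= i) = (q < 2 ^ i).
Proof.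
apply/idP/idP => [le|lt]; last by rewrite -[i]nlog_exp nlog_mono.
rewrite ltnNge; apply/negP => h; have := nlog_mono (h : 2 ^ i < q.+1).
have -> : nlog (2 ^ i).+1 = i.+1.
  rewrite /nlog big_ord_recr /= -/(nlog _) nlog_exp.
  have -> : pow2 (2 ^ i) by apply/pow2P; exists i.
  by rewrite addn1.
by lia.
Qed.

Lemma sum_bits m s : s < 2 ^ m -> \sum_(i < m) odd (s %/ 2 ^ i) * 2 ^ i = s.
Proof.
elim: m s => [|m IH] s lt; first by rewrite big_ord0; move: lt; rewrite expn0; lia.
rewrite big_ord_recl /= divn1 muln1 (eq_bigr (fun i : 'I_m => 2 * (odd (s./2 %/ 2 ^ i) * 2 ^ i))).
  by rewrite -big_distrr /= IH ?mul2n ?odd_double_half //; rewrite expnS in lt; lia.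
by move=> i _; rewrite /bump /= add1n expnS -divn2 -divnMA mulnCA.
Qed.

Section Membership.
Variable rv : bool.

Definition lead w := \sum_(i < size w) (all (nth false w) (iota 0 i.+1) : nat).
Definition adj w u v := nth false w (lead w + 1 + (u * lead w + v)).
Definition moff w := lead w + 1 + lead w * lead w.
(* the absolute value of the bound, with every power of two truncated at [lead w + 1] *)
Definition cap w := \sum_(i < size w) nth false w (moff w + 1 + i) * \sum_(q < (lead w).+1) (nlog q.+1 <= i).
Definition mnv w := lead w * (lead w).+1.
Definition muniv w i := i %% (lead w).+1 == lead w.

Definition mok w (x : nat -> bool) := ~~ nth false w (moff w) && (\sum_(u < lead w) x u <= cap w).
Definition mpreds w x v := all (fun u => adj w u v ==> x u) (iota 0 (lead w)).
Definition mplace w (x y : nat -> bool) := has (fun v => [&& ~~ x v, mpreds w x v &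
  all (fun u => y u == ((u == v) || x u)) (iota 0 (lead w))]) (iota 0 (lead w)).
Definition mremove w (x y : nat -> bool) := has (fun v => [&& x v, rv ==> mpreds w x v &
  all (fun u => y u == (x u && (u != v))) (iota 0 (lead w))]) (iota 0 (lead w)).
(** Stuttering turns paths of length [2 ^ r] into paths of at most this length. *)
Definition mmove w x y := [|| all (fun u => y u == x u) (iota 0 (lead w)), mplace w x y | mremove w x y].

Definition mbit w (f : nat -> bool) r := f (r * (lead w).+1 + lead w).
Definition mlast w (f : nat -> bool) (e : bool) a :=
  (mbit w f a == ~~ e) && all (fun r => (a < r) ==> (mbit w f r == e)) (iota 0 (lead w)).
(** If no round has set the end, all bits are [false]. This is the empty configuration, as required
    on the left; on the right [mfin] supplies the sink instead. *)
Definition mend w f e p := has (fun a => mlast w f e a && f (a * (lead w).+1 + p)) (iota 0 (lead w)).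
Definition mfin w f p := mend w f true p ||
  (all (fun r => mbit w f r) (iota 0 (lead w)) && all (fun v => ~~ adj w p v) (iota 0 (lead w))).

Definition mleaf w f := [&& mok w (mend w f false), mok w (mfin w f) & mmove w (mend w f false) (mfin w f)].

Section Def.
Ltac dhook ::= fail.

Let dlead : wdef0 lead.
Proof.
move=> C; apply: (Def_sum (G := fun x i => all (nth false (cw x)) (iota 0 i.+1) : nat)); first exact: Def_wsize.
apply: (DefB_ext (f := fun p : cx (ext C) => all (fun j => nth false (cw p) j) (iota 0 p.2.+1))) => //.
by ds.
Qed.

Ltac dhook ::= lazymatch goal with | |- Def (fun x => lead _) => apply: dlead end.

Let dmoff : wdef0 moff. Proof. by move=> C; rewrite /moff; ds. Qed.

Let dadj C (u v : cx C -> nat) : Def u -> Def v -> DefB (fun x => adj (cw x) (u x) (v x)).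
Proof. by move=> hu hv; rewrite /adj; ds. Qed.

Ltac dhook ::= lazymatch goal with | |- Def (fun x => lead _) => apply: dlead
  | |- Def (fun x => moff _) => apply: dmoff | |- DefB (fun x => adj _ _ _) => apply: dadj
  | |- Def (fun x => nlog _) => apply: Def_nlog end.

Let dcap : wdef0 cap.
Proof.
move=> C; apply: (Def_sum (G := fun x i => nth false (cw x) (moff (cw x) + 1 + i) * \sum_(q < (lead (cw x)).+1) (nlog q.+1 <= i))).
  exact: Def_wsize.
apply: Def_mul; first by change (DefB (fun p : cx (ext C) => nth false (cw p) (moff (cw p) + 1 + p.2))); ds.
apply: (Def_sum (C := ext C) (G := fun p q => (nlog q.+1 <= p.2 : nat))); by ds.
Qed.

Lemma mnv_def C : Def (fun x : cx C => mnv (cw x)).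
Proof. by rewrite /mnv; ds. Qed.

Lemma muniv_def C : DefB (fun x : cx C => muniv (cw x) (size (ca x))).
Proof. by rewrite /muniv; ds. Qed.

Definition WA (x : seq bool -> seq bool -> nat -> bool) := forall C u, Def u -> DefB (fun c : cx C => x (cw c) (ca c) (u c)).

Lemma mok_def x C : WA x -> DefB (fun c : cx C => mok (cw c) (x (cw c) (ca c))).
Proof.
move=> dx; rewrite /mok; apply: DefB_and; first by ds.
apply: DefB_leq; last exact: dcap.
apply: (Def_sum (G := fun c u => x (cw c) (ca c) u : nat)); first by ds.
exact: (dx (ext C) _ (Def_bound C)).
Qed.

Lemma mpreds_def x C v : WA x -> Def v -> DefB (fun c : cx C => mpreds (cw c) (x (cw c) (ca c)) (v c)).
Proof.
move=> dx dv; rewrite /mpreds; have h := dx (ext C) _ (Def_bound C).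
by ds.
Qed.

Lemma mmove_def x y C : WA x -> WA y -> DefB (fun c : cx C => mmove (cw c) (x (cw c) (ca c)) (y (cw c) (ca c))).
Proof.
move=> dx dy; have hx := dx (ext C) _ (Def_bound C); have hy := dy (ext C) _ (Def_bound C).
have hx2 := dx (ext (ext C)) _ (Def_bound (ext C)); have hy2 := dy (ext (ext C)) _ (Def_bound (ext C)).
have hp := mpreds_def dx (Def_bound C).
rewrite /mmove /mplace /mremove; apply: DefB_or.
  by apply: DefB_all; [ds|apply: DefB_eqb].
apply: DefB_or; (apply: DefB_has; first by ds).
  apply: DefB_and; first by apply: DefB_neg.
  apply: DefB_and; first exact: hp.
  by apply: DefB_all; [ds|apply: DefB_eqb; [exact: hy2|apply: DefB_or; [ds|exact: hx2]]].
apply: DefB_and; first exact: hx.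
apply: DefB_and; first by apply: DefB_imp; [ds|exact: hp].
by apply: DefB_all; [ds|apply: DefB_eqb; [exact: hy2|apply: DefB_and; [exact: hx2|ds]]].
Qed.

Lemma mend_def f e : WA f -> WA (fun w a => mend w (f w a) e).
Proof.
move=> df C u du; rewrite /mend /mlast /mbit.
apply: DefB_has; first by ds.
apply: DefB_and; last by apply: df; ds.
apply: DefB_and; first by apply: DefB_eqb; [apply: (df (ext C)); ds|ds].
apply: DefB_all; first by ds.
by apply: DefB_imp; [ds|apply: DefB_eqb; [apply: (df (ext (ext C))); ds|ds]].
Qed.

Lemma mfin_def f : WA f -> WA (fun w a => mfin w (f w a)).
Proof.
move=> df C u du; rewrite /mfin; apply: DefB_or; first exact: (mend_def true df).
apply: DefB_and; last by ds.
by apply: DefB_all; [ds|apply: (df (ext C)); ds].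
Qed.

Lemma mleaf_def C : DefB (fun x : cx C => mleaf (cw x) (fun i => (i < mnv (cw x)) && nth false (ca x) (mnv (cw x) - i.+1))).
Proof.
have df : WA (fun w a i => (i < mnv w) && nth false a (mnv w - i.+1)).
  by move=> D u du; have h := mnv_def D; apply: DefB_and; ds.
have d1 := mend_def false df; have d2 := mfin_def df.
rewrite /mleaf; apply: DefB_and; first exact: (mok_def C d1).
by apply: DefB_and; [exact: (mok_def C d2)|exact: (mmove_def C d1 d2)].
Qed.

End Def.
End Membership.

Lemma sum_ltn m n : n <= m -> \sum_(i < m) (i < n : nat) = n.
Proof.
move=> le; rewrite -[RHS]card_ord -sum1_card [RHS](big_ord_widen m (fun=> 1) le) big_mkcond [RHS]big_mkcond.
by apply: eq_bigr => i _; case: ltnP.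
Qed.

Lemma has_ord n (P : nat -> bool) : has P (iota 0 n) = [exists i : 'I_n, P i].
Proof.
apply/hasP/existsP => [[i]|[i Pi]]; last by exists (nat_of_ord i) => //; rewrite mem_iota add0n /=.
by rewrite mem_iota add0n /= => lt Pi; exists (Ordinal lt).
Qed.

Lemma all_ord n (P : nat -> bool) : all P (iota 0 n) = [forall i : 'I_n, P i].
Proof.
apply/allP/forallP => [H i|H i]; first by apply: H; rewrite mem_iota add0n /=.
by rewrite mem_iota add0n /= => lt; apply: (H (Ordinal lt)).
Qed.

Section Reach.
Variables (T : finType) (ok : pred T) (step : rel T).

Definition conn m P Q := exists Ps, [/\ path step P Ps, last P Ps = Q, all ok (P :: Ps) & size Ps <= m].

Lemma conn_double m P Q : conn (m + m) P Q <-> exists C, conn m P C /\ conn m C Q.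
Proof.
split=> [[Ps [p l o sz]]|[C [[Ps [p1 l1 o1 s1]] [Qs [p2 l2 o2 s2]]]]]; last first.
  exists (Ps ++ Qs); split.
  - by rewrite cat_path p1 l1.
  - by rewrite last_cat l1.
  - by move: o1 o2 => /= /andP[-> h1] /andP[_ h2]; rewrite all_cat h1.
  - by rewrite size_cat leq_add.
exists (last P (take m Ps)); move: p l o; rewrite -{1 2 3}(cat_take_drop m Ps) cat_path last_cat.
move=> /andP[p1 p2] l /= /andP[oP]; rewrite all_cat => /andP[o1 o2]; split.
  by exists (take m Ps); split=> //=; rewrite ?oP // size_take_min geq_minl.
exists (drop m Ps); split=> //=; last by rewrite size_drop leq_subLR.
rewrite o2 andbT; have := mem_last P (take m Ps); rewrite inE => /orP[/eqP-> //|].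
by move=> h; apply: (allP o1).
Qed.

(** Cycles are cut out. For sets of vertices the bound is [2 ^ n], which is what [n] rounds
    cover. *)
Lemma conn_short Ps P Q : path step P Ps -> last P Ps = Q -> all ok (P :: Ps) -> conn #|T| P Q.
Proof.
move=> p <- /= /andP[oP oPs]; case: (shortenP p) => Qs q u sub.
exists Qs; split=> //; first by rewrite /= oP; apply/allP => x /sub h; apply: (allP oPs).
by have := card_uniqP u => /= E; have := max_card (mem (P :: Qs)); rewrite E; apply: ltnW.
Qed.

End Reach.

(** * The leaf predicate on encoded instances *)

Section Instance.
Variables (rv : bool) (n : nat) (e : rel 'I_n) (s : int) (z : 'I_n).
Hypothesis sinkz : unique_sink e z.
Let w := encode e s.

Let a := `|s|%N.

Let nthw i : nth false w (n + 1 + i) = nth false ([seq e u v | u <- enum 'I_n, v <- enum 'I_n] ++ int_bits s) i.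
Proof.
by rewrite /w /encode nth_cat size_nseq -addnA ltnNge leq_addr /= addKn add1n.
Qed.

Let szw : size w = n + 1 + (n * n + (trunc_log 2 a).+2).
Proof.
by rewrite /w /encode size_cat size_nseq /= size_cat size_allpairs size_enum_ord /int_bits /nat_bits /= size_map size_iota -/a; lia.
Qed.

Lemma lead_encode : lead w = n.
Proof.
rewrite /lead -[RHS](@sum_ltn (size w) n); last by rewrite szw; lia.
apply: eq_bigr => i _; congr (nat_of_bool _); apply/allP/idP => [H|lt j].
  rewrite ltnNge; apply/negP => ni; have := H n; rewrite mem_iota add0n /= ltnS => /(_ ni).
  by rewrite /w /encode nth_cat size_nseq ltnn subnn.
rewrite mem_iota add0n /= => ji; rewrite /w /encode nth_cat size_nseq.
have jn : j < n by lia.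
by rewrite jn nth_nseq jn.
Qed.

Lemma adj_encode (u v : 'I_n) : adj w u v = e u v.
Proof.
rewrite /adj lead_encode nthw nth_cat size_allpairs size_enum_ord.
have lt : u * n + v < n * n by apply: pair_bound.
rewrite lt.
pose f (u v : nat) := if (insub u : option 'I_n) is Some u' then if (insub v : option 'I_n) is Some v' then e u' v' else false else false.
have fE (u' v' : 'I_n) : f u' v' = e u' v' by rewrite /f !valK.
have -> : [seq e u v | u <- enum 'I_n, v <- enum 'I_n] = [seq f (u : 'I_n) (v : 'I_n) | u <- enum 'I_n, v <- enum 'I_n].
  by apply: eq_allpairs => u' v'; rewrite fE.
by rewrite allpairs_mkseq nth_mkseq // pair_div // pair_mod // fE.
Qed.

Lemma sign_encode : nth false w (moff w) = (s < 0)%R.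
Proof. by rewrite /moff lead_encode nthw nth_cat size_allpairs size_enum_ord ltnn subnn. Qed.

Lemma bits_encode i : nth false w (moff w + 1 + i) = odd (a %/ 2 ^ i).
Proof.
have -> : moff w + 1 + i = n + 1 + (n * n + i.+1) by rewrite /moff lead_encode; lia.
rewrite nthw nth_cat size_allpairs size_enum_ord ltnNge leq_addr /= addKn /=.
rewrite /nat_bits; case: (ltnP i (trunc_log 2 a).+1) => h; first by rewrite nth_mkseq.
rewrite nth_default ?size_mkseq // divn_small //; apply: leq_trans (trunc_log_ltn a (isT : 1 < 2)) _.
by rewrite leq_pexp2l.
Qed.

(** The bound is given in binary and may be exponential, beyond unary arithmetic, but only
    comparisons with numbers up to [n] matter. A set bit of weight above [n] alone makes the
    truncated sum exceed [n]; without one nothing is truncated. *)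
Lemma cap_encode m : m <= n -> (m <= cap w) = (m <= a).
Proof.
move=> mn; rewrite /cap lead_encode.
have A2 : a < 2 ^ size w.
  by apply: leq_trans (trunc_log_ltn a (isT : 1 < 2)) _; rewrite leq_pexp2l // szw; lia.
pose t i := odd (a %/ 2 ^ i) * minn (2 ^ i) n.+1.
have tE i : nth false w (moff w + 1 + i) * \sum_(q < n.+1) (nlog q.+1 <= i) = t i.
  rewrite bits_encode /t; congr (_ * _).
  rewrite (eq_bigr (fun q : 'I_n.+1 => (q < minn (2 ^ i) n.+1) : nat)) ?sum_ltn ?geq_minr //.
  by move=> q _; rewrite nlog_leq leq_min ltn_ord andbT.
rewrite (eq_bigr (fun i : 'I_(size w) => t i)); last by move=> i _; apply: tE.
have tle (i : 'I_(size w)) : t i <= odd (a %/ 2 ^ i) * 2 ^ i by rewrite leq_mul2l geq_minl orbT.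
apply/idP/idP => h.
  by apply: leq_trans h _; rewrite -[X in _ <= X](sum_bits A2); apply: leq_sum.
have [/existsP[i /andP[oi ni]]|/existsPn small] := boolP [exists i : 'I_(size w), odd (a %/ 2 ^ i) && (n < 2 ^ i)].
  rewrite (bigD1 i) //=; apply: leq_trans (leq_addr _ _).
  by rewrite /t oi mul1n leq_min; apply/andP; split; lia.
apply: leq_trans h _; rewrite -{1}(sum_bits A2); apply: leq_sum => i _; rewrite /t.
have := small i; case: odd => //=; rewrite -leqNgt => le.
by rewrite leq_mul2l leq_min leqnn leqW.
Qed.

Definition bs (x : nat -> bool) : {set 'I_n} := [set u : 'I_n | x u].
Definition pok (P : {set 'I_n}) := (0 <= s)%R && (#|P| <= a).
Definition pmove : rel {set 'I_n} := if rv then reversible_move e else standard_move e.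

Lemma mok_bs x : mok w x = pok (bs x).
Proof.
rewrite /mok sign_encode lead_encode -Num.Theory.real_leNgt ?Num.Theory.num_real //; congr (_ && _).
have -> : \sum_(u < n) x u = #|bs x|.
  by rewrite cardsE -sum1_card [RHS]big_mkcond; apply: eq_bigr => u _; rewrite unfold_in; case: (x u).
by rewrite cap_encode // -[X in _ <= X](card_ord n) max_card.
Qed.

Lemma mpreds_bs x (v : 'I_n) : mpreds w x v = (preds e v \subset bs x).
Proof.
rewrite /mpreds lead_encode all_ord; apply/forallP/subsetP => [H u|H u].
  by rewrite !inE => uv; have := H u; rewrite adj_encode uv.
by apply/implyP; rewrite adj_encode => uv; have := H u; rewrite !inE; apply.
Qed.

Lemma all_bs (x y : nat -> bool) : all (fun u => y u == x u) (iota 0 n) = (bs y == bs x).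
Proof.
rewrite all_ord; apply/forallP/eqP => [H|/setP H u].
  by apply/setP => u; rewrite !inE; apply/eqP.
by have := H u; rewrite !inE => ->.
Qed.

Lemma mmove_bs x y : mmove rv w x y = (bs x == bs y) || pmove (bs x) (bs y).
Proof.
rewrite /mmove lead_encode all_bs eq_sym; congr (_ || _).
have E1 : mplace w x y = placement e (bs x) (bs y).
  rewrite /mplace lead_encode has_ord; apply: eq_existsb => v; rewrite inE mpreds_bs.
  rewrite (all_bs (fun u => (u == v) || x u)); congr [&& _, _ & _ == _].
  by apply/setP => u; rewrite !inE -val_eqE.
have E2 : mremove rv w x y = [exists v, [&& v \in bs x, rv ==> (preds e v \subset bs x) & bs y == bs x :\ v]].
  rewrite /mremove lead_encode has_ord; apply: eq_existsb => v; rewrite inE mpreds_bs.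
  rewrite (all_bs (fun u => x u && (u != v))); congr [&& _, _ & _ == _].
  by apply/setP => u; rewrite !inE -val_eqE andbC.
by rewrite E1 E2 /pmove /reversible_move /standard_move; case: rv.
Qed.

Definition cset (o : option (seq bool)) (d : {set 'I_n}) := if o is Some C then bs (nth false C) else d.
Definition mrel oX oY := let X := cset oX set0 in let Y := cset oY [set z] in
  [/\ pok X, pok Y & (X == Y) || pmove X Y].

Lemma mend_ends A b : size A = n * n.+1 -> bs (mend w (nth false A) b) = cset (sel b (ends n n A)) set0.
Proof.
move=> sA; case: (ends_last n A b n) => [[-> all]|[c [cn bc later ->]]]; apply/setP => p; rewrite !inE /mend lead_encode.
  apply/hasP => -[c]; rewrite mem_iota add0n /= => cn /andP[/andP[]].
  by rewrite /mbit lead_encode all //; case: (b).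
rewrite nth_chunk //; apply/hasP/idP => [[c']|h].
  rewrite mem_iota add0n /= => cn' /andP[/andP[]]; rewrite /mbit lead_encode => /eqP bc' /allP later'.
  have -> // : c' = c.
  case: (ltngtP c' c) => // lt; last by have := later c' lt cn'; rewrite bc'; case: (b).
  by have := later' c; rewrite mem_iota add0n lt bc => /(_ cn); case: (b).
exists c; first by rewrite mem_iota.
rewrite h andbT /mlast /mbit lead_encode bc eqxx /=; apply/allP => r; rewrite mem_iota add0n /= => rn.
by apply/implyP => cr; rewrite later.
Qed.

Lemma mfin_ends A : size A = n * n.+1 -> bs (mfin w (nth false A)) = cset (sel true (ends n n A)) [set z].
Proof.
move=> sA; have E := mend_ends true sA.
have S p : all (fun v => ~~ adj w p v) (iota 0 n) = (p == z :> nat) \/ True by right.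
have sk (p : 'I_n) : all (fun v => ~~ adj w p v) (iota 0 n) = (p == z).
  rewrite all_ord; apply/forallP/eqP => [H|/sinkz H v]; last by rewrite adj_encode.
  by apply/sinkz => v; have := H v; rewrite adj_encode.
apply/setP => p; have /setP/(_ p) := E; rewrite !inE /mfin lead_encode => ->; rewrite sk.
case: (ends_last n A true n) => [[-> all1]|[c [cn bc later ->]]] /=.
  rewrite !inE; have -> // : all (fun r => mbit w (nth false A) r) (iota 0 n).
  by apply/allP => r; rewrite mem_iota add0n /= /mbit lead_encode => /all1.
rewrite inE; case: (nth _ _ _) => //=; apply/negbTE; rewrite negb_and; apply/orP; left.
by apply/allPn; exists c; rewrite ?mem_iota // /mbit lead_encode bc.
Qed.

Lemma mleaf_rel A : size A = n * n.+1 -> (mleaf rv w (nth false A) <-> mrel (ends n n A).1 (ends n n A).2).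
Proof.
move=> sA; rewrite /mleaf !mok_bs mmove_bs (mend_ends false sA) (mfin_ends sA) /mrel /=.
by split=> [/and3P[]|[h1 h2 h3]]; [|apply/and3P].
Qed.

Lemma reach_conn r oX oY : reach n mrel r oX oY <-> conn pok pmove (2 ^ r) (cset oX set0) (cset oY [set z]).
Proof.
elim: r oX oY => [|r IH] oX oY.
  split=> [[h1 h2 /orP[/eqP E|h3]]|[[|Q [|Q' Ps]] [/= p l o sz]]] //.
  - by exists [::]; split=> //=; rewrite h1.
  - by exists [:: cset oY [set z]]; split=> //=; rewrite ?h1 ?h2 ?h3.
  - by split; rewrite -?l ?eqxx //; case/andP: o.
  - by case/and3P: o => o1 o2 _; rewrite andbT in p; split; rewrite -?l ?p ?orbT.
rewrite expnS mul2n -addnn; split=> [[C [sC /IH h1 /IH h2]]|/conn_double[C [h1 h2]]].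
  by apply/conn_double; exists (bs (nth false C)).
pose D := mkseq (fun i => if (insub i : option 'I_n) is Some u then u \in C else false) n.
have DE : bs (nth false D) = C.
  by apply/setP => u; rewrite inE nth_mkseq // valK.
by exists D; split; [rewrite size_mkseq|apply/IH; rewrite /= DE|apply/IH; rewrite /= DE].
Qed.

Lemma membership_qval : qval (muniv w) (fun A => mleaf rv w (nth false A)) (mnv w) [::] <->
  exists Ps, pebbling pmove z Ps /\ all pok (set0 :: Ps).
Proof.
have univE i : i < n * n.+1 -> muniv w i = (i %% n.+1 == n) by rewrite /muniv lead_encode.
have S := qval_savitch (R := 0) (A := [::]) univE mleaf_rel (add0n n) erefl.
rewrite /mnv lead_encode; apply: (iff_trans S); apply: (iff_trans (reach_conn _ _ _)) => /=.
split=> [[Ps [p l o _]]|[Ps [/andP[p /eqP l] o]]]; first by exists Ps; rewrite /pebbling p l eqxx.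
have := conn_short p l o; suff -> : #|{set 'I_n}| = 2 ^ n by [].
by rewrite -cardsT -powersetT card_powerset cardsT card_ord.
Qed.

Lemma pok_space Ps : all pok (set0 :: Ps) = (0 <= s)%R && (pebbling_space Ps <= a).
Proof.
have -> : all pok (set0 :: Ps) = (0 <= s)%R && all (fun P : {set 'I_n} => #|P| <= a) (set0 :: Ps).
  by case h : (0 <= s)%R => //=; rewrite /pok h.
congr (_ && _); rewrite /pebbling_space; elim: (set0 :: Ps) => [|P l IH]; first by rewrite big_nil.
by rewrite big_cons geq_max /= IH.
Qed.

End Instance.

Definition gmove (rv : bool) (V : finType) (e : rel V) : rel {set V} := if rv then reversible_move e else standard_move e.

(** The machine decides the threshold [s] itself; since [K] is positive, a price of at least [s + K]
    rules out pebblings of space [s]. *)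
Theorem pebbling_pspace rv K : 0 < K -> PSPACE (gap_pebbling_price (gmove rv) K).
Proof.
move=> K0; apply: (pspace_def (nv := mnv) (univ := muniv) (L := mleaf rv)).
- exact: mnv_def.
- exact: muniv_def.
- exact: mleaf_def.
- move=> w [n [e [s [z [k [-> [_ _ sz [[Ps pPs sPs] _] ks]]]]]]]; apply/(membership_qval rv s sz).
  exists Ps; split; first exact: pPs.
  by rewrite pok_space sPs; case: s ks => // s' ks; rewrite lez_nat in ks.
move=> w [n [e [s [z [k [-> [_ _ sz [_ low] ks]]]]]]]; apply/negP => /(membership_qval rv s sz) [Ps [pPs]].
rewrite pok_space => /andP[s0]; have := low Ps pPs; case: s s0 ks => // s' _ ks h1 h2.
have sk : s' + K <= k by rewrite -lez_nat.
have ks' : k <= s' := leq_trans h1 h2.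
by lia.
Qed.

Theorem theorem3p4 (K : nat) (hK : 0 < K) :
  PSPACE_complete (gap_pebbling_price standard_move K) /\
  PSPACE_complete (gap_pebbling_price reversible_move K).
Proof.
split; split.
- exact: (pebbling_pspace false hK).
- by apply: (pebbling_hard hK) => V e P P' //; exact: reversible_standard.
- exact: (pebbling_pspace true hK).
- by apply: (pebbling_hard hK) => V e P P' //; exact: reversible_standard.
Qed.
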